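(* Let $q$ be a power of a prime $p$ and let $G<GL(V)$ be a (not necessarily irreducible) $p$-exceptional group preserving a tensor-induced decomposition $V=V_1\otimes V_2\otimes\cdots\otimes V_t$ over $\mathbb{F}_q$, where each $\dim V_i=m\ge2$ and $t\ge2$. Then $p=2$ and one of the following holds: (i) $t=4$ and $m=q=2$; (ii) $t=3$ and $m\in\{2,3\}$; moreover $q=2$ if $m=3$, and $q\le4$ if $m=2$; (iii) $t=2$ and $m\in\{2,3\}$; moreover $q\le8$ if $m=3$.
   Context: Given $V_1=\mathbb{F}_q^m$ and $V=V_1\otimes\cdots\otimes V_t$ with all $V_i\cong V_1$ (identified via fixed bases), the group $(GL(V_1)\circ\cdots\circ GL(V_t)).S_t$ acts on $V$, the central product acting factorwise and $S_t$ permuting the tensor factors. $G$ preserves the tensor-induced decomposition if $G$ is a subgroup of this group. $G\le GL(V)$ is $p$-exceptional if $p$ divides $|G|$ and every orbit of $G$ on $V$ has size coprime to $p$. *)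

(* Defs.v *)
From HB Require Import structures.
From mathcomp Require Import all_boot all_order all_algebra all_fingroup all_field.
Set Implicit Arguments. Unset Strict Implicit. Unset Printing Implicit Defensive.
Import GRing.Theory.
Local Open Scope ring_scope.

(* V = V_1 (x) ... (x) V_t with V_i = F^m (fixed standard bases):
   coordinates of a vector are indexed by basis tensors e_{f 0} (x) ... (x) e_{f (t-1)},
   i.e. by f : 'I_t -> 'I_m. *)
Notation tensV F m t := {ffun {ffun 'I_t -> 'I_m} -> F}.

(* The action of (A_0, ..., A_{t-1}) in GL(V_1) x ... x GL(V_t) on V:
   A_0 (x) ... (x) A_{t-1}, acting on column coordinates. *)
Definition tens_act (F : fieldType) (m t : nat) (A : 'I_t -> 'M[F]_m)
  (v : tensV F m t) : tensV F m t :=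
  [ffun g : {ffun 'I_t -> 'I_m} => \sum_(f : {ffun 'I_t -> 'I_m}) (\prod_(i < t) A i (g i) (f i)) * v f].

Definition perm_act (F : fieldType) (m t : nat) (s : 'S_t)
  (v : tensV F m t) : tensV F m t :=
  [ffun g : {ffun 'I_t -> 'I_m} => v [ffun i => g (s i)]].

Definition in_tensor_induced (F : finFieldType) (m t : nat)
  (x : {perm tensV F m t}) : Prop :=
  exists (A : 'I_t -> 'M[F]_m) (s : 'S_t),
    (forall i, A i \in unitmx) /\ forall v, x v = tens_act A (perm_act s v).

Definition preserves_tensor_induced (F : finFieldType) (m t : nat)
  (G : {group {perm tensV F m t}}) : Prop :=
  forall x, x \in G -> in_tensor_induced x.

Definition p_exceptional (T : finType) (p : nat) (G : {group {perm T}}) : Prop :=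
  (p %| #|G|)%N /\ forall v : T, coprime #|orbit 'P G v| p.

(* Main.v *)
(* Let H be the kernel of the action of G on the tensor positions.  As all
   orbits have size prime to p, every vector is fixed by a conjugate of any
   given p-element of G; every exclusion applies this to a suitable vector.

   If p divides |H|, flattening V at a position turns H into a p-exceptional
   group of maps X |-> A X B on matrices.  The fixator of X acts on the row
   space of X as the contragredient of its action on the column space; testing
   this on matrices of rank at most 2 leaves only p = m = t = 2.

   Otherwise an element x of order p moves some positions.
   - t >= 7: the conjugates of x are too few for their fixed spaces to cover V.
   - p odd, t <= 6: a tensor with blocks {0,1}, {2,3}, {4}, {5} of coupled
     positions has a fixator acting on the positions as a 2-group.
   - p = 2 and 4 <= t <= 6, or t = 3 <= m: let x swap a, b and fix c.  A tensor
     entangling a, b, c whose fixator must fix the position c contradicts the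
     row/column argument for the flattening at c.
   - p = 2, t = 3, m = 2: counting conjugates of x again, now using that an
     odd-order subgroup of GL_2(q), q even, has a regular orbit on vectors.
   - p = 2, t = 2: x becomes matrix transposition, and the parts of H generate a
     group D of odd order such that every matrix X has a symmetric multiple c X
     with c in D.  This passes to the action of D on subspaces.  In dimension 2
     it makes D sharply transitive on nonzero vectors; in dimension 3 and for
     q >= 4 it makes D transitive of order (q^3 - 1)(q + 1), which leaves too few
     elements without eigenvector; in dimension 4 over F_2 it gives |D| > 21,
     too large for an odd-order subgroup of GL_4(2). *)
Require Import Defs.
From HB Require Import structures.
From mathcomp Require Import all_boot all_order all_algebra all_fingroup all_field.
From mathcomp Require Import all_solvable mxabelem ring zify.
Set Implicit Arguments. Unset Strict Implicit. Unset Printing Implicit Defensive.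
Import GRing.Theory.

(** * Tensor-induced operators *)

(** The components of a tensor-induced map are determined only up to scalars of product 1, and every
    argument has to survive this ambiguity. In characteristic p each scalar has a p-th root, so an
    element of order p acting as X |-> A X B can be rescaled until A and B are unipotent.
    Determinants of 2 x 2 cores enter only through a product that the ambiguity leaves alone. For p
    = 2 stray scalars c with c^2 = 1 disappear. A test vector must have a controllable fixator while
    x acts on it visibly. Two invariants of tensor-induced maps give the control: the sets of
    positions along which a tensor decomposes, and the ranks of its flattenings. For t = 2 the only
    information on D is that it symmetrizes. Comparing the numbers of invertible and of invertible
    symmetric matrices bounds |D| from below, and oddness sharpens the bound: an odd quotient is 1
    or at least 3. *)

Section TensorOperators.
Local Open Scope ring_scope.
Variables (F : finFieldType) (m t : nat).
Implicit Types (A B : 'I_t -> 'M[F]_m) (s r : 'S_t) (v : tensV F m t).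
Implicit Types (x y : {perm tensV F m t}).

Definition dlt (f : {ffun 'I_t -> 'I_m}) : tensV F m t := [ffun g => (g == f)%:R].

Lemma tens_act_dlt A f g : tens_act A (dlt f) g = \prod_i A i (g i) (f i).
Proof.
rewrite ffunE (bigD1 f) //= ffunE eqxx mulr1 [X in _ + X]big1 ?addr0 // => h /negbTE hf.
by rewrite ffunE hf mulr0.
Qed.

Lemma tens_actM A B v :
  tens_act A (tens_act B v) = tens_act (fun i => A i *m B i) v.
Proof.
apply/ffunP => g; rewrite !ffunE.
under eq_bigr do rewrite ffunE big_distrr /=.
rewrite exchange_big /=; apply: eq_bigr => h _.
under eq_bigr do rewrite mulrA -big_split /=.
rewrite -big_distrl /=; congr (_ * _).
under [RHS]eq_bigr do rewrite mxE.
by rewrite bigA_distr_bigA.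
Qed.

Lemma eq_tens_act A B : (forall i, A i = B i) -> tens_act A =1 tens_act B.
Proof.
move=> eAB v; apply/ffunP => g; rewrite !ffunE; apply: eq_bigr => f _.
by congr (_ * _); apply: eq_bigr => i _; rewrite eAB.
Qed.

Lemma tens_act1 v : tens_act (fun=> 1%:M) v = v.
Proof.
apply/ffunP => g; rewrite ffunE (bigD1 g) //= [X in _ + X]big1 => [|f fg].
  by rewrite addr0 big1 ?mul1r // => i _; rewrite mxE eqxx.
 rewrite (_ : \prod_i _ = 0) ?mul0r //.
have [i gi] : exists i, g i != f i.
  apply/existsP; rewrite -negb_forall; apply: contra fg => /forallP e.
  by apply/eqP/ffunP => i; rewrite (eqP (e i)).
by rewrite (bigD1 i) //= mxE (negbTE gi) mul0r.
Qed.

Lemma perm_actM s r v : perm_act s (perm_act r v) = perm_act (r * s)%g v.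
Proof.
apply/ffunP => g; rewrite !ffunE; congr (v _); apply/ffunP => i.
by rewrite !ffunE permM.
Qed.

Lemma perm_act1 v : perm_act 1%g v = v.
Proof.
apply/ffunP => g; rewrite ffunE; congr (v _); apply/ffunP => i.
by rewrite ffunE perm1.
Qed.

Lemma perm_tens_act s A v :
  perm_act s (tens_act A v) = tens_act (fun i => A (s^-1%g i)) (perm_act s v).
Proof.
apply/ffunP => g; rewrite !ffunE.
pose h (f : {ffun 'I_t -> 'I_m}) : {ffun 'I_t -> 'I_m} := [ffun i => f (s i)].
pose k (f : {ffun 'I_t -> 'I_m}) : {ffun 'I_t -> 'I_m} := [ffun i => f (s^-1%g i)].
have hk : cancel k h by move=> f; apply/ffunP => i; rewrite !ffunE permK.
have kh : cancel h k by move=> f; apply/ffunP => i; rewrite !ffunE permKV.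
rewrite (reindex h) /=; last by exists k => f _.
apply: eq_bigr => f _; rewrite !ffunE; congr (_ * _).
rewrite (reindex_inj (@perm_inj _ s^-1%g)) /=; apply: eq_bigr => i _.
by rewrite !ffunE permKV.
Qed.

Lemma perm_act_dlt s f : perm_act s (dlt f) = dlt [ffun i => f (s^-1%g i)].
Proof.
apply/ffunP => g; rewrite !ffunE; congr (_%:R); congr nat_of_bool.
apply/eqP/eqP => [<-|->]; apply/ffunP => i; rewrite !ffunE.
  by rewrite permKV.
by rewrite permK.
Qed.

(** A relation, because [x] determines the components [A] only up to scalars ([rep_scalar]); [s] is
    unique as soon as [m > 1] ([rep_perm_uniq]). *)
Definition rep x A s := (forall i, A i \in unitmx) /\ forall v, x v = tens_act A (perm_act s v).

Lemma rep1 : rep 1%g (fun=> 1%:M) 1%g.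
Proof.
by split=> [i|v]; rewrite ?unitmx1 // perm1 perm_act1 tens_act1.
Qed.

Lemma repM x A s y B r : rep x A s -> rep y B r ->
  rep (x * y)%g (fun i => B i *m A (r^-1%g i)) (s * r)%g.
Proof.
move=> [uA xA] [uB yB]; split=> [i|v]; first by rewrite unitmx_mul uB uA.
by rewrite permM yB xA perm_tens_act tens_actM perm_actM.
Qed.

Lemma rep_act_dlt x A s f g : rep x A s ->
  x (dlt f) g = \prod_i A i (g i) (f (s^-1%g i)).
Proof.
move=> [_ ->]; rewrite perm_act_dlt tens_act_dlt.
by apply: eq_bigr => i _; rewrite ffunE.
Qed.

Lemma repV x A s : rep x A s -> rep x^-1%g (fun i => invmx (A (s i))) s^-1%g.
Proof.
move=> [uA xA]; split=> [i|v]; first by rewrite unitmx_inv.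
apply: (@perm_inj _ x); rewrite permKV xA perm_tens_act perm_actM mulVg perm_act1.
rewrite tens_actM; under eq_tens_act => i do rewrite permKV mulmxV //.
by rewrite tens_act1.
Qed.

Lemma rep1_perm A s : (1 < m)%N -> rep 1%g A s -> s = 1%g.
Proof.
move=> m1 rA; apply/permP => i0; rewrite perm1.
apply/eqP; apply/negP => /negP si; set i := s i0.
have Vi : s^-1%g i = i0 by rewrite permK.
have E f g := rep_act_dlt f g rA.
(* The diagonal coefficient at a basis tensor with index a at [i] and b at [i0 != i] equals 1 and
   contains the factor [A i a b]. *)
have nz a b : A i a b != 0.
  pose f0 : {ffun 'I_t -> 'I_m} := [ffun k => if k == i then a else b].
  have := E f0 f0; rewrite perm1 ffunE eqxx (bigD1 i) //= Vi !ffunE eqxx.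
  rewrite [i0 == i]eq_sym (negbTE si) => e; apply/negP => /eqP h.
  by move/eqP: e; rewrite h mul0r oner_eq0.
pose z := Ordinal (ltnW m1); pose o := Ordinal m1.
(* The coefficients of [dlt f] at f and at g differ only in the factor at [i], which is nonzero in
   both; yet one is 1 and the other 0. *)
pose f : {ffun 'I_t -> 'I_m} := [ffun=> z].
pose g : {ffun 'I_t -> 'I_m} := [ffun k => if k == i then o else z].
have := E f g; rewrite perm1 ffunE (_ : (g == f) = false); last first.
  by apply/negP => /eqP/ffunP/(_ i); rewrite !ffunE eqxx => /(congr1 val).
have := E f f; rewrite perm1 ffunE eqxx (bigD1 i) //= [\prod_i _](bigD1 i) //=.
rewrite [in X in _ -> _ = X -> _](eq_bigr (fun k => A k (f k) (f (s^-1%g k)))); last first.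
  by move=> k /negbTE ki; rewrite !ffunE ki.
set P := \prod_(_ < _ | _) _ => /eqP e1 /esym/eqP.
rewrite mulf_eq0 (negbTE (nz _ _)) /= => /eqP P0.
by move: e1; rewrite P0 mulr0 oner_eq0.
Qed.

Lemma rep_perm_uniq x A s B r : (1 < m)%N -> rep x A s -> rep x B r -> s = r.
Proof.
move=> m1 rA rB; have := repM rA (repV rB); rewrite mulgV => /(rep1_perm m1) e.
by rewrite -(mulgKV r s) e mul1g.
Qed.

Lemma rep1_scalar A i : rep 1%g A 1%g -> exists c, A i = c%:M.
Proof.
case=> uA rA.
have E (f g : {ffun 'I_t -> 'I_m}) : (g == f)%:R = \prod_i A i (g i) (f i) :> F.
  have := rA (dlt f); rewrite perm1 perm_act1 => /ffunP/(_ g).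
  by rewrite tens_act_dlt ffunE.
pose upd (f : {ffun 'I_t -> 'I_m}) a : {ffun 'I_t -> 'I_m} := [ffun k => if k == i then a else f k].
case: m @upd A uA rA E => [|n] upd A uA rA E.
  by exists 0; apply/matrixP => -[].
pose f0 : {ffun 'I_t -> 'I_n.+1} := [ffun=> ord0].
(* Only the index at [i] varies, so coefficients of the identity are entries of [A i] times one
   common factor. *)
have U a b : \prod_j A j (upd f0 a j) (upd f0 b j) = A i a b * \prod_(j | j != i) A j ord0 ord0.
  rewrite (bigD1 i) //= !ffunE eqxx; congr (_ * _); apply: eq_bigr => j /negbTE ji.
  by rewrite !ffunE ji.
set P := \prod_(j | _) _ in U.
have D a : A i a a * P = 1 by rewrite -U -E eqxx.
have Pn : P != 0 by apply/eqP => h; move/eqP: (D ord0); rewrite h mulr0 eq_sym oner_eq0.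
exists P^-1; apply/matrixP => a b; rewrite !mxE; have [<-|ab] := eqVneq a b.
  by apply: (mulIf Pn); rewrite D mulVf.
apply: (mulIf Pn); rewrite mul0r -U -E (_ : (_ == _) = false) //.
apply/negP => /eqP/ffunP/(_ i); rewrite !ffunE eqxx => /eqP.
by rewrite (negbTE ab).
Qed.

Lemma rep_scalar x A B s i : rep x A s -> rep x B s -> exists2 c, c != 0 & A i = c *: B i.
Proof.
move=> rA rB; have := repM (repV rB) rA; rewrite !mulVg => rM.
have [c] := rep1_scalar i rM; rewrite ?permKV => e; have uB := rB.1 i.
have cE : A i = c *: B i.
  by rewrite -[LHS]mulmx1 -(mulVmx uB) mulmxA e mul_scalar_mx.
have [c0|cn] := eqVneq c 0; last by exists c.
(* A zero scalar forces [m = 0], where all matrices are equal and any nonzero scalar serves. *)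
exists 1; rewrite ?oner_eq0 // scale1r; have := rA.1 i; rewrite cE c0 scale0r.
case: (m) (B i) => [|n] Bi; first by rewrite [Bi]flatmx0 => _; exact: flatmx0.
by rewrite unitmxE det0 unitr0.
Qed.

End TensorOperators.

(** * Orbits of length prime to p and Sylow subgroups *)

Section PrimeIndexOrbits.
Local Open Scope group_scope.
Variables (gT : finGroupType) (rT : finType) (to : {action gT &-> rT}).
Variables (G L : {group gT}) (p : nat) (v : rT).
Hypotheses (sLG : L \subset G) (sCL : 'C_G[v | to] \subset L).
Hypothesis (cop : coprime #|orbit to G v| p).

(** As [L] contains the stabiliser C of [v], the index |L : C| divides |G : C|. *)
Lemma orbit_sub_coprime : coprime #|orbit to L v| p.
Proof.
apply: coprime_dvdl cop; rewrite !card_orbit.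
have -> : 'C_L[v | to] = 'C_G[v | to].
  apply/eqP; rewrite eqEsubset setSI // subsetI sCL; exact: subsetIr.
by rewrite -(Lagrange_index sLG sCL) dvdn_mull.
Qed.

(** The stabiliser has index prime to p in [L], so it contains a Sylow p-subgroup of [L], into which
    every p-element can be conjugated. *)
Lemma p_elt_conj_astab1 x : prime p -> x \in L -> p.-elt x ->
  exists2 g, g \in L & x ^ g \in 'C_L[v | to].
Proof.
move=> pr_p xL px; have [P sylP] := Sylow_exists p 'C_L[v | to]%G.
have sPC := pHall_sub sylP.
have sPL : P \subset L := subset_trans sPC (subsetIl _ _).
have sylPL : p.-Sylow(L) P.
  rewrite pHallE sPL (card_Hall sylP) /=.
  have e : #|L| = (#|'C_L[v | to]| * #|orbit to L v|)%N by rewrite card_orbit Lagrange ?subsetIl.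
  rewrite e partnM ?cardG_gt0 //; last by rewrite card_orbit indexg_gt0.
  rewrite [X in _ == (_ * X)%N]part_p'nat ?muln1 //.
  by rewrite p'natE // -prime_coprime // coprime_sym orbit_sub_coprime.
have sx : <[x]> \subset L by rewrite cycle_subG.
have [g gL sg] := Sylow_Jsub sylPL sx px.
by exists g => //; apply: (subsetP sPC); apply: (subsetP sg); rewrite memJ_conjg cycle_id.
Qed.

End PrimeIndexOrbits.

(** Lets the orbit of a test tensor control an orbit on positions or on sets of positions; the
    action on these is defined only on the subgroup [D] of tensor-induced maps. *)
Lemma orbit_dvd_orbit (gT : finGroupType) (rT rT' : finType) (D : {group gT})
    (to : {action gT &-> rT}) (to' : action D rT') (G : {group gT}) v z :
    G \subset D -> 'C_G[v | to]%g \subset 'C_G[z | to']%g ->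
  #|orbit to' G z| %| #|orbit to G v|.
Proof.
move=> sGD sC; rewrite card_orbit card_orbit_in //.
by rewrite -(Lagrange_index (subsetIl G 'C[z | to']%g) sC) dvdn_mulr.
Qed.

(** With C the stabiliser in [G], the orbit length under [H] is |HC : C|, an intermediate index. *)
Lemma normal_orbit_dvd (gT : finGroupType) (rT : finType)
    (to : {action gT &-> rT}) (G H : {group gT}) v :
  (H <| G)%g -> #|orbit to H v| %| #|orbit to G v|.
Proof.
move=> /andP[sHG nHG]; rewrite !card_orbit.
set C := 'C_G[v | to]%G; have nCH : C \subset 'N(H)%g by apply: subset_trans nHG; exact: subsetIl.
have -> : 'C_H[v | to]%g = (H :&: C)%g by rewrite /= setIA (setIidPl sHG).
rewrite indexgI -(indexMg C H) -norm_joinEl //.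
by rewrite -(@Lagrange_index _ G (C <*> H)%G C) ?dvdn_mull ?joing_subl //= join_subG sHG subsetIl.
Qed.

(** * The homomorphism to permutations of the positions *)

Section PositionMorphism.
Local Open Scope ring_scope.
Variables (F : finFieldType) (m t : nat).
Hypothesis m1 : (1 < m)%N.
Implicit Types (x y : {perm tensV F m t}) (s : 'S_t).

Definition repb x s := [exists A : {ffun 'I_t -> 'M[F]_m},
  [forall i, A i \in unitmx] && [forall v, x v == tens_act A (perm_act s v)]].

Lemma repbP x s : reflect (exists A, rep x A s) (repb x s).
Proof.
apply: (iffP existsP) => [[A /andP[/forallP uA /forallP e]]|[A [uA e]]].
  by exists A; split=> [i|v]; rewrite ?uA // (eqP (e v)).
exists (finfun A); apply/andP; split; first by apply/forallP => i; rewrite ffunE.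
by apply/forallP => v; rewrite e; apply/eqP/eq_tens_act => i; rewrite ffunE.
Qed.

Definition tensor_group := [set x : {perm tensV F m t} | [exists s, repb x s]].

Lemma tensor_groupP x : reflect (exists A s, rep x A s) (x \in tensor_group).
Proof.
rewrite inE; apply: (iffP existsP) => [[s /repbP[A r]]|[A [s r]]]; first by exists A, s.
by exists s; apply/repbP; exists A.
Qed.

Lemma tensor_group_set : group_set tensor_group.
Proof.
apply/group_setP; split; first by apply/tensor_groupP; do 2 eexists; exact: rep1.
move=> x y /tensor_groupP[A [s r]] /tensor_groupP[B [s' r']]; apply/tensor_groupP; do 2 eexists; exact: repM r r'.
Qed.
Canonical tensor_group_group := Group tensor_group_set.

(* The permutation of the positions induced by x (1 if x is not tensor-induced). *)
Definition sg x : 'S_t := odflt 1%g [pick s | repb x s].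

Lemma sgE x A s : rep x A s -> sg x = s.
Proof.
move=> r; rewrite /sg; case: pickP => [s' /repbP[B r']|/(_ s)/repbP[]]; last by exists A.
exact: rep_perm_uniq m1 r' r.
Qed.

Lemma sg_rep x : x \in tensor_group -> exists A, rep x A (sg x).
Proof. by case/tensor_groupP=> A [s r]; exists A; rewrite (sgE r). Qed.

Lemma sgM : {in tensor_group &, {morph sg : x y / (x * y)%g}}.
Proof. by move=> x y /sg_rep[A r] /sg_rep[B r']; rewrite (sgE (repM r r')). Qed.

Definition sgm := Morphism sgM.

End PositionMorphism.

(** * Two-sided multiplications *)

Section TwoSided.
Local Open Scope ring_scope.
Variables (F : finFieldType) (T : finType).

Definition two_sided a b (phi : T -> 'M[F]_(a, b)) (g : {perm T}) (A : 'M[F]_a) (B : 'M[F]_b) :=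
  [/\ A \in unitmx, B \in unitmx & forall v, phi (g v) = A *m phi v *m B].

Definition two_sided_group a b (phi : T -> 'M[F]_(a, b)) (L : {set {perm T}}) :=
  forall g, g \in L -> exists A B, two_sided phi g A B.

Lemma two_sidedM a b (phi : T -> 'M[F]_(a, b)) g h A B A' B' :
  two_sided phi g A B -> two_sided phi h A' B' ->
  two_sided phi (g * h)%g (A' *m A) (B *m B').
Proof.
move=> [uA uB e] [uA' uB' e']; split=> [||v]; rewrite ?unitmx_mul ?uA ?uA' ?uB ?uB' //.
by rewrite permM e' e !mulmxA.
Qed.

Lemma two_sidedV a b (phi : T -> 'M[F]_(a, b)) g A B :
  two_sided phi g A B -> two_sided phi g^-1%g (invmx A) (invmx B).
Proof.
move=> [uA uB e]; split=> [||v]; rewrite ?unitmx_inv //.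
rewrite -[in RHS](permKV g v) e !mulmxA mulVmx // mul1mx -mulmxA mulmxV // mulmx1 //.
Qed.

Lemma two_sided1 a b (phi : T -> 'M[F]_(a, b)) : two_sided phi 1%g 1%:M 1%:M.
Proof. by split=> [||v]; rewrite ?unitmx1 // perm1 mul1mx mulmx1. Qed.

Lemma two_sided_tr a b (phi : T -> 'M[F]_(a, b)) g A B :
  two_sided phi g A B -> two_sided (fun v => (phi v)^T) g B^T A^T.
Proof.
by move=> [uA uB e]; split=> [||v]; rewrite ?unitmx_tr // e !trmx_mul mulmxA.
Qed.

Lemma two_sided_group_tr a b (phi : T -> 'M[F]_(a, b)) L :
  two_sided_group phi L -> two_sided_group (fun v => (phi v)^T) L.
Proof. by move=> h g /h[A [B r]]; do 2 eexists; exact: two_sided_tr r. Qed.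

Section Transfer.
Variables (a b p : nat) (phi : T -> 'M[F]_(a, b)) (L : {group {perm T}}) (v0 : T).
Hypotheses (pr_p : prime p) (inj_phi : injective phi) (actL : two_sided_group phi L).
Hypothesis cop : coprime #|orbit 'P L v0| p.
Let X := phi v0.

(** The stabiliser of both the column space and the row space of [X]. [R] is required to be
    invertible because it is not unique when the columns of [X] are dependent. *)
Definition stab_spaces : {set {perm T}} :=
  [set g in L | [exists A, exists B, exists R, exists C,
    [&& A \in unitmx, B \in unitmx, R \in unitmx,
        [forall v, phi (g v) == A *m phi v *m B], A *m X == X *m R & X *m B == C *m X]]].

Lemma stab_spacesP g : reflect (g \in L /\ exists A B R C,
    [/\ two_sided phi g A B, R \in unitmx, A *m X = X *m R & X *m B = C *m X])
  (g \in stab_spaces).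
Proof.
rewrite inE; apply: (iffP andP).
  case=> gL /existsP[A /existsP[B /existsP[R /existsP[C]]]].
  case/and3P => uA uB /and4P[uR /forallP e /eqP eA /eqP eB]; split=> //; exists A, B, R, C.
  by split=> //; split=> // v; apply/eqP.
case=> gL [A [B [R [C [[uA uB e] uR eA eB]]]]]; split=> //.
apply/existsP; exists A; apply/existsP; exists B; apply/existsP; exists R; apply/existsP; exists C.
by rewrite uA uB uR eA eB !eqxx /= andbT; apply/forallP => v; apply/eqP.
Qed.

Lemma stab_spaces_group_set : group_set stab_spaces.
Proof.
apply/group_setP; split.
  apply/stab_spacesP; split; first exact: group1.
  exists 1%:M, 1%:M, 1%:M, 1%:M; split; rewrite ?unitmx1 ?mul1mx ?mulmx1 //.
  exact: two_sided1.
move=> g h /stab_spacesP[gL [A [B [R [C [r uR eA eB]]]]]].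
move=> /stab_spacesP[hL [A' [B' [R' [C' [r' uR' eA' eB']]]]]].
apply/stab_spacesP; split; first exact: groupM.
exists (A' *m A), (B *m B'), (R' *m R), (C *m C'); split.
- exact: two_sidedM.
- by rewrite unitmx_mul uR uR'.
- by rewrite -mulmxA eA mulmxA eA' mulmxA.
- by rewrite mulmxA eB -mulmxA eB' mulmxA.
Qed.
Canonical stab_spaces_group := Group stab_spaces_group_set.

(* A fixator of v0 acts on the row space of X as the contragredient of its
   action on the column space, and every p-element stabilising both spaces is
   conjugate, within the stabiliser of both, to a fixator of v0. *)
Lemma col_fixed_row_fixed x A B C : x \in L -> (p.-elt x)%g -> two_sided phi x A B ->
  A *m X = X -> X *m B = C *m X -> X *m B = X.
Proof.
move=> xL px rx eA eB.
have sSL : stab_spaces_group \subset L by apply/subsetP => g /stab_spacesP[].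
have xS : x \in stab_spaces_group.
  by apply/stab_spacesP; split=> //; exists A, B, 1%:M, C; rewrite unitmx1 mulmx1.
(* A fixator satisfies X = A1 X B1, so A1 X = X B1^-1 and X B1 = A1^-1 X. *)
have sC : 'C_L[v0 | 'P]%g \subset stab_spaces_group.
  apply/subsetP => g /setIP[gL /astab1P/= gv]; apply/stab_spacesP; split=> //.
  have [A1 [B1 r1]] := actL gL; have [uA uB e] := r1; exists A1, B1, (invmx B1), (invmx A1).
  have := e v0; rewrite (gv : g v0 = v0) -/X => eX.
  by split=> //; rewrite ?unitmx_inv // {2}eX ?mulmxK // -!mulmxA mulKmx.
have [g /stab_spacesP[gL [A1 [B1 [R [C1 [r1 uR eA1 eB1]]]]]]] :=
  p_elt_conj_astab1 sSL sC cop pr_p xS px.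
case/setIP => _ /astab1P /= fx.
have [uA1 uB1 _] := r1; have := two_sidedM (two_sidedV r1) (two_sidedM rx r1).
rewrite -conjgE => -[_ _ /(_ v0)]; rewrite (fx : (x ^ g)%g v0 = v0) -/X.
(* [invmx A1] preserves the column space, on which [A] is trivial; only the right factor of x^g
   remains in the fixing equation. *)
have e1 : A1 *m A *m invmx A1 *m X = X.
  have -> : A1 *m A *m invmx A1 *m X = A1 *m (A *m (invmx A1 *m X)) by rewrite !mulmxA.
  have -> : invmx A1 *m X = X *m invmx R.
    by apply: (canRL (mulmxK uR)); rewrite -mulmxA -eA1 mulKmx.
  by rewrite (mulmxA A) eA mulmxA eA1 mulmxK.
rewrite e1 => e2.
have e3 : X *m invmx B1 *m B = X *m invmx B1.
  by apply: (canRL (mulmxK uB1)); rewrite -!mulmxA -e2.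
have e4 : X = C1 *m (X *m invmx B1) by rewrite mulmxA -eB1 mulmxK.
by rewrite {1}e4 -mulmxA e3 -e4.
Qed.

End Transfer.

Lemma row_fixed_col_fixed a b p (phi : T -> 'M[F]_(a, b)) (L : {group {perm T}}) v0 x A B R :
  prime p -> injective phi -> two_sided_group phi L -> coprime #|orbit 'P L v0| p ->
  x \in L -> (p.-elt x)%g -> two_sided phi x A B ->
  phi v0 *m B = phi v0 -> A *m phi v0 = phi v0 *m R -> A *m phi v0 = phi v0.
Proof.
move=> pr_p inj aL cop xL px rx eB eA; apply: trmx_inj; rewrite trmx_mul.
apply: (@col_fixed_row_fixed _ _ p (fun v => (phi v)^T) L v0 pr_p _ cop x B^T A^T R^T xL px).
- exact: two_sided_group_tr.
- exact: two_sided_tr.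
- by rewrite -trmx_mul eB.
- by rewrite -!trmx_mul eA.
Qed.

End TwoSided.

Lemma sum_ord2 (V : nmodType) (f : 'I_2 -> V) : (\sum_i f i = f 0 + f 1)%R.
Proof. by rewrite big_ord_recl big_ord1; congr (_ + f _)%R; apply: val_inj. Qed.

Lemma det_mx22 (R : comNzRingType) (M : 'M[R]_2) :
  (\det M = M 0 0 * M 1 1 - M 0 1 * M 1 0)%R.
Proof.
rewrite (expand_det_row _ 0%R) sum_ord2 /cofactor !det_mx11 !mxE /=.
rewrite expr0 expr1 mul1r mulN1r mulrN; congr (_ * M _ _ - _ * M _ _)%R; exact: val_inj.
Qed.

(** * Determinants on 2 x 2 cores and the exclusion of odd p *)

Section DetClass.
Local Open Scope ring_scope.
Variables (F : finFieldType) (T : finType) (a b p : nat) (phi : T -> 'M[F]_(a, b)).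
Variables (L : {group {perm T}}) (Cc : 'M[F]_(a, 2)) (Cl : 'M[F]_(2, a)).
Variables (Rr : 'M[F]_(2, b)) (Rl : 'M[F]_(b, 2)).
Hypotheses (pr_p : prime p) (actL : two_sided_group phi L) (inj_phi : injective phi).
Hypotheses (ClK : Cl *m Cc = 1%:M) (RlK : Rr *m Rl = 1%:M).

Definition stab_pair (P : pred (F * F)) : {set {perm T}} :=
  [set g in L | [exists A, exists B, exists a2 : 'M[F]_2, exists b2 : 'M[F]_2,
    [&& A \in unitmx, B \in unitmx, [forall v, phi (g v) == A *m phi v *m B],
        A *m Cc == Cc *m a2, Rr *m B == b2 *m Rr & P (\det a2, \det b2)]]].

Lemma stab_pairP (P : pred (F * F)) g : reflect (g \in L /\ exists A B (a2 b2 : 'M[F]_2),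
    [/\ two_sided phi g A B, A *m Cc = Cc *m a2, Rr *m B = b2 *m Rr & P (\det a2, \det b2)])
  (g \in stab_pair P).
Proof.
rewrite inE; apply: (iffP andP).
  case=> gL /existsP[A /existsP[B /existsP[R /existsP[C]]]].
  case/and3P => uA uB /and4P[/forallP e /eqP eA /eqP eB hP]; split=> //; exists A, B, R, C.
  by split=> //; split=> // v; apply/eqP.
case=> gL [A [B [R [C [[uA uB e] eA eB hP]]]]]; split=> //.
apply/existsP; exists A; apply/existsP; exists B; apply/existsP; exists R; apply/existsP; exists C.
by rewrite uA uB eA eB !eqxx hP /= andbT; apply/forallP => v; apply/eqP.
Qed.

Lemma stab_pair_group_set (P : pred (F * F)) : P (1, 1) ->
  (forall x y x' y', P (x, y) -> P (x', y') -> P (x * x', y * y')) -> group_set (stab_pair P).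
Proof.
move=> P1 PM; apply/group_setP; split.
  apply/stab_pairP; split; first exact: group1.
  exists 1%:M, 1%:M, 1%:M, 1%:M; rewrite !det1 ?mul1mx ?mulmx1; split=> //.
  exact: two_sided1.
move=> g h /stab_pairP[gL [A [B [R [C [r eA eB hP]]]]]].
move=> /stab_pairP[hL [A' [B' [R' [C' [r' eA' eB' hP']]]]]].
apply/stab_pairP; split; first exact: groupM.
exists (A' *m A), (B *m B'), (R' *m R), (C *m C'); split.
- exact: two_sidedM.
- by rewrite -mulmxA eA mulmxA eA' mulmxA.
- by rewrite mulmxA eB -mulmxA eB' mulmxA.
- by rewrite !det_mulmx [X in (X, _)]mulrC; apply: PM.
Qed.

Lemma core_unitl A a2 : A \in unitmx -> A *m Cc = Cc *m a2 -> a2 \in unitmx.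
Proof.
move=> uA e; have : (Cl *m invmx A *m Cc) *m a2 = 1%:M.
  by rewrite -!mulmxA -e mulKmx.
by case/mulmx1_unit.
Qed.

Lemma core_unitr B b2 : B \in unitmx -> Rr *m B = b2 *m Rr -> b2 \in unitmx.
Proof.
move=> uB e; have : b2 *m (Rr *m invmx B *m Rl) = 1%:M.
  by rewrite !mulmxA -e mulmxK.
by case/mulmx1_unit.
Qed.

(** The pair (A, B) can be replaced by (c A, c^-1 B), which leaves the product of the two
    determinants unchanged. *)
Definition invpair : pred (F * F) := fun q => q.1 * q.2 == 1.

Lemma stab_pairT_group_set : group_set (stab_pair predT).
Proof. exact: stab_pair_group_set. Qed.
Canonical stab_pairT_group := Group stab_pairT_group_set.

Lemma invpair_group_set : group_set (stab_pair invpair).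
Proof.
apply: stab_pair_group_set; rewrite /invpair /= ?mulr1 // => x y x' y'.
by move=> /eqP e /eqP e'; rewrite mulrACA e e' mulr1.
Qed.
Canonical invpair_group := Group invpair_group_set.

(** Conjugation changes neither of the two determinants. *)
Lemma invpair_normal : (invpair_group <| stab_pairT_group)%g.
Proof.
apply/andP; split.
  apply/subsetP => g /stab_pairP[gL [A [B [R [C [r eA eB /eqP/= hP]]]]]].
  apply/stab_pairP; split=> //; exists A, B, R, C; split=> //.
apply/normsP => g gS; apply/eqP; rewrite eqEcard cardJg leqnn andbT.
apply/subsetP => _ /imsetP[h hQ ->].
case/stab_pairP: gS => gL [A [B [R [C [r eA eB _]]]]].
case/stab_pairP: hQ => hL [A1 [B1 [R1 [C1 [r1 eA1 eB1 /eqP/= hP]]]]].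
have r' := two_sidedV r; have [uA uB _] := r.
have uR := core_unitl uA eA; have uC := core_unitr uB eB.
have := uR; have := uC; rewrite !unitmxE !unitfE => n2 n1.
apply/stab_pairP; split; first by rewrite groupJ.
exists (A *m (A1 *m invmx A)), (invmx B *m B1 *m B), (R *m (R1 *m invmx R)), (invmx C *m C1 *m C).
split.
- by rewrite conjgE mulgA; exact: two_sidedM (two_sidedM r' r1) r.
- have e : invmx A *m Cc = Cc *m invmx R.
    by apply: (canRL (mulmxK uR)); rewrite -mulmxA -eA mulKmx.
  by rewrite -!mulmxA e (mulmxA A1) eA1 -!mulmxA (mulmxA A) eA -!mulmxA.
- have e : Rr *m invmx B = invmx C *m Rr.
    by apply: (canRL (mulKmx uC)); rewrite mulmxA -eB mulmxK.
  by rewrite !mulmxA e -(mulmxA _ Rr) eB1 !mulmxA -(mulmxA _ Rr) eB !mulmxA.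
- rewrite /invpair /= !det_mulmx !det_inv.
  by apply/eqP; rewrite -hP; field; rewrite n1 n2.
Qed.

(* Elements of invpair preserve the determinant of the 2 x 2 core M of Cc M Rr,
   so their p-elements fix cores of every determinant. *)
Lemma fixed_core x (M : 'M[F]_2) : bijective phi -> (forall v, coprime #|orbit 'P L v| p) ->
  x \in invpair_group -> (p.-elt x)%g -> M \in unitmx ->
  exists M' : 'M[F]_2, \det M' = \det M /\ forall v, phi v = Cc *m M' *m Rr -> x v = v.
Proof.
move=> [psi phiK psiK] cop xQ px uM; pose v0 := psi (Cc *m M *m Rr).
have v0E : phi v0 = Cc *m M *m Rr by rewrite psiK.
have sSL : stab_pairT_group \subset L by apply/subsetP => g /stab_pairP[].
have sC : 'C_L[v0 | 'P]%g \subset stab_pairT_group.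
  apply/subsetP => g /setIP[gL /astab1P/= gv]; apply/stab_pairP; split=> //.
  have [A [B r]] := actL gL; have [uA uB e] := r.
  have := e v0; rewrite (gv : g v0 = v0) v0E => eX.
  pose a2 := M *m (Rr *m invmx B *m Rl) *m invmx M.
  pose b2 := invmx M *m (Cl *m invmx A *m Cc) *m M.
  have eA : A *m Cc = Cc *m a2.
    have : A *m Cc *m M *m Rr = Cc *m M *m Rr *m invmx B.
      by rewrite eX mulmxK // !mulmxA.
    move=> /(congr1 (fun Y => Y *m Rl *m invmx M)).
    by rewrite -!(mulmxA _ Rr) RlK mulmx1 mulmxK // /a2 !mulmxA.
  have eB : Rr *m B = b2 *m Rr.
    have : invmx A *m (Cc *m M *m Rr) = Cc *m M *m (Rr *m B).
      by rewrite eX !mulmxA mulVmx // mul1mx.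
    move=> /(congr1 (fun Y => invmx M *m (Cl *m Y))).
    by rewrite !mulmxA -(mulmxA _ Cl Cc) ClK mulmx1 mulVmx // mul1mx => <-; rewrite /b2 !mulmxA.
  exists A, B, a2, b2; split=> //.
have cop' := coprime_dvdl (normal_orbit_dvd 'P v0 invpair_normal) (orbit_sub_coprime sSL sC (cop v0)).
have sQ : 'C_invpair_group[v0 | 'P]%g \subset invpair_group by exact: subsetIl.
have [g gQ] := p_elt_conj_astab1 (subxx _) sQ cop' pr_p xQ px.
case/setIP=> _ /astab1P /= fx.
have : (g^-1)%g \in invpair_group by rewrite groupV.
case/stab_pairP => _ [A [B [a2 [b2 [[uA uB e] eA eB /eqP/= hP]]]]].
exists (a2 *m M *m b2); split.
  by rewrite !det_mulmx mulrAC hP mul1r.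
move=> v ve; have <- : (g^-1)%g v0 = v.
  by apply: inj_phi; rewrite e v0E ve !mulmxA eA -!mulmxA eB.
apply: (@perm_inj _ g); rewrite permKV -[in RHS](fx : (x ^ g)%g v0 = v0).
by rewrite conjgE !permM.
Qed.

(** For p odd, x fixes cores M1 and M2 of determinants 1 and e, with e not a square. Then M2 M1^-1
    commutes with the transvection J, so it is upper triangular with equal diagonal entries, and its
    determinant e is a square after all. *)
Lemma no_odd_core x A B (b2 : 'M[F]_2) : bijective phi -> (forall v, coprime #|orbit 'P L v| p) ->
  p \in [pchar F] -> x \in L -> (p.-elt x)%g -> two_sided phi x A B ->
  A *m Cc = Cc *m (1%:M + delta_mx 0 1) -> Rr *m B = b2 *m Rr -> \det b2 = 1 -> p = 2%N.
Proof.
move=> bij cop chp xL px rx eA eB db2; apply/eqP; apply: contraT => p2.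
set J := _ + _ in eA; have dJ : \det J = 1.
  by rewrite det_mx22 !mxE /=; ring.
have xQ : x \in invpair_group.
  by apply/stab_pairP; split=> //; exists A, B, J, b2; split; rewrite // /invpair /= dJ db2 mulr1.
(* Squaring identifies 1 and -1; not being injective on a finite field, it is not onto. *)
have [e eN] : exists e : F, e \notin [set y ^+ 2 | y in {: F}].
  apply/existsP; rewrite -negb_forall; apply/negP => /forallP h.
  have : {in {: F} &, injective (fun y : F => y ^+ 2)}.
    apply/imset_injP; apply/eqP; rewrite (_ : [set _ | _ in _] = setT) ?cardsT //.
    by apply/setP => y; rewrite h inE.
  move=> /(_ 1 (-1) isT isT); rewrite sqrrN => /(_ erefl)/eqP.
  rewrite -subr_eq0 opprK -mulr2n -(dvdn_pcharf chp) dvdn_prime2 //.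
  by rewrite (negbTE p2).
have e0 : e != 0 by apply: contraNneq eN => ->; apply/imsetP; exists 0; rewrite ?expr0n.
pose D : 'M[F]_2 := diag_mx (\row_i (if i == 0 then e else 1)).
have dD : \det D = e by rewrite det_diag big_ord_recl big_ord1 !mxE /= mulr1.
have uD : D \in unitmx by rewrite unitmxE dD unitfE.
have [M1 [d1 f1]] := fixed_core bij cop xQ px (unitmx1 _ _).
have [M2 [d2 f2]] := fixed_core bij cop xQ px uD.
have fixM M : (forall v, phi v = Cc *m M *m Rr -> x v = v) -> J *m M *m b2 = M.
  move=> f; case: bij => psi phiK psiK; pose v := psi (Cc *m M *m Rr).
  have ve : phi v = Cc *m M *m Rr by rewrite psiK.
  have [_ _ /(_ v)] := rx; rewrite f // ve !mulmxA eA -!mulmxA eB.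
  move=> /(congr1 (fun Y => Cl *m Y *m Rl)); rewrite !mulmxA ClK !mul1mx.
  by rewrite -!(mulmxA _ Rr) RlK !mulmx1.
have {}f1 := fixM _ f1; have {}f2 := fixM _ f2.
rewrite det1 in d1; rewrite dD in d2.
have u1 : M1 \in unitmx by rewrite unitmxE d1 unitr1.
have ub : b2 \in unitmx by rewrite unitmxE db2 unitr1.
have uJ : J \in unitmx by rewrite unitmxE dJ unitr1.
pose c := M2 *m invmx M1.
have cJ : c *m J = J *m c.
  apply: (can_inj (mulmxK u1)); apply: (can_inj (mulmxK ub)).
  rewrite -!(mulmxA J) mulmxKV // mulmxA f2 -(mulmxA c) -(mulmxA c) f1 mulmxKV //.
have dc : \det c = e by rewrite det_mulmx det_inv d1 d2 invr1 mulr1.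
have /matrixP := cJ; move: (c) dc => {cJ}c dc cJE.
have c10 : c 1 0 = 0.
  have := cJE 0 0; rewrite !mxE !sum_ord2 !mxE /= => h.
  by apply: (addrI (c 0 0)); move: h; rewrite ?(addr0, add0r, mulr1, mulr0, mul1r, mul0r).
have c01 : c 0 0 = c 1 1.
  have := cJE 0 1; rewrite !mxE !sum_ord2 !mxE /= => h.
  apply: (addIr (c 0 1)); rewrite [in RHS]addrC.
  by move: h; rewrite ?(addr0, add0r, mulr1, mulr0, mul1r, mul0r).
case/imsetP: eN; exists (c 0 0) => //.
by rewrite -dc det_mx22 c10 mulr0 subr0 -c01.
Qed.

End DetClass.

(** * Two-sided actions of elements of order p *)

Section Unipotent.
Local Open Scope ring_scope.
Variables (F : finFieldType).

(** If j + 2 is the least exponent killing [N], some column of [N ^+ j] survives one multiplication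
    by [N], but not two. *)
Lemma nilpotent_chain n (N : 'M[F]_n.+1) k : N ^+ k = 0 -> N != 0 ->
  exists u : 'cV_n.+1, N *m u != 0 /\ N *m (N *m u) = 0.
Proof.
move=> Nk N0; pose P k := N ^+ k == 0.
have [[|[|j]] /eqP Pj minj] := ex_minnP (ex_intro P k (introT eqP Nk)).
- by move/eqP: Pj; rewrite expr0 oner_eq0.
- by move/eqP: Pj; rewrite expr1 (negbTE N0).
have nz : N ^+ j.+1 != 0 by apply/negP => /(minj j.+1); rewrite ltnn.
have [i ni] : exists i, col i (N ^+ j.+1) != 0.
  apply/existsP; rewrite -negb_forall; apply: contra nz => /forallP h.
  apply/eqP/matrixP => r i; have /eqP/matrixP/(_ r 0) := h i; by rewrite !mxE.
exists (col i (N ^+ j)).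
have e s : N *m col i (N ^+ s) = col i (N ^+ s.+1).
  by rewrite !colE mulmxA -[N *m _]/(N * N ^+ s) -exprS.
by split; rewrite ?e // Pj colE mul0mx.
Qed.

(** For a chain u of N = A - 1, the columns N u and u carry a Jordan block of size 2. *)
Lemma unipotent_cols n (A : 'M[F]_n.+1) k : (A - 1%:M) ^+ k = 0 -> A != 1%:M ->
  exists (C : 'M_(n.+1, 2)) (Cl : 'M_(2, n.+1)),
    Cl *m C = 1%:M /\ A *m C = C *m (1%:M + delta_mx 0 1).
Proof.
move=> Ak A1; have N0 : A - 1%:M != 0 by rewrite subr_eq0.
have [u [nu nnu]] := nilpotent_chain Ak N0.
set N := A - 1%:M in nu nnu; have AE : A = 1%:M + N by rewrite /N addrC subrK.
pose C : 'M_(n.+1, 2) := \matrix_(i, j) (if j == 0 then (N *m u) i 0 else u i 0).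
have c0 : col 0 C = N *m u by apply/matrixP => i j; rewrite ord1 [LHS]mxE mxE.
have c1 : col 1 C = u by apply/matrixP => i j; rewrite ord1 [LHS]mxE mxE.
have fr : row_free C^T.
  apply: inj_row_free => v /(congr1 trmx); rewrite trmx_mul trmxK trmx0 => Cv.
  have E : v 0 0 *: (N *m u) + v 0 1 *: u = 0.
    rewrite -{2}c1 -c0 -Cv; apply/matrixP => i j.
    by rewrite !ord1 [RHS]mxE sum_ord2 !mxE ?ord1 mulrC [X in _ + X]mulrC.
  have v1 : v 0 1 = 0.
    move/(congr1 (mulmx N)): (E); rewrite mulmxDr -!scalemxAr nnu scaler0 add0r mulmx0.
    by move/eqP; rewrite scaler_eq0 (negbTE nu) orbF => /eqP.
  move: E; rewrite v1 scale0r addr0 => /eqP; rewrite scaler_eq0 (negbTE nu) orbF => /eqP v0.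
  apply/matrixP => i j; rewrite ord1 mxE.
  by case: (unliftP 0 j) => [k'|] ->; rewrite ?ord1 // -[RHS]v1; congr (v 0 _); apply: val_inj.
have [Cl /(congr1 trmx)] := row_freeP fr; rewrite trmx_mul trmxK trmx1 => e.
exists C, Cl^T; split=> //.
rewrite AE mulmxDl mulmxDr mul1mx mulmx1; congr (_ + _); apply/matrixP => i j.
have -> : (N *m C) i j = (N *m col j C) i 0.
  by rewrite !mxE; apply: eq_bigr => s _; rewrite !mxE.
rewrite [RHS]mxE sum_ord2 [delta_mx _ _ _ _]mxE [delta_mx _ _ _ _]mxE /= mulr0 addr0.
case: (unliftP 0 j) => [j'|] -> /=; last by rewrite c0 nnu mxE mulr0.
have -> : lift 0 j' = 1 by apply: val_inj; rewrite ord1.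
by rewrite c1 mulr1 -c0 mxE.
Qed.

Lemma unipotent_rows n (B : 'M[F]_n.+1) k : (B - 1%:M) ^+ k = 0 -> B != 1%:M ->
  exists (R : 'M_(2, n.+1)) (Rl : 'M_(n.+1, 2)),
    R *m Rl = 1%:M /\ R *m B = (1%:M + delta_mx 1 0) *m R.
Proof.
move=> Bk B1; have Bk' : (B^T - 1%:M) ^+ k = 0.
  rewrite -[1%:M]trmx1 -linearB /= -[LHS]trmxK -trmx0; congr trmx; rewrite -Bk.
  by elim: (k) => [|j IH]; rewrite ?trmx1 // exprS [RHS]exprSr trmx_mul trmxK IH.
have B1' : B^T != 1%:M by rewrite -trmx1 (inj_eq trmx_inj).
have [C [Cl [e1 e2]]] := unipotent_cols Bk' B1'.
exists C^T, Cl^T; split; first by rewrite -trmx_mul e1 trmx1.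
by rewrite -[B]trmxK -trmx_mul e2 trmx_mul linearD /= trmx1 trmx_delta.
Qed.

(** On matrix units the hypothesis reads A E_ij = E_ij B^-1, and the entries can be compared. *)
Lemma two_sided_id a b (A : 'M[F]_a.+1) (B : 'M[F]_b.+1) : B \in unitmx ->
  (forall X : 'M_(a.+1, b.+1), A *m X *m B = X) -> exists2 c, c != 0 & A = c%:M /\ B = c^-1%:M.
Proof.
move=> uB h; have e i j k l : A k i * (j == l)%:R = (k == i)%:R * invmx B j l.
  have : A *m delta_mx i j = delta_mx i j *m invmx B.
    by apply: (canRL (mulmxK uB)); rewrite h.
  move/matrixP/(_ k l); rewrite !mxE (bigD1 i) //= [in RHS](bigD1 j) //= !mxE !eqxx /=.
  rewrite !big1 ?addr0 ?andbT.
  - by rewrite eq_sym.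
  - by move=> s /negbTE sj; rewrite mxE sj andbF mul0r.
  - by move=> s /negbTE si; rewrite mxE si mulr0.
pose c := invmx B 0 0.
have AE : A = c%:M.
  by apply/matrixP => k i; have := e i 0 k 0; rewrite !mxE eqxx mulr1 => ->; rewrite mulr_natl.
have BE : invmx B = c%:M.
  apply/matrixP => j l; have := e 0 j 0 l; rewrite eqxx mul1r AE !mxE eqxx mulr1n => <-.
  by rewrite mulr_natr.
have c0 : c != 0.
  apply: contraTneq uB => c0; rewrite -unitmx_inv BE c0 unitmxE.
  by rewrite det_scalar expr0n unitr0.
exists c => //; split=> //.
by rewrite -[B]invmxK BE invmx_scalar.
Qed.

Lemma frobenius_surj p (y : F) : p \in [pchar F] -> exists x, x ^+ p = y.
Proof.
move=> chp; have /injF_onto/(_ y)/codomP[x ->] := fmorph_inj (pFrobenius_aut chp).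
by exists x.
Qed.

(** [A ^+ p] and [B ^+ p] are mutually inverse scalars c and c^-1. Dividing A and multiplying B by a
    p-th root of c makes both p-th powers 1, and (A - 1)^p = A^p - 1 in characteristic p. *)
Lemma two_sided_unipotent (T : finType) a b p (phi : T -> 'M[F]_(a.+1, b.+1)) x A B :
  p \in [pchar F] -> bijective phi -> (x ^+ p = 1)%g -> two_sided phi x A B ->
  exists A' B', [/\ two_sided phi x A' B', (A' - 1%:M) ^+ p = 0 & (B' - 1%:M) ^+ p = 0].
Proof.
move=> chp [psi phiK psiK] xp rx.
have rk k : two_sided phi (x ^+ k)%g (A ^+ k) (B ^+ k).
  elim: k => [|k IH]; first by rewrite expg0 !expr0; exact: two_sided1.
  by rewrite expgSr exprS exprSr; exact: two_sidedM IH rx.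
have [uA uB e] := rk p; have {e} e X : A ^+ p *m X *m B ^+ p = X.
  by have := e (psi X); rewrite xp perm1 !psiK => <-.
have [c c0 [eA eB]] := two_sided_id uB e.
have [d dE] := frobenius_surj c chp.
have d0 : d != 0.
  apply: contraNneq c0 => d0; rewrite -dE d0 expr0n.
  by rewrite gtn_eqF // prime_gt0 // (pcharf_prime chp).
have chM n : p \in [pchar 'M[F]_n.+1].
  by rewrite inE (pcharf_prime chp) /= -scaler_nat (pcharf0 chp) scale0r.
have up n (M : 'M[F]_n.+1) : M ^+ p = 1 -> (M - 1%:M) ^+ p = 0.
  move=> Mp; have := pFrobenius_autB_comm (chM n) (commr1 M).
  by rewrite !pFrobenius_autE Mp expr1n subrr.
have [uA1 uB1 e1] := rx.
exists (d^-1 *: A), (d *: B); split.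
- split; rewrite ?unitmxZ ?unitfE ?invr_eq0 // => v.
  by rewrite e1 -scalemxAr -!scalemxAl scalerA divff // scale1r.
- by apply: up; rewrite exprZn eA exprVn dE -[c%:M]scalemx1 scalerA mulVf // scale1r.
- by apply: up; rewrite exprZn eB dE -[c^-1%:M]scalemx1 scalerA mulfV // scale1r.
Qed.

Lemma two_sided_p_exceptional_le2 (T : finType) a b (phi : T -> 'M[F]_(a.+1, b.+1))
    (L : {group {perm T}}) x A B :
  (0 < a)%N -> bijective phi -> two_sided_group phi L ->
  (forall v, coprime #|orbit 'P L v| 2) -> x \in L -> (2.-elt x)%g -> x != 1%g ->
  two_sided phi x A B -> (A - 1%:M) ^+ 2 = 0 -> (B - 1%:M) ^+ 2 = 0 -> (b <= 1)%N.
Proof.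
move=> a0 bij aL cop xL px x1 rx A2 B2; rewrite leqNgt; apply/negP => b1.
have inj := bij_inj bij; have [psi phiK psiK] := bij.
have [A1|A1] := eqVneq A 1%:M; last first.
  have [C [Cl [ClK AC]]] := unipotent_cols A2 A1.
  have [R [Rl [RlK RB]]] : exists (R : 'M_(2, b.+1)) (Rl : 'M_(b.+1, 2)),
      R *m Rl = 1%:M /\ R *m B = R.
    set N := B - 1%:M in B2; have BE : B = 1%:M + N by rewrite /N addrC subrK.
    (* N^2 = 0 limits the rank of N to half of b + 1 >= 3, which leaves two independent fixed
       rows. *)
    have rk : (2 <= \rank (kermx N))%N.
      rewrite mxrank_ker; have := mulmx0_rank_max (B2 : N *m N = 0); rewrite addnn => h.
      by move: (\rank N) h => r h; lia.
    pose R : 'M_(2, _) := pid_mx 2 *m row_base (kermx N).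
    have fR : row_free R by rewrite /row_free mxrankMfree ?row_base_free // rank_pid_mx.
    exists R, (pinvmx R); rewrite mulmxVp //; split=> //.
    rewrite BE mulmxDr mulmx1 (_ : R *m N = 0) ?addr0 // -mulmxA.
    have e : row_base (kermx N) *m N = 0 by apply/sub_kermxP; rewrite eq_row_base.
    by rewrite e mulmx0.
  have [psX psXE] : exists v0, phi v0 = C *m R by exists (psi (C *m R)); rewrite psiK.
  have := @row_fixed_col_fixed _ _ _ _ 2 phi L psX x A B (Rl *m (1%:M + delta_mx 0 1) *m R)
    isT inj aL (cop psX) xL px rx.
  rewrite psXE -mulmxA RB => /(_ erefl).
  rewrite !mulmxA AC -(mulmxA C R Rl) RlK mulmx1 => /(_ erefl).
  move/(congr1 (fun Y => Cl *m (Y *m Rl))); rewrite -!mulmxA RlK !mulmx1 !mulmxA ClK mul1mx.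
  move/(congr1 (fun M : 'M_2 => M 0 1)); rewrite !mxE /= add0r => /eqP; by rewrite oner_eq0.
have [B1|B1] := eqVneq B 1%:M.
  case/eqP: x1; apply/permP => v; rewrite perm1; apply: inj.
  by have [_ _ ->] := rx; rewrite A1 B1 mul1mx mulmx1.
have [R [Rl [RlK RB]]] := unipotent_rows B2 B1.
(* With A = 1 every plane of columns is fixed; the first two coordinates serve. *)
have ClK : (pid_mx 2 : 'M[F]_(2, a.+1)) *m (pid_mx 2 : 'M_(a.+1, 2)) = 1%:M.
  by rewrite mul_pid_mx minnn (minn_idPr _) ?pid_mx_1.
set Cl := pid_mx 2 in ClK; set C := pid_mx 2 in ClK.
have [v0 v0E] : exists v0, phi v0 = C *m R by exists (psi (C *m R)); rewrite psiK.
have := @col_fixed_row_fixed _ _ _ _ 2 phi L v0 isT aL (cop v0) x A B (C *m (1%:M + delta_mx 1 0) *m Cl) xL px rx.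
rewrite v0E A1 mul1mx => /(_ erefl).
rewrite -!mulmxA RB (mulmxA Cl) ClK mul1mx => /(_ erefl).
move/(congr1 (fun Y => Cl *m (Y *m Rl))); rewrite -!mulmxA RlK !mulmx1 !mulmxA ClK mul1mx.
by move/(congr1 (fun M : 'M_2 => M 1 0)); rewrite !mxE /= add0r => /eqP; rewrite oner_eq0.
Qed.

(* For p odd, a 2-dimensional piece of each factor already contradicts
   [no_odd_core]; for p = 2 a fixed plane on one side and a moved plane on the
   other contradict [row_fixed_col_fixed], which leaves only 2 x 2 matrices. *)
Theorem two_sided_p_exceptional (T : finType) a b p (phi : T -> 'M[F]_(a, b)) (G : {group {perm T}}) :
  prime p -> p \in [pchar F] -> (1 < a)%N -> (1 < b)%N -> bijective phi ->
  two_sided_group phi G -> p_exceptional p G -> [/\ p = 2, a = 2 & b = 2]%N.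
Proof.
move=> pr_p chp; case: a phi => [|[|a]] // phi; case: b phi => [|[|b]] // phi _ _ bij aG [pG cop].
have [x xG ox] := Cauchy pr_p pG.
have px : (p.-elt x)%g by rewrite /p_elt ox pnat_id.
have x1 : x != 1%g by apply: contraTneq pr_p => x1; rewrite -ox x1 order1.
have xp : (x ^+ p = 1)%g by rewrite -ox expg_order.
have [A0 [B0 r0]] := aG x xG.
have [A [B [r Ap Bp]]] := two_sided_unipotent chp bij xp r0.
have bijT : bijective (fun v => (phi v)^T).
  by case: bij => psi phiK psiK; exists (fun X => psi X^T) => v; rewrite ?psiK ?trmxK.
have rT := two_sided_tr r; have aT := two_sided_group_tr aG.
have tp n (M : 'M[F]_n.+1) k : (M - 1%:M) ^+ k = 0 -> (M^T - 1%:M) ^+ k = 0.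
  move=> Mk; rewrite -[1%:M]trmx1 -linearB /= -[LHS]trmxK -trmx0; congr trmx; rewrite -Mk.
  by elim: (k) => [|j IH]; rewrite ?trmx1 // exprS [RHS]exprSr trmx_mul trmxK IH.
have main a' b' (f : T -> 'M[F]_(a'.+2, b'.+2)) A1 B1 : bijective f -> two_sided_group f G ->
    two_sided f x A1 B1 -> A1 != 1%:M -> (A1 - 1%:M) ^+ p = 0 -> (B1 - 1%:M) ^+ p = 0 -> p = 2%N.
  move=> bijf aGf rf A1n A1p B1p; have [C [Cl [ClK AC]]] := unipotent_cols A1p A1n.
  have [R [Rl [b2 [RlK RB db2]]]] : exists (R : 'M_(2, b'.+2)) (Rl : 'M_(b'.+2, 2)) (b2 : 'M_2),
      [/\ R *m Rl = 1%:M, R *m B1 = b2 *m R & \det b2 = 1].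
    have [->|B1n] := eqVneq B1 1%:M.
      exists (pid_mx 2), (pid_mx 2), 1%:M; rewrite mul_pid_mx minnn (minn_idPr _) // pid_mx_1.
      by rewrite mulmx1 mul1mx det1.
    have [R [Rl [e1 e2]]] := unipotent_rows B1p B1n; exists R, Rl; eexists; split; [by []|exact: e2|].
    by rewrite det_mx22 !mxE /=; ring.
  exact: (no_odd_core pr_p aGf (bij_inj bijf) ClK RlK bijf cop chp xG px rf AC RB db2).
have p2 : p = 2%N.
  have [A1|A1] := eqVneq A 1%:M; last exact: main bij aG r A1 Ap Bp.
  have [B1|B1] := eqVneq B 1%:M.
    case/eqP: x1; apply/permP => v; rewrite perm1; apply: (bij_inj bij).
    by have [_ _ ->] := r; rewrite A1 B1 mul1mx mulmx1.
  apply: (main _ _ _ _ _ bijT aT rT); [|exact: tp Bp|exact: tp Ap].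
  by rewrite -trmx1 (inj_eq trmx_inj).
rewrite p2 in cop px Ap Bp; split=> //.
- have := @two_sided_p_exceptional_le2 _ b.+1 a.+1 _ _ _ _ _ isT bijT aT cop xG px x1 rT (tp _ _ _ Bp) (tp _ _ _ Ap).
  by case: (a).
- have := @two_sided_p_exceptional_le2 _ a.+1 b.+1 _ _ _ _ _ isT bij aG cop xG px x1 r Ap Bp.
  by case: (b).
Qed.

End Unipotent.

(** * Flattenings and the action on positions *)

Section Flattening.
Local Open Scope ring_scope.
Variables (F : finFieldType).

(** Since [phi] is onto, any row r occurs in some [phi (g v)] of the form A e_i0 r; cancelling A
    puts r in the row space of B. *)
Lemma two_sided_unitr (T : finType) a b (phi : T -> 'M[F]_(a, b)) (g : {perm T}) A B :
  (0 < a)%N -> bijective phi -> A \in unitmx ->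
  (forall v, phi (g v) = A *m phi v *m B) -> two_sided phi g A B.
Proof.
move=> a0; pose i0 := Ordinal a0; move=> [psi phiK psiK] uA e; split=> //.
rewrite -row_full_unit -sub1mx; apply/row_subP => i; set r := row i _.
pose v := (g^-1%g) (psi (A *m (delta_mx i0 0 *m r))).
have := e v; rewrite permKV psiK -mulmxA => /(can_inj (mulKmx uA)) h.
have -> : r = row i0 (phi v) *m B.
  rewrite -row_mul -h row_mul (_ : row i0 _ = 1%:M) ?mul1mx //.
  by apply/matrixP => k l; rewrite !mxE !ord1 eqxx.
exact: submxMl.
Qed.

Variables (m t : nat).
Implicit Types (c : 'I_t) (v : tensV F m t) (f : {ffun 'I_t -> 'I_m}) (h : {ffun 'I_t.-1 -> 'I_m}).

Definition insert_at c (a : 'I_m) h : {ffun 'I_t -> 'I_m} :=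
  [ffun i => if unlift c i is Some j then h j else a].

Definition rest_of c f : {ffun 'I_t.-1 -> 'I_m} := [ffun j => f (lift c j)].

Lemma insert_at_c c a h : insert_at c a h c = a.
Proof. by rewrite ffunE unlift_none. Qed.

Lemma insert_at_lift c a h j : insert_at c a h (lift c j) = h j.
Proof. by rewrite ffunE liftK. Qed.

Lemma insert_atK c f : insert_at c (f c) (rest_of c f) = f.
Proof. by apply/ffunP => i; rewrite !ffunE; case: unliftP => [j|] ->; rewrite ?ffunE. Qed.

Lemma rest_insert c a h : rest_of c (insert_at c a h) = h.
Proof. by apply/ffunP => j; rewrite ffunE insert_at_lift. Qed.

Definition flat c v : 'M[F]_(m, #|{ffun 'I_t.-1 -> 'I_m}|) :=
  \matrix_(a, k) v (insert_at c a (enum_val k)).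

Lemma flat_bij c : bijective (flat c).
Proof.
exists (fun M : 'M[F]_(m, #|{ffun 'I_t.-1 -> 'I_m}|) => [ffun f : {ffun 'I_t -> 'I_m} => M (f c) (enum_rank (rest_of c f))]).
  by move=> v; apply/ffunP => f; rewrite ffunE mxE enum_rankK insert_atK.
by move=> M; apply/matrixP => a k; rewrite mxE ffunE insert_at_c rest_insert enum_valK.
Qed.

Lemma sum_insert_at (V : nmodType) c (E : {ffun 'I_t -> 'I_m} -> V) :
  \sum_f E f = \sum_a \sum_h E (insert_at c a h).
Proof.
rewrite pair_bigA /= (reindex (fun q : 'I_m * {ffun 'I_t.-1 -> 'I_m} => insert_at c q.1 q.2)) //=.
exists (fun f => (f c, rest_of c f)) => [[a h]|f] _ /=; last exact: insert_atK.
by rewrite insert_at_c rest_insert.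
Qed.

Lemma flat_rep c x (A : 'I_t -> 'M[F]_m) (s : 'S_t) : rep x A s ->
  exists B, forall v, flat (s c) (x v) = A (s c) *m flat c v *m B.
Proof.
move=> [uA xA].
(* Transports an index of the positions other than [s c] back to those other than [c]. The default
   branch is never reached, since [s (lift c j)] differs from [s c]. *)
pose sh h : {ffun 'I_t.-1 -> 'I_m} :=
  [ffun j => if unlift (s c) (s (lift c j)) is Some j' then h j' else h j].
have shE a h : [ffun i => insert_at (s c) a h (s i)] = insert_at c a (sh h).
  apply/ffunP => i; rewrite ffunE; case: (unliftP c i) => [j|] ->.
    rewrite insert_at_lift [RHS]ffunE.
    case: (unliftP (s c) (s (lift c j))) => [j' ->|e]; first by rewrite insert_at_lift.
    by have /eqP := e; rewrite (inj_eq perm_inj) eq_sym (negbTE (neq_lift _ _)).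
  by rewrite !insert_at_c.
pose ev (k : 'I_#|{ffun 'I_t.-1 -> 'I_m}|) : {ffun 'I_t.-1 -> 'I_m} := enum_val k.
(* [Q] renames the columns by [sh], and [N] is the transposed tensor product of the components at
   the other positions. *)
pose Q : 'M[F]_#|{ffun 'I_t.-1 -> 'I_m}| :=
  \matrix_(l, k) (enum_val l == sh (enum_val k))%:R.
pose N : 'M[F]_#|{ffun 'I_t.-1 -> 'I_m}| :=
  \matrix_(k, n) \prod_j A (lift (s c) j) (ev n j) (ev k j).
exists (Q *m N) => v.
have FQ : flat c v *m Q = \matrix_(b, k) v (insert_at c b (sh (ev k))).
  apply/matrixP => b k; rewrite !mxE (bigD1 (enum_rank (sh (ev k)))) //=.
  rewrite !mxE enum_rankK eqxx mulr1 big1 ?addr0 // => l lk; rewrite !mxE.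
  case: eqP => [e|_]; last by rewrite mulr0.
  by case/eqP: lk; rewrite -e enum_valK.
rewrite -!mulmxA (mulmxA (flat c v)) FQ; apply/matrixP => a n.
rewrite mxE xA ffunE (sum_insert_at (s c)) mxE; apply: eq_bigr => b _.
rewrite [in RHS]mxE big_distrr /= [LHS](reindex ev) /=; last first.
  by exists enum_rank => h _; [exact: enum_valK|exact: enum_rankK].
apply: eq_bigr => k _; rewrite ffunE shE (bigD1_ord (s c)) //= !insert_at_c !mxE -mulrA; congr (_ * _).
by rewrite mulrC; congr (_ * _); apply: eq_bigr => j _; rewrite !insert_at_lift.
Qed.

Lemma flat_two_sided c x (A : 'I_t -> 'M[F]_m) (s : 'S_t) :
  (0 < m)%N -> rep x A s -> s c = c ->
  exists B, two_sided (flat c) x (A c) B.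
Proof.
move=> m0 r sc; have [B] := flat_rep c r; rewrite sc => e; exists B.
exact: two_sided_unitr (flat_bij c) (r.1 c) e.
Qed.

Lemma rank_flat_rep c x (A : 'I_t -> 'M[F]_m) (s : 'S_t) v : rep x A s ->
  (\rank (flat (s c) (x v)) <= \rank (flat c v))%N.
Proof.
move=> r; have [B ->] := flat_rep c r.
exact: leq_trans (mxrankM_maxl _ _) (mxrankM_maxr _ _).
Qed.

End Flattening.

Section FixedPosition.
Local Open Scope ring_scope.
Variables (F : finFieldType) (m t p : nat).
Hypotheses (m1 : (1 < m)%N) (t1 : (1 < t)%N) (pr_p : prime p) (chp : p \in [pchar F]).

(** Flattening at the fixed position gives a two-sided action on m x m^(t-1) matrices, and m =
    m^(t-1) = 2 leaves t = 2. *)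
Lemma fixed_position_p_exceptional c (K : {group {perm tensV F m t}}) :
  K \subset tensor_group F m t -> (forall x, x \in K -> sg x c = c) -> p_exceptional p K ->
  [/\ p = 2, m = 2 & t = 2]%N.
Proof.
move=> sK fc exK.
have gK : two_sided_group (flat (F := F) c) K.
  move=> x xK; have [A r] := sg_rep m1 (subsetP sK _ xK).
  by have [B rB] := flat_two_sided (ltnW m1) r (fc _ xK); exists (A c), B.
have t1' : (0 < t.-1)%N by lia.
have cb : #|{ffun 'I_t.-1 -> 'I_m}| = (m ^ t.-1)%N by rewrite card_ffun !card_ord.
have b1 : (1 < #|{ffun 'I_t.-1 -> 'I_m}|)%N.
  by rewrite cb -(exp1n t.-1) ltn_exp2r.
have [-> m2] := two_sided_p_exceptional pr_p chp m1 b1 (flat_bij F m c) gK exK.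
rewrite cb m2 -[RHS]expn1 => /eqP; rewrite eqn_exp2l // => /eqP e; split=> //; lia.
Qed.

End FixedPosition.

(** * Decomposability along sets of positions *)

Section Splitting.
Local Open Scope ring_scope.
Variables (F : finFieldType) (m t : nat).
Implicit Types (v : tensV F m t) (f g : {ffun 'I_t -> 'I_m}) (O : {set 'I_t}).

Definition merge O f g : {ffun 'I_t -> 'I_m} := [ffun i => if i \in O then f i else g i].

(* v is decomposable along O, i.e. of the form v_O (x) v_(~: O). *)
Definition splits v O := forall f g, v f * v g = v (merge O f g) * v (merge O g f).

Lemma merge_merge O f g : merge O (merge O f g) (merge O g f) = f.
Proof. by apply/ffunP => i; rewrite !ffunE; case: (i \in O). Qed.

(** Both sides expand into double sums, and exchanging the [O]-parts of the two summation indices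
    matches their terms. *)
Lemma splits_tens v O A : splits v O -> splits (tens_act A v) O.
Proof.
move=> sv f g; rewrite !ffunE.
pose E f g (f' g' : {ffun 'I_t -> 'I_m}) := \prod_i A i (f i) (f' i) * \prod_i A i (g i) (g' i) * (v f' * v g').
have dist f1 g1 : (\sum_(f' : {ffun 'I_t -> 'I_m}) (\prod_i A i (f1 i) (f' i)) * v f') *
    (\sum_(g' : {ffun 'I_t -> 'I_m}) (\prod_i A i (g1 i) (g' i)) * v g') =
    \sum_(q : {ffun 'I_t -> 'I_m} * {ffun 'I_t -> 'I_m}) E f1 g1 q.1 q.2.
  rewrite big_distrl /= -(pair_bigA _ (fun f' g' => E f1 g1 f' g')) /=.
  by apply: eq_bigr => f' _; rewrite big_distrr; apply: eq_bigr => g' _; rewrite /E mulrACA.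
rewrite !dist.
rewrite [RHS](reindex (fun q => (merge O q.1 q.2, merge O q.2 q.1))) /=; last first.
  by exists (fun q => (merge O q.1 q.2, merge O q.2 q.1)) => -[f' g'] _ /=; rewrite !merge_merge.
apply: eq_bigr => -[f' g'] _ /=; rewrite /E -sv; congr (_ * _).
by rewrite -!big_split; apply: eq_bigr => i _; rewrite !ffunE; case: (i \in O) => //; exact: mulrC.
Qed.

Lemma splits_perm v O (s : 'S_t) : splits v (s @^-1: O) -> splits (perm_act s v) O.
Proof.
move=> sv f g; rewrite !ffunE sv; congr (v _ * v _); apply/ffunP => i.
  by rewrite !ffunE inE.
by rewrite !ffunE inE.
Qed.

Lemma splits_fix x v O (m1 : (1 < m)%N) : x \in tensor_group F m t -> x v = v ->
  splits v (sg x @^-1: O) -> splits v O.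
Proof.
move=> /(sg_rep m1)[A [uA r]] fx h; rewrite -fx r.
exact/splits_tens/splits_perm.
Qed.

Lemma tens_actK A v : (forall i, A i \in unitmx) ->
  tens_act (fun i => invmx (A i)) (tens_act A v) = v.
Proof.
move=> uA; rewrite tens_actM -[RHS]tens_act1; apply: eq_tens_act => i.
by rewrite mulVmx.
Qed.

Variables (I : eqType) (blk : 'I_t -> I).

(* The tensor product over the blocks B of blk of sum_a (x)_(i in B) e_a. *)
Definition ghz : tensV F m t :=
  [ffun f : {ffun 'I_t -> 'I_m} =>
    [forall i, forall j, (blk i == blk j) ==> (f i == f j)]%:R].

Definition saturated O := forall i j, blk i = blk j -> (i \in O) = (j \in O).

Lemma ghz_splits O : saturated O -> splits ghz O.
Proof.
move=> satO f g; rewrite !ffunE -!natrM !mulnb; congr (_%:R); congr nat_of_bool.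
apply/andP/andP => -[/forallP c1 /forallP c2]; split; apply/forallP => i;
  apply/forallP => j; apply/implyP => /eqP e;
  have := satO _ _ e; have /eqP e' := e;
  have /forallP/(_ j)/implyP/(_ e') := c1 i; have /forallP/(_ j)/implyP/(_ e') := c2 i;
  rewrite !ffunE; by case: (i \in O); case: (j \in O).
Qed.

Lemma splits_ghz O : (1 < m)%N -> splits ghz O -> saturated O.
Proof.
move=> m1 h; suff H i j : blk i = blk j -> i \in O -> j \in O.
  by move=> i j e; apply/idP/idP; apply: H.
move=> e iO; apply: contraT => jO.
pose z := Ordinal (ltnW m1); pose o := Ordinal m1.
have := h [ffun=> z] [ffun=> o]; rewrite !ffunE.
have c0 a : [forall i, forall j, (blk i == blk j) ==>
    ([ffun=> a] i == [ffun=> a] j :> 'I_m)] by apply/forallP => ?; apply/forallP => ?; rewrite !ffunE eqxx implybT.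
rewrite !c0 mul1r (_ : [forall i, _] = false) ?mul0r => [/eqP|]; first by rewrite oner_eq0.
apply/negP => /forallP/(_ i)/forallP/(_ j); rewrite e eqxx /= !ffunE iO (negbTE jO).
by move=> /eqP/(congr1 val).
Qed.

(** The sets along which the tensor decomposes are the unions of blocks, whatever [P] is. A fixator
    pulls such sets back to such sets, so it maps blocks into blocks. The twist by [P] is there for
    tensors that are only equivalent to [ghz]. *)
Lemma ghz_stab x (P : 'I_t -> 'M[F]_m) (m1 : (1 < m)%N) : x \in tensor_group F m t ->
  (forall i, P i \in unitmx) -> x (tens_act P ghz) = tens_act P ghz ->
  forall i j, blk i = blk j -> blk (sg x i) = blk (sg x j).
Proof.
move=> xt uP fx.
have sE O : splits (tens_act P ghz) O <-> saturated O.
  split=> [/(@splits_tens _ _ (fun i => invmx (P i)))|/ghz_splits]; last exact: splits_tens.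
  by rewrite tens_actK //; apply: splits_ghz.
have fV : (x^-1)%g (tens_act P ghz) = tens_act P ghz.
  by apply: (@perm_inj _ x); rewrite permKV fx.
have sgV : sg x^-1%g = (sg x)^-1%g.
  by have [A r] := sg_rep m1 xt; rewrite (sgE m1 (repV r)).
move=> i j e; pose O := [set k | blk k == blk (sg x i)].
have /sE satO : saturated O by move=> k l; rewrite !inE => ->.
have /sE satV : splits (tens_act P ghz) (sg x @^-1: O).
  apply: (splits_fix m1 _ fV); first by rewrite groupV.
  rewrite sgV (_ : _ @^-1: _ = O) //.
  by apply/setP => k; rewrite !inE permKV.
have := satV _ _ e; rewrite !inE eqxx => /esym/eqP; exact: esym.
Qed.

End Splitting.

(** When its order is odd, s is a power of s^2. *)
Lemma odd_perm_fix (T : finType) (s : {perm T}) i : odd #[s]%g -> s (s i) = i -> s i = i.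
Proof.
move=> os h; have h2 k : ((s ^+ 2) ^+ k)%g i = i.
  by elim: k => [|k IH]; rewrite ?expg0 ?perm1 // expgS permM permM h.
have := h2 (#[s]%g.+1)./2; rewrite -expgM mul2n.
rewrite (_ : (#[s]%g.+1)./2.*2 = #[s]%g.+1); last by rewrite -[RHS]odd_double_half /= os.
by rewrite expgS expg_order mulg1.
Qed.

Lemma involution_fix (T : finType) (s : {perm T}) (S : {set T}) : (s ^+ 2 = 1)%g ->
  (forall i, i \in S -> s i \in S) -> odd #|S| -> exists2 i, i \in S & s i = i.
Proof.
move=> s2 sS oS; have p2 : (2.-group <[s]>)%g.
  rewrite /pgroup -orderE; apply: (@pnat_dvd _ 2); last by rewrite pnat_id.
  by rewrite order_dvdn s2.
have act : [acts <[s]>%g, on S | 'P].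
  rewrite cycle_subG; apply/astabsP => i /=; rewrite apermE.
  by apply/idP/idP => [|/sS//]; move/sS; rewrite -permM -[(s * s)%g]/(s ^+ 2)%g s2 perm1.
have := pgroup_fix_mod p2 act; rewrite !modn2 oS => e.
have : 'Fix_(S | 'P)(<[s]>)%g != set0.
  by rewrite -card_gt0; move: e; case: #|_|.
case/set0Pn => i; rewrite inE => /andP[iS /afixP/(_ s (cycle_id _)) /= fi].
by exists i.
Qed.

(** Labels 0 and 1 mark {0,1} and {2,3}; every later position is its own label, at least 4, so no
    label is used twice. *)
Definition pair_blk n := if (n < 4)%N then n./2 else n.

Lemma pair_blk3 i j k : pair_blk i = pair_blk j -> pair_blk i = pair_blk k -> [\/ i = j, i = k | j = k].
Proof.
rewrite /pair_blk; case: ifP => ?; case: ifP => ?; case: ifP => ? e1 e2.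
all: try by (have := odd_double_half i; have := odd_double_half j; have := odd_double_half k;
  rewrite -e1 -?e2; do 3 case: (odd _) => /=; move=> *;
  (apply: Or31; lia) || (apply: Or32; lia) || (apply: Or33; lia)).
all: by constructor; lia.
Qed.

Lemma pair_blk_lt i : (i < 4)%N -> (pair_blk i < 2)%N.
Proof. by rewrite /pair_blk => h; rewrite h; lia. Qed.

Lemma pair_blk_neq i j : j != i -> pair_blk j = pair_blk i -> (i < 4)%N.
Proof.
rewrite /pair_blk; case: (ltnP i 4) => // i4; case: ifP => j4; first lia.
by move/eqP.
Qed.

Lemma pair_blk_partner i : (i < 4)%N ->
  exists2 j, j != i /\ (j <= (i./2).*2.+1)%N & pair_blk j = pair_blk i.
Proof.
case: i => [|[|[|[|i]]]] // _; [exists 1%N|exists 0%N|exists 3|exists 2%N] => //.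
Qed.

Section Combinatorics.
Local Open Scope ring_scope.
Variables (F : finFieldType) (m t p : nat).
Hypotheses (m1 : (1 < m)%N) (pr_p : prime p).
Variables (G : {group {perm tensV F m t}}) (x : {perm tensV F m t}).
Hypotheses (sG : G \subset tensor_group F m t) (cop : forall v, coprime #|orbit 'P G v| p).
Hypotheses (xG : x \in G) (px : (p.-elt x)%g) (sx : sg x != 1%g).

Let sgm := sgm F t m1.

Lemma sgMG : {in G &, {morph @sg F m t : x y / (x * y)%g}}.
Proof. by move=> y z yG zG; apply: (sgM m1); exact: (subsetP sG). Qed.

Lemma sgVG y : y \in G -> sg y^-1%g = (sg y)^-1%g.
Proof. by move=> yG; exact: (morphV sgm (subsetP sG _ yG)). Qed.

Lemma sg_p_elt y : y \in G -> (p.-elt y)%g -> (p.-elt (sg y))%g.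
Proof. by move=> yG py; exact: (morph_p_elt sgm (subsetP sG _ yG)). Qed.

Lemma fix_conj v : exists2 y, y \in G & [/\ y v = v, (p.-elt y)%g & sg y != 1%g].
Proof.
have [g gG /setIP[xgG /astab1P fx]] :=
  p_elt_conj_astab1 (subxx G) (subsetIl _ _) (cop v) pr_p xG px.
exists (x ^ g)%g; first exact: groupJ.
split; [exact: fx|by rewrite p_eltJ|].
rewrite conjgE !sgMG ?groupM ?groupV // sgVG // -conjgE.
by rewrite -[1%g](conj1g (sg g)) (inj_eq (conjg_inj _)).
Qed.

Lemma ghz_fix (I : eqType) (blk : 'I_t -> I) y : y \in G ->
  y (ghz F m blk) = ghz F m blk -> forall i j, (blk (sg y i) == blk (sg y j)) = (blk i == blk j).
Proof.
move=> yG fy i j; have H z : z \in G -> z (ghz F m blk) = ghz F m blk ->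
    forall i j, blk i = blk j -> blk (sg z i) = blk (sg z j).
  move=> zG fz; apply: (@ghz_stab _ _ _ _ blk z (fun=> 1%:M)) => //.
  - exact: (subsetP sG).
  - by move=> ?; rewrite unitmx1.
  - by rewrite tens_act1.
apply/eqP/eqP => [|/H]; last exact.
have fV : (y^-1)%g (ghz F m blk) = ghz F m blk.
  by apply: (@perm_inj _ y); rewrite permKV fy.
have yV : (y^-1)%g \in G by rewrite groupV.
by move/(H _ yV fV); rewrite sgVG // !permK.
Qed.

(* The tensor with entries 1 exactly where f0 = f1 and f2 = f3: its blocks
   {0,1}, {2,3}, {4}, {5} have sizes at most 2 and multiplicities at most 2. *)
Lemma odd_small_t : odd p -> (1 < t <= 6)%N -> False.
Proof.
move=> op /andP[t1 t6].
pose blk (i : 'I_t) := pair_blk i.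
have [y yG [fy py ny]] := fix_conj (ghz F m blk).
have H := ghz_fix yG fy; set s := sg y in ny H.
have os : odd #[s]%g.
  have := sg_p_elt yG py; rewrite /p_elt => /p_natP[k ->].
  by rewrite oddX op orbT.
have [a sa] : exists a, s a != a.
  apply/existsP; rewrite -negb_forall; apply: contra ny => /forallP h.
  by apply/eqP/permP => i; rewrite perm1 (eqP (h i)).
have si i j : (s i == s j) = (i == j) by rewrite (inj_eq perm_inj).
have nab : a != s a by rewrite eq_sym.
have nbc : s a != s (s a) by rewrite si.
have nac : a != s (s a) by apply: contra sa => /eqP e; apply/eqP/odd_perm_fix.
have two (i j k : 'I_t) : blk i == blk j -> blk i == blk k -> [|| i == j, i == k | j == k].
  move=> /eqP e1 /eqP e2.
  by case: (pair_blk3 e1 e2) => /val_inj ->; rewrite eqxx ?orbT.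
have nab' : blk a != blk (s a).
  apply/negP => e; have e2 : blk (s a) == blk (s (s a)) by rewrite H.
  have := two a (s a) (s (s a)) e; rewrite (eqP e) => /(_ e2).
  by rewrite (negbTE nab) (negbTE nbc) (negbTE nac).
have nbc' : blk (s a) != blk (s (s a)) by rewrite H.
(* Otherwise a, s^2 a and s^4 a share a block of size at most 2, so s^4 a = a, and s^2, of odd
   order, fixes a. *)
have nac' : blk a != blk (s (s a)).
  apply/negP => e; have e2 : blk (s (s a)) == blk (s (s (s (s a)))) by rewrite !H.
  have := two (s (s a)) a (s (s (s (s a)))); rewrite eq_sym e => /(_ isT e2).
  rewrite eq_sym (negbTE nac) !si (negbTE nac) /= => /eqP e4.
  have os2 : odd #[(s ^+ 2)%g]%g.
    by apply: dvdn_odd os; rewrite orderXdvd.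
  have := @odd_perm_fix _ (s ^+ 2)%g a os2; rewrite !permM -e4 => /(_ erefl) e5.
  by move: nac; rewrite e5 eqxx.
(* At t = 3 position 2 loses its partner 3. In every case at most two positions are unpaired. *)
have part (i : 'I_t) : (exists2 j, j != i & blk j = blk i) \/ ((4 <= i)%N \/ (i = 2 :> nat /\ t = 3)).
  case: (ltnP i 4) => i4; last by right; left.
  have [n [ni nle] en] := pair_blk_partner i4.
  case: (ltnP n t) => nt; first by left; exists (Ordinal nt); rewrite -?val_eqE.
  right; right; have := ltn_ord i; move: (nat_of_ord i) i4 ni nle => k.
  by move: t1 nt; clear; case: k => [|[|[|[|k]]]] //=; lia.
have small (i j : 'I_t) : j != i -> blk j = blk i -> (i < 4)%N.
  by rewrite -val_eqE; exact: pair_blk_neq.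
(* The three distinct blocks of a, s a, s^2 a have equal size, but there are at most two pairs and
   at most two unpaired positions. *)
have [[a' na' ea']|pa] := part a.
  have /pair_blk_lt a4 := small _ _ na' ea'.
  have /pair_blk_lt b4 : (s a < 4)%N.
    by apply: (small _ (s a')); [rewrite si|apply/eqP; rewrite H ea'].
  have /pair_blk_lt c4 : (s (s a) < 4)%N.
    by apply: (small _ (s (s a'))); [rewrite !si|apply/eqP; rewrite !H ea'].
  move: nab' nbc' nac' a4 b4 c4; rewrite /blk.
  by case: (pair_blk a) => [|[|?]]; case: (pair_blk (s a)) => [|[|?]]; case: (pair_blk _) => [|[|?]].
have up (i : 'I_t) : ~ (exists2 j, j != i & blk j = blk i) ->
    ~ (exists2 j, j != s i & blk j = blk (s i)).
  move=> h [j nj ej]; apply: h; exists (s^-1%g j).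
    by apply: contra nj => /eqP <-; rewrite permKV.
  by apply/eqP; rewrite -H permKV ej.
have pa' : ~ (exists2 j, j != a & blk j = blk a).
  case=> j nj ej; have := small _ _ nj ej; case: pa => [|[e t3]]; first by rewrite leqNgt => /negbTE ->.
  move=> _; have j3 : (j < 3)%N by rewrite -[X in (_ < X)%N]t3.
  move: j3 nj ej; rewrite /blk -val_eqE /= e.
  by case: (nat_of_ord j) => [|[|[|?]]].
case: (part (s a)) => [/(up _ pa')//|pb]; case: (part (s (s a))) => [/(up _ (up _ pa'))//|pc].
have := ltn_ord a; have := ltn_ord (s a); have := ltn_ord (s (s a)).
by move: nab nbc nac pa pb pc t6; rewrite -!val_eqE /=; clear; lia.
Qed.

End Combinatorics.

(** * Orbits on positions and on sets of positions, p = 2 *)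

Section Positions.
Variables (F : finFieldType) (m t p : nat).
Hypotheses (m1 : 1 < m) (pr_p : prime p).
Variables (G : {group {perm tensV F m t}}).
Hypotheses (sG : G \subset tensor_group F m t) (cop : forall v, coprime #|orbit 'P G v| p).

Definition set_orb (C : {set 'I_t}) : {set {set 'I_t}} := [set sg y @: C | y in G].

Lemma set_orb_sub_tig : G \subset ((sgm F t m1) @*^-1 [set: 'S_t])%g.
Proof.
apply/subsetP => y yG; apply/morphpreP; split; [exact: (subsetP sG)|exact: in_setT].
Qed.

Lemma set_orbE C : set_orb C = orbit ('P^* \o sgm F t m1)%act G C.
Proof.
apply/setP => D; apply/imsetP/orbitP => [[y yG ->]|[y yG <-]]; exists y => //;
  by rewrite /= /comp_act /= /setact; apply: eq_imset.
Qed.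

Definition set_blk (C : {set 'I_t}) (i : 'I_t) : option 'I_t := if i \in C then None else Some i.

(** Two elements of [C] keep a common label under y, and [C] is the only block with two elements. *)
Lemma set_blk_stab (C : {set 'I_t}) y : (1 < #|C|) -> y \in G ->
  (forall i j, set_blk C i = set_blk C j -> set_blk C (sg y i) = set_blk C (sg y j)) ->
  sg y @: C = C.
Proof.
move=> C1 yG H; apply/eqP; rewrite eqEcard card_imset ?leqnn ?andbT; last exact: perm_inj.
apply/subsetP => _ /imsetP[i iC ->].
have [j jC ji] : exists2 j, j \in C & j != i.
  have : 0 < #|C :\ i| by rewrite (cardsD1 i) iC in C1.
  by rewrite card_gt0 => /set0Pn[j]; rewrite !inE => /andP[? ?]; exists j.
have := H i j; rewrite /set_blk iC jC => /(_ erefl).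
case: ifP => // _; case: ifP => // _ [] /perm_inj ij.
by rewrite ij eqxx in ji.
Qed.

Lemma set_orb_coprime (C : {set 'I_t}) : 1 < #|C| -> coprime #|set_orb C| p.
Proof.
move=> C1; pose v := ghz F m (set_blk C).
apply: coprime_dvdl (cop v); rewrite set_orbE; apply: orbit_dvd_orbit; first exact: set_orb_sub_tig.
apply/subsetP => y /setIP[yG /astab1P/= fy]; rewrite inE yG /=.
rewrite inE (subsetP set_orb_sub_tig _ yG) /= inE; apply/subsetP => D; rewrite !inE => /eqP ->.
apply/eqP; rewrite [LHS](_ : _ = sg y @: C).
  by apply: set_blk_stab => // i j e; apply/eqP; rewrite (ghz_fix m1 sG yG fy) e.
by rewrite /= /comp_act /= /setact; apply: eq_imset.
Qed.

Hypothesis p2 : p = 2.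

Lemma set_orb_odd (C : {set 'I_t}) : 1 < #|C| -> odd #|set_orb C|.
Proof. by move/set_orb_coprime; rewrite p2 coprimen2. Qed.

Hypothesis nofix : forall c, exists2 y, y \in G & sg y c != c.

Definition pos_orb (i : 'I_t) : {set 'I_t} := [set sg y i | y in G].

Lemma pos_orb_odd i : 2 < t -> odd #|pos_orb i|.
Proof.
(* The complement of i determines i and, unlike {i}, has the two elements that [set_blk_stab]
   requires. *)
move=> t2; have c1 : 1 < #|~: [set i]| by rewrite cardsC1 card_ord; case: (t) t2 => [|[|]].
suff : coprime #|pos_orb i| p by rewrite p2 coprimen2.
pose v := ghz F m (set_blk (~: [set i])).
apply: coprime_dvdl (cop v).
rewrite (_ : pos_orb i = orbit ('P \o sgm F t m1)%act G i); last first.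
  by apply/setP => D; apply/imsetP/orbitP => [[y yG ->]|[y yG <-]]; exists y.
apply: orbit_dvd_orbit; first exact: set_orb_sub_tig.
apply/subsetP => y /setIP[yG /astab1P/= fy]; rewrite inE yG /=.
rewrite inE (subsetP set_orb_sub_tig _ yG) /= inE; apply/subsetP => D; rewrite !inE => /eqP ->.
have : sg y i \notin ~: [set i].
  rewrite -(set_blk_stab c1 yG) ?(mem_imset _ _ (@perm_inj _ (sg y))) ?inE ?eqxx // => j k e'.
  by apply/eqP; rewrite (ghz_fix m1 sG yG fy) e'.
by rewrite !inE negbK.
Qed.

Lemma pos_orb_id i : i \in pos_orb i.
Proof.
apply/imsetP; exists 1%g; rewrite ?group1 //.
by rewrite (sgE m1 (rep1 F m t)) perm1.
Qed.

Lemma pos_orb_sg i j y : y \in G -> j \in pos_orb i -> sg y j \in pos_orb i.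
Proof.
move=> yG /imsetP[z zG ->]; apply/imsetP; exists (z * y)%g; rewrite ?groupM //.
by rewrite (sgMG m1 sG) // permM.
Qed.

Lemma pos_orb_sym i j : j \in pos_orb i -> i \in pos_orb j.
Proof.
case/imsetP => z zG ->; apply/imsetP; exists z^-1%g; rewrite ?groupV //.
by rewrite (sgVG m1 sG) // permK.
Qed.

Lemma pos_orb_trans i j k : j \in pos_orb i -> k \in pos_orb j -> k \in pos_orb i.
Proof. by move=> ij /imsetP[z zG ->]; apply: pos_orb_sg. Qed.

Lemma pos_orb_neq1 i : #|pos_orb i| != 1.
Proof.
apply/negP => /cards1P[j e]; have [y yG] := nofix i.
have := pos_orb_sg yG (pos_orb_id i); have := pos_orb_id i; rewrite e !inE.
by move=> /eqP -> /eqP ->; rewrite eqxx.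
Qed.

Lemma pos_orb_ge3 i : 2 < t -> 2 < #|pos_orb i|.
Proof.
move=> t2; have := pos_orb_odd i t2; have := pos_orb_neq1 i.
by case: #|_| => [|[|[|]]].
Qed.

Lemma pos_orb_disjoint i j : j \notin pos_orb i -> #|pos_orb i| + #|pos_orb j| <= t.
Proof.
move=> h; rewrite -[t in _ <= t]card_ord -cardsUI.
rewrite (_ : _ :&: _ = set0) ?cards0 ?addn0 ?max_card //.
apply/setP => k; rewrite !inE; apply/negP => /andP[ki kj]; case/negP: h.
exact: pos_orb_trans ki (pos_orb_sym kj).
Qed.

(** Orbits of odd length at least 3 leave one orbit of length 5 or two of length 3; t = 4 has no
    such partition. *)
Lemma pos_orb_cases i : 3 < t <= 6 ->
  (t = 5 /\ pos_orb i = setT) \/ (t = 6 /\ #|~: pos_orb i| = 3).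
Proof.
move=> /andP[t3 t6]; have o := pos_orb_odd i (ltnW t3); have g := pos_orb_ge3 i (ltnW t3).
have [j|] := pickP [predC pos_orb i].
  move=> /= ji; have := pos_orb_disjoint ji; have := pos_orb_ge3 j (ltnW t3).
  have := cardsC (pos_orb i); rewrite card_ord.
  move: #|pos_orb i| #|pos_orb j| #|~: _| o g t3 t6; clear => n k l; case: n => [|[|[|[|n]]]] //= *.
    by right; lia.
  by exfalso; lia.
move=> h; have e : pos_orb i = setT by apply/setP => j; have /= := h j; rewrite inE => /negbFE ->.
left; split=> //; move: o; rewrite e cardsT card_ord; move: t3 t6; clear.
by case: t => [|[|[|[|[|[|[|?]]]]]]].
Qed.

(** The orbit of the pair is the edge set E of a regular graph on five vertices, of degree N with 5
    N = 2 |E|. As |E| is odd and at most 10, |E| = 5 and N = 2, while d has three neighbours. *)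
Lemma pair_orb_contra (C : {set 'I_t}) d u1 u2 u3 : t = 5 -> (forall i, pos_orb i = setT) ->
  uniq [:: d; u1; u2; u3] ->
  [set d; u2] \in set_orb [set d; u1] -> [set d; u3] \in set_orb [set d; u1] -> False.
Proof.
move=> t5 tr un h2 h3; set E := set_orb [set d; u1].
have E2 e : e \in E -> #|e| = 2.
  case/imsetP => y yG ->; rewrite card_imset; last exact: perm_inj.
  by rewrite cards2; move: un; rewrite /= !inE !negb_or => /andP[/andP[-> _] _].
have oE : odd #|E|.
  apply: set_orb_odd; rewrite cards2; move: un.
  by rewrite /= !inE !negb_or => /andP[/andP[-> _] _].
have lE : #|E| <= 10.
  have e10 : 'C(t, 2) = 10 by rewrite t5.
  rewrite -e10 -[X in 'C(X, _)]card_ord -card_draws.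
  by apply: subset_leq_card; apply/subsetP => e /E2; rewrite inE => ->.
pose N i := #|[set e in E | i \in e]|.
have EJ y e : y \in G -> e \in E -> sg y @: e \in E.
  move=> yG /imsetP[z zG ->]; apply/imsetP; exists (z * y)%g; rewrite ?groupM //.
  by rewrite -imset_comp; apply: eq_imset => i; rewrite (sgMG m1 sG) // permM.
have Nle y i : y \in G -> N i <= N (sg y i).
  move=> yG; rewrite /N -(card_imset _ (imset_inj (@perm_inj _ (sg y)))).
  apply: subset_leq_card; apply/subsetP => _ /imsetP[e + ->]; rewrite !inE => /andP[eE ie].
  by rewrite EJ // imset_f.
have Nc i : N i = N d.
  have le j k : N j <= N k.
    have : k \in pos_orb j by rewrite tr inE.
    by case/imsetP => y yG ->; apply: Nle.
  by apply/eqP; rewrite eqn_leq !le.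
have sumN : \sum_i N i = 2 * #|E|.
  rewrite (eq_bigr (fun i => \sum_(e in E) (i \in e))); last first.
    move=> i _; rewrite /N -sum1_card big_mkcond [RHS]big_mkcond /=; apply: eq_bigr => e _.
    by rewrite inE; case: (e \in E); case: (i \in e).
  rewrite exchange_big /= (eq_bigr (fun=> 2)) ?sum_nat_const ?[2 * _]mulnC // => e eE.
  by rewrite -(E2 e eE) -sum1_card [RHS]big_mkcond; apply: eq_bigr => i _; case: (i \in e).
have Nd : 3 <= N d.
  have <- : #|[set [set d; u1]; [set d; u2]; [set d; u3]]| = 3.
    rewrite -!setUA cardsU1 cards2 !inE.
    have neq u v : d != u -> u != v -> [set d; u] != [set d; v].
      move=> du uv; apply/eqP => /setP/(_ u); rewrite !inE eqxx orbT.
      by rewrite eq_sym (negbTE du) (negbTE uv).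
    move: un; rewrite /= !inE !negb_or => /and4P[/and3P[d1 d2 d3] /andP[n12 n13] n23 _].
    by rewrite !neq.
  apply: subset_leq_card; apply/subsetP => e; rewrite !inE.
  by case/orP => [/orP[]|] /eqP ->; rewrite ?h2 ?h3 ?inE ?eqxx ?andbT //;
    apply/imsetP; exists 1%g; rewrite ?group1 // (sgE m1 (rep1 F m t)) -[LHS]imset_id;
    apply: eq_imset => i; rewrite perm1.
move: sumN; rewrite (eq_bigr (fun=> N d)) // sum_nat_const card_ord.
rewrite [X in (X * _)%N = _]t5; move: (N d) #|E| Nd oE lE; clear => n k ? ok ? e.
have := odd_double_half k; rewrite ok; lia.
Qed.

(** The square of y fixes a position d outside the 3-cycle and still cycles a, u, w, so {d,a}, {d,u}
    and {d,w} lie in one orbit. *)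
Lemma three_cycle_contra y a u w : t = 5 -> (forall i, pos_orb i = setT) -> y \in G ->
  uniq [:: a; u; w] -> sg y a = u -> sg y u = w -> sg y w = a -> False.
Proof.
move=> t5 tr yG un ya yu yw; set s := sg y in ya yu yw.
have inS i : (s i \in [set a; u; w]) = (i \in [set a; u; w]).
  have ia : (s i == a) = (i == w) by rewrite -{1}yw (inj_eq perm_inj).
  have iu : (s i == u) = (i == a) by rewrite -{1}ya (inj_eq perm_inj).
  have iw : (s i == w) = (i == u) by rewrite -{1}yu (inj_eq perm_inj).
  by rewrite !inE ia iu iw -orbA orbC.
have c2 : #|~: [set a; u; w]| == 2.
  move: un; rewrite /= !inE !negb_or => /andP[/andP[n1 n2] /andP[n3 _]].
  have := cardsC [set a; u; w]; rewrite card_ord [in RHS]t5 -setUA cardsU1 cards2 !inE negb_or n1 n2 n3.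
  by move=> /eqP.
have /cards2P[d [d' [dd' De]]] := c2.
have ssd : s (s d) = d.
  have dD : d \in ~: [set a; u; w] by rewrite De !inE eqxx.
  have sdD : s d \in ~: [set a; u; w] by rewrite inE inS -in_setC.
  have ssdD : s (s d) \in ~: [set a; u; w] by rewrite inE inS -in_setC.
  move: sdD ssdD; rewrite De !inE => /orP[/eqP e|/eqP e]; first by rewrite !e.
  by case/orP => /eqP // e2; have := e2; rewrite -[in RHS]e => /perm_inj; rewrite e => e3; rewrite e3 eqxx in dd'.
have dn : d \notin [set a; u; w] by rewrite -in_setC De !inE eqxx.
have sE b : s @: (s @: [set d; b]) = [set d; s (s b)].
  by rewrite !imsetU1 !imset_set1 ssd.
have inE2 b : [set d; b] \in set_orb [set d; a] -> [set d; s (s b)] \in set_orb [set d; a].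
  case/imsetP => z zG e; apply/imsetP; exists (z * y * y)%g; rewrite ?groupM // -sE e.
  rewrite -!imset_comp; apply: eq_imset => i /=.
  by rewrite !(sgMG m1 sG) ?groupM // !permM.
have e0 : [set d; a] \in set_orb [set d; a].
  apply/imsetP; exists 1%g; rewrite ?group1 // (sgE m1 (rep1 F m t)) -[LHS]imset_id.
  by apply: eq_imset => i; rewrite perm1.
have e1 := inE2 _ e0; rewrite ya yu in e1.
have e2 := inE2 _ e1; rewrite yw ya in e2.
apply: (@pair_orb_contra set0 d a w u t5 tr _ e1 e2).
move: dn un; rewrite /= !inE !negb_or.
case/andP => /andP[-> ->] -> /and3P[/andP[-> ->] n _]; by rewrite /= andbT eq_sym.
Qed.

(** For t = 5, an element y that stabilises the triple and moves c gives a 3-cycle on it, namely y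
    or x y. For t = 6, c is a fixed point of x in the orbit of length 3 not containing a, so no y
    can move c to a or b. *)
Lemma distinguished_triple (x : {perm tensV F m t}) : 3 < t <= 6 -> x \in G ->
  (sg x ^+ 2 = 1)%g -> sg x != 1%g ->
  exists a b c, [/\ uniq [:: a; b; c], sg x a = b, sg x b = a, sg x c = c &
    forall y, y \in G -> sg y @: [set a; b; c] = [set a; b; c] -> sg y c = c].
Proof.
move=> tb xG x2 nx; set s := sg x in x2 nx *.
have ss i : s (s i) = i by rewrite -permM -[(s * s)%g]/(s ^+ 2)%g x2 perm1.
have [a sa] : exists a, s a != a.
  apply/existsP; rewrite -negb_forall; apply: contra nx => /forallP h.
  by apply/eqP/permP => i; rewrite perm1 (eqP (h i)).
have fixc c : s c = c -> uniq [:: a; s a; c].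
  move=> sc; have ca : a != c by apply: contraNneq sa => ->; rewrite sc.
  rewrite /= !inE negb_or [a == s a]eq_sym sa ca /=.
  rewrite andbT;   by apply: contra ca => /eqP e; rewrite -[a]ss e sc.
have inC c y i : sg y @: [set a; s a; c] = [set a; s a; c] ->
    i \in [set a; s a; c] -> sg y i \in [set a; s a; c].
  by move=> yC iC; have := imset_f (sg y) iC; rewrite yC.
case: (pos_orb_cases a tb) => [[t5 _]|[t6 c3]].
  have tr i : pos_orb i = setT.
    by case: (pos_orb_cases i tb) => [[]//|[t6 _]]; rewrite t6 in t5.
  have [c _ sc] : exists2 c, c \in [set: 'I_t] & s c = c.
    by apply: involution_fix x2 _ _ => //; rewrite cardsT card_ord t5.
  exists a, (s a), c; split=> //; first exact: fixc.
  move=> y yG yC; apply/eqP; apply: contraT => yc; exfalso.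
  have yi i := inC _ _ c y i yC.
  have := yi c; have := yi a; have := yi (s a); rewrite !inE !eqxx !orbT (negbTE yc) orbF => /(_ isT) yb /(_ isT) ya /(_ isT) yc'.
  have un := fixc c sc; have := un; rewrite /= !inE !negb_or => /andP[/andP[n1 n2] /andP[n3 _]].
  have neq i j : i != j -> sg y i = sg y j -> False.
    by move=> ij /perm_inj e; rewrite e eqxx in ij.
  have sxy i : sg (x * y)%g i = sg y (s i) by rewrite (sgMG m1 sG) // permM.
  have un' : uniq [:: a; c; s a] by rewrite /= !inE negb_or n1 n2 eq_sym n3.
  have xyG : (x * y)%g \in G by rewrite groupM.
  case/orP: yc' => /eqP ec.
    case/orP: ya => [/orP[]|] /eqP ea.
    - by apply: (neq a c); rewrite ?ea ?ec.
    - case/orP: yb => [/orP[]|] /eqP eb.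
      + by apply: (neq (s a) c); rewrite ?eb ?ec.
      + by apply: (neq a (s a)); rewrite ?ea ?eb.
      + exact: three_cycle_contra t5 tr yG un ea eb ec.
    - case/orP: yb => [/orP[]|] /eqP eb.
      + by apply: (neq (s a) c); rewrite ?eb ?ec.
      + by apply: (three_cycle_contra t5 tr xyG un); rewrite sxy ?ss ?sc.
      + by apply: (neq a (s a)); rewrite ?ea ?eb.
  case/orP: ya => [/orP[]|] /eqP ea.
  - case/orP: yb => [/orP[]|] /eqP eb.
    + by apply: (neq a (s a)); rewrite ?ea ?eb.
    + by apply: (neq (s a) c); rewrite ?eb ?ec.
    + by apply: (three_cycle_contra t5 tr xyG un'); rewrite sxy ?ss ?sc.
  - by apply: (neq a c); rewrite ?ea ?ec.
  - case/orP: yb => [/orP[]|] /eqP eb.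
    + exact: three_cycle_contra t5 tr yG un' ea ec eb.
    + by apply: (neq (s a) c); rewrite ?eb ?ec.
    + by apply: (neq a (s a)); rewrite ?ea ?eb.
have [c cO sc] : exists2 c, c \in ~: pos_orb a & s c = c.
  apply: involution_fix x2 _ _; last by rewrite c3.
  move=> i; rewrite !inE; apply: contra => h; rewrite -[i]ss; exact: pos_orb_sg.
exists a, (s a), c; split=> //; first exact: fixc.
move=> y yG yC; have := inC _ _ c y c yC; rewrite !inE eqxx orbT => /(_ isT).
have cy : sg y c \in pos_orb c by apply: pos_orb_sg => //; exact: pos_orb_id.
rewrite inE in cO; case/orP => [/orP[]|] /eqP // e; case/negP: cO; apply: pos_orb_sym.
  by rewrite -e.
by rewrite -[a]ss -e; exact: pos_orb_sg.
Qed.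

End Positions.

(** * Tensors entangling three positions *)

Section PureTensors.
Local Open Scope ring_scope.
Variables (F : finFieldType) (m t : nat).
Implicit Types (U : 'I_m -> 'I_t -> 'cV[F]_m).

(** Taking exactly m pure tensors makes the left factor in [flat_tsum] square. *)
Definition tsum U : tensV F m t :=
  [ffun g : {ffun 'I_t -> 'I_m} => \sum_k \prod_i U k i (g i) 0].

Lemma eq_tsum U U' : (forall k i, U k i = U' k i) -> tsum U = tsum U'.
Proof.
move=> e; apply/ffunP => g; rewrite !ffunE; apply: eq_bigr => k _.
by apply: eq_bigr => i _; rewrite e.
Qed.

Lemma tens_act_tsum (A : 'I_t -> 'M[F]_m) U : tens_act A (tsum U) = tsum (fun k i => A i *m U k i).
Proof.
apply/ffunP => g; rewrite !ffunE.
under eq_bigr do rewrite ffunE big_distrr /=.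
rewrite exchange_big /=; apply: eq_bigr => k _.
under eq_bigr do rewrite -big_split /=.
by under [RHS]eq_bigr do rewrite mxE; rewrite bigA_distr_bigA.
Qed.

Lemma perm_act_tsum (s : 'S_t) U : perm_act s (tsum U) = tsum (fun k i => U k (s^-1%g i)).
Proof.
apply/ffunP => g; rewrite !ffunE; apply: eq_bigr => k _.
rewrite [RHS](reindex_inj (@perm_inj _ s)) /=; apply: eq_bigr => i _.
by rewrite ffunE permK.
Qed.

Lemma flat_tsum c U : flat c (tsum U) = (\matrix_(a, k) U k c a 0) *m
  (\matrix_(k, h) \prod_j U k (lift c j) ((enum_val h : {ffun 'I_t.-1 -> 'I_m}) j) 0).
Proof.
apply/matrixP => a h; rewrite !mxE ffunE; apply: eq_bigr => k _.
rewrite (bigD1_ord c) //= insert_at_c !mxE; congr (_ * _).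
by apply: eq_bigr => j _; rewrite insert_at_lift.
Qed.

Lemma ghz_tsum (C : {set 'I_t}) : C != set0 -> ghz F m (set_blk C) =
  tsum (fun k i => if i \in C then delta_mx k 0 else const_mx 1).
Proof.
case/set0Pn => c cC; apply/ffunP => g; rewrite !ffunE.
have E k i : (if i \in C then delta_mx k 0 else const_mx 1 : 'cV[F]_m) (g i) 0 =
    ((i \in C) ==> (g i == k))%:R by case: (i \in C); rewrite !mxE ?eqxx ?andbT.
under [RHS]eq_bigr do under eq_bigr do rewrite E.
case: (boolP [forall _, _]) => [/forallP h|].
  rewrite (bigD1 (g c)) //= [X in _ + X]big1 ?addr0; last first.
    by move=> k kg; rewrite (bigD1 c) //= cC /= eq_sym (negbTE kg) mul0r.
  rewrite big1 // => i _; case: (boolP (i \in C)) => //= iC.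
  by have /forallP/(_ c) := h i; rewrite /set_blk iC cC eqxx /= => ->.
rewrite negb_forall => /existsP[i]; rewrite negb_forall => /existsP[j].
rewrite negb_imply /set_blk => /andP[eij gij]; symmetry; apply: big1 => k _.
have [iC jC] : i \in C /\ j \in C.
  by move: eij gij; case: ifP; case: ifP => // _ _ /eqP[->]; rewrite eqxx.
have [e|ne] := eqVneq (g i) k; last by rewrite (bigD1 i) //= iC /= (negbTE ne) mul0r.
by rewrite (bigD1 j) //= jC /= -e eq_sym (negbTE gij) mul0r.
Qed.

End PureTensors.

Section Transfer.
Local Open Scope ring_scope.
Variables (F : finFieldType) (m t : nat).
Hypotheses (m1 : (1 < m)%N) (ch2 : 2%N \in [pchar F]).

Lemma unit_vector_map n (u v : 'cV[F]_n) : u != 0 -> v != 0 ->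
  exists2 P : 'M[F]_n, P \in unitmx & P *m u = v.
Proof.
suff H (w : 'cV[F]_n) : w != 0 -> exists2 P : 'M[F]_n, P \in unitmx & P *m pid_mx 1 = w.
  move=> /H[P uP eP] /H[Q uQ eQ]; exists (Q *m invmx P); rewrite ?unitmx_mul ?unitmx_inv ?uQ //.
  by rewrite -eP mulmxA mulmxKV.
move=> w0; have r1 : \rank w = 1%N.
  by apply/eqP; rewrite eqn_leq rank_leq_col lt0n mxrank_eq0.
have := mulmx_ebase w; rewrite r1 => e.
have [c cE] : exists c, row_ebase w = c%:M by exists (row_ebase w 0 0); exact: mx11_scalar.
have c0 : c != 0 by have := row_ebase_unit w; rewrite cE unitmxE det_scalar expr1 unitfE.
exists (c *: col_ebase w); first by rewrite unitmxZ ?unitfE // col_ebase_unit.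
by rewrite -scalemxAl -[RHS]e cE mul_mx_scalar.
Qed.

(** In characteristic 2 the scalar l is a square d^2, and (A - d)^2 = A^2 - d^2 = 0. *)
Lemma eigenvector_sq_scalar n (A : 'M[F]_n.+1) l : l != 0 -> A *m A = l%:M ->
  exists (u : 'cV_n.+1) d, [/\ u != 0, d != 0, A *m u = d *: u & (A - d%:M) ^+ 2 = 0].
Proof.
move=> l0 AA; have [d dE] := frobenius_surj l ch2.
have d0 : d != 0 by apply: contraNneq l0 => d0; rewrite -dE d0 expr0n.
have N2 : (A - d%:M) ^+ 2 = 0.
  have ch : 2%N \in [pchar 'M[F]_n.+1] by rewrite inE /= -scaler_nat (pcharf0 ch2) scale0r.
  have cm : GRing.comm A d%:M by rewrite /GRing.comm -[LHS]/(_ *m _) -[RHS]/(_ *m _) scalar_mxC.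
  have := pFrobenius_autB_comm ch cm; rewrite !pFrobenius_autE => ->.
  by rewrite !expr2 -[A * A]/(A *m A) AA -[_%:M * _]/(_ *m _) -scalar_mxM -expr2 dE subrr.
have nu : A - d%:M \notin unitmx.
  apply/negP => u; have : (A - d%:M) ^+ 2 \is a GRing.unit by rewrite unitrX.
  by rewrite N2 unitr0.
have : kermx (A - d%:M)^T != 0.
  by rewrite kermx_eq0 row_free_unit unitmx_tr.
case/rowV0Pn => u /sub_kermxP/(congr1 trmx); rewrite trmx_mul trmxK trmx0 mulmxBl.
rewrite mul_scalar_mx => /eqP; rewrite subr_eq0 => /eqP e u0.
by exists u^T, d; split=> //; rewrite -trmx0 (inj_eq trmx_inj).
Qed.

(** These vectors fill the positions outside the triple and are permuted by x up to scalars: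
    eigenvectors at fixed positions; on a swapped pair, [e0] at the smaller position and its image
    at the larger. *)
Lemma compatible_vectors x (A : 'I_t -> 'M[F]_m) s : rep x A s -> (x ^+ 2 = 1)%g ->
  exists (r : 'I_t -> 'cV[F]_m) (rho : 'I_t -> F), forall d,
    [/\ r d != 0, rho d != 0 & A d *m r (s^-1%g d) = rho d *: r d].
Proof.
move=> rx x2; have := repM rx rx; rewrite -[(x * x)%g]/(x ^+ 2)%g x2 => r2.
have s2 := rep1_perm m1 r2; rewrite s2 in r2.
have ssE d : s (s d) = d by rewrite -permM s2 perm1.
have sV d : s^-1%g d = s d by rewrite -[d in LHS]ssE permK.
have AA d : exists2 l, l != 0 & A d *m A (s d) = l%:M.
  have [l l0] := rep_scalar d r2 (rep1 F m t); rewrite sV => e.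
  by exists l => //; rewrite e scalemx1.
have [la laP] : exists la : 'I_t -> F, forall d, la d != 0 /\ A d *m A (s d) = (la d)%:M.
  by have [|la h] := @fin_all_exists _ _ (fun d l => l != 0 /\ A d *m A (s d) = l%:M) _;
    [move=> d; have [l ? ?] := AA d; exists l|exists la].
have [ei eiP] : exists ei : 'I_t -> 'cV[F]_m * F, forall d, s d = d ->
    [/\ (ei d).1 != 0, (ei d).2 != 0 & A d *m (ei d).1 = (ei d).2 *: (ei d).1].
  pose Q d (q : 'cV[F]_m * F) := s d = d -> [/\ q.1 != 0, q.2 != 0 & A d *m q.1 = q.2 *: q.1].
  suff h d : exists q, Q d q by have [ei eiP] := fin_all_exists h; exists ei.
  rewrite /Q; have [e|ne] := eqVneq (s d) d; last first.
    by exists (0, 0) => e; rewrite e eqxx in ne.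
  have := AA d; rewrite e; case: (m) (ltnW m1) (A d) => [|n] // _ Ad [l l0 AAd].
  by have [u [k [u0 k0 Au _]]] := eigenvector_sq_scalar l0 AAd; exists (u, k).
pose e0 : 'cV[F]_m := delta_mx (Ordinal (ltnW m1)) 0.
have e00 : e0 != 0.
  by apply/eqP => /matrixP/(_ (Ordinal (ltnW m1)) 0)/eqP; rewrite !mxE !eqxx oner_eq0.
exists (fun d => if s d == d then (ei d).1 else if (d < s d)%N then e0 else A d *m e0).
exists (fun d => if s d == d then (ei d).2 else if (d < s d)%N then la d else 1) => d.
rewrite sV ssE; have [e|ne] := eqVneq (s d) d.
  by have [? ? ?] := eiP d e; rewrite e.
have [l0 lE] := laP d.
case: ltngtP => [lt|gt|/val_inj e]; last by move: ne; rewrite -{1}e eqxx.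
  by rewrite mulmxA lE mul_scalar_mx.
rewrite oner_eq0 scale1r; split=> //.
by apply: contra e00 => /eqP h; rewrite -[e0](mulKmx (rx.1 d)) h mulmx0.
Qed.

Variables (G : {group {perm tensV F m t}}).
Hypotheses (sG : G \subset tensor_group F m t) (cop : forall v, coprime #|orbit 'P G v| 2).
Variables (x : {perm tensV F m t}) (A : 'I_t -> 'M[F]_m) (a b c : 'I_t).
Hypotheses (xG : x \in G) (x2 : (x ^+ 2 = 1)%g) (rx : rep x A (sg x)).
Hypotheses (un : uniq [:: a; b; c]) (sa : sg x a = b) (sb : sg x b = a) (sc : sg x c = c).
Variables (r : 'I_t -> 'cV[F]_m) (rho : 'I_t -> F).
Hypothesis r_ok : forall d, [/\ r d != 0, rho d != 0 & A d *m r ((sg x)^-1%g d) = rho d *: r d].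

(* sum_k Phi e_k (x) e_k (x) A_b e_(tau k) at the positions c, a, b, times the
   vectors r elsewhere; up to a scalar, x replaces Phi by A_c Phi tau. *)
Definition entangled (Phi : 'M[F]_m) (tau : 'S_m) : tensV F m t := tsum (fun k i =>
  if i == c then col k Phi else if i == a then delta_mx k 0
  else if i == b then A b *m delta_mx (tau k) 0 else r i).

Definition entangled_row (tau : 'S_m) : 'M[F]_(m, #|{ffun 'I_t.-1 -> 'I_m}|) :=
  \matrix_(k, h) \prod_j (let i := lift c j in if i == a then delta_mx k 0
  else if i == b then A b *m delta_mx (tau k) 0 else r i)
    ((enum_val h : {ffun 'I_t.-1 -> 'I_m}) j) 0.

Let nab : a != b. Proof. by move: un; rewrite /= !inE negb_or => /andP[/andP[]]. Qed.
Let nac : a != c. Proof. by move: un; rewrite /= !inE negb_or => /andP[/andP[]]. Qed.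
Let nbc : b != c. Proof. by move: un; rewrite /= !inE negb_or => /andP[_ /andP[]]. Qed.

Lemma flat_entangled Phi tau : flat c (entangled Phi tau) = Phi *m entangled_row tau.
Proof.
rewrite flat_tsum; congr (_ *m _); apply/matrixP => k h; rewrite !mxE ?eqxx ?mxE //.
by apply: eq_bigr => j _ /=; rewrite eq_sym (negbTE (neq_lift c j)).
Qed.

(** The k-th term carries e_k at position a, so a column with index k there sees the k-th row
    alone. *)
Lemma entangled_row_free tau : row_free (entangled_row tau).
Proof.
apply: inj_row_free => y y0; apply/matrixP => i0 k; rewrite ord1 mxE {i0}.
have nz (u : 'cV[F]_m) : u != 0 -> exists i, u i 0 != 0.
  move=> u0; apply/existsP; rewrite -negb_forall; apply: contra u0 => /forallP h.
  by apply/eqP/matrixP => i j; rewrite ord1 mxE (eqP (h i)).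
have [ib ibP] : exists i, (A b *m delta_mx (tau k) 0 : 'cV[F]_m) i 0 != 0.
  apply: nz; apply/eqP => h; have : delta_mx (tau k) 0 = 0 :> 'cV[F]_m.
    by rewrite -[LHS](mulKmx (rx.1 b)) h mulmx0.
  by move/matrixP/(_ (tau k) 0)/eqP; rewrite !mxE !eqxx oner_eq0.
have [rr rrP] : exists rr : 'I_t -> 'I_m, forall d, r d (rr d) 0 != 0.
  suff h d : exists i, r d i 0 != 0 by have [rr rrP] := fin_all_exists h; exists rr.
  by have [? _ _] := r_ok d; exact: nz.
pose h : {ffun 'I_t.-1 -> 'I_m} := [ffun j => let i := lift c j in
  if i == a then k else if i == b then ib else rr i].
have := congr1 (fun M : 'rV_ _ => M 0 (enum_rank h)) y0; rewrite !mxE (bigD1 k) //= [X in _ + X]big1.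
  rewrite addr0 mxE enum_rankK => /eqP; rewrite mulf_eq0 => /orP[/eqP //|].
  rewrite prodf_seq_eq0 => /hasP[j _]; rewrite ffunE /=.
  case: ifP => _; first by rewrite !mxE !eqxx oner_eq0.
  by case: ifP => _; rewrite ?(negbTE ibP) // (negbTE (rrP _)).
move=> l lk; rewrite mxE enum_rankK.
have [j ej] : exists j, lift c j = a.
  by case: (unliftP c a) => [j ->|e]; [exists j|move: nac; rewrite e eqxx].
by rewrite (bigD1 j) //= ffunE ej eqxx /= eqxx mxE [k == l]eq_sym (negbTE lk) /= mul0r mulr0.
Qed.

(** At a and b, x turns e_k and A_b e_(tau k) into multiples of e_(tau k) and A_b e_k. These are the
    vectors of the term tau k, as tau is an involution, so reindexing by tau moves the whole change
    to Phi. *)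
Lemma entangled_act : exists2 k, k != 0 & forall Phi tau, (tau * tau = 1)%g ->
  flat c (x (entangled Phi tau)) = k *: (A c *m Phi *m perm_mx tau *m entangled_row tau).
Proof.
have [l l0 AA] : exists2 l, l != 0 & A a *m A b = l%:M.
  have := repM rx rx; rewrite -[(x * x)%g]/(x ^+ 2)%g x2 => r2.
  have s2 := rep1_perm m1 r2; rewrite s2 in r2.
  have [l l0] := rep_scalar a r2 (rep1 F m t); rewrite -[in A (_ a)]sb permK => e.
  by exists l => //; rewrite e scalemx1.
pose w j := let i := lift c j in if i == a then l else if i == b then 1 else rho i.
exists (\prod_j w j).
  rewrite prodf_seq_neq0; apply/allP => j _ /=; rewrite /w /=; case: ifP => // _.
  by case: ifP; rewrite ?oner_eq0 //; have [] := r_ok (lift c j).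
move=> Phi tau tt; have tk k : tau (tau k) = k by rewrite -permM tt perm1.
rewrite rx.2 /entangled perm_act_tsum tens_act_tsum flat_tsum -mulmxA -row_permE.
rewrite scalemxAr; congr (_ *m _).
  have sVc : (sg x)^-1%g c = c by rewrite -{1}sc permK.
  apply/matrixP => i k; rewrite mxE sVc eqxx !mxE.
  by apply: eq_bigr => j _; rewrite !mxE.
apply/matrixP => k h; rewrite !mxE -big_split /=; apply: eq_bigr => j _.
rewrite /w /=; set i := lift c j; have ic : i == c = false by rewrite eq_sym (negbTE (neq_lift _ _)).
have inv j' : ((sg x)^-1%g i == j') = (i == sg x j').
  by rewrite -(inj_eq (@perm_inj _ (sg x))) permKV.
rewrite !inv sa sb sc ic.
have [->|nia] := eqVneq i a.
  rewrite (negbTE nab) mulmxA AA mul_scalar_mx mxE //.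
have [->|nib] := eqVneq i b; first by rewrite tk mul1r.
by have [_ _ ->] := r_ok i; rewrite mxE.
Qed.

(** The stabiliser of position c contains the fixator of the tensor, so the row/column argument
    applies to it. For tau = 1, x acts on the rows by a scalar; for A_c scalar, on the columns.
    Rescaling makes that side trivial, hence the other side too. *)
Lemma entangled_transfer Phi tau :
  (tau * tau = 1)%g -> (forall y, y \in G -> y (entangled Phi tau) = entangled Phi tau -> sg y c = c) ->
  (tau = 1%g -> (exists R, A c *m Phi = Phi *m R) -> exists k, k *: (A c *m Phi) = Phi) /\
  (forall mu C, A c = mu%:M -> C *m Phi = Phi *m perm_mx tau -> exists k, k *: (Phi *m perm_mx tau) = Phi).
Proof.
move=> tt fixc; have [k k0 act] := entangled_act.
set v0 := entangled Phi tau in fixc.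
pose L := [set y in G | sg y c == c].
have gL : group_set L.
  apply/group_setP; split; first by rewrite inE group1 (sgE m1 (rep1 F m t)) perm1 eqxx.
  move=> y z; rewrite !inE => /andP[yG /eqP yc] /andP[zG /eqP zc].
  by rewrite groupM // (sgMG m1 sG) // permM yc zc eqxx.
pose LG := Group gL.
have sLG : LG \subset G by apply/subsetP => y; rewrite inE => /andP[].
have sC : 'C_G[v0 | 'P]%g \subset LG.
  by apply/subsetP => y /setIP[yG /astab1P/= fy]; rewrite inE yG; apply/eqP/fixc.
have copL := orbit_sub_coprime sLG sC (cop v0).
have xL : x \in LG by rewrite inE xG sc eqxx.
have px : (2.-elt x)%g.
  by apply: (@pnat_dvd _ 2); [rewrite order_dvdn x2|rewrite pnat_id].
have tsL : two_sided_group (flat (F := F) c) LG.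
  move=> y; rewrite inE => /andP[yG /eqP yc].
  have [A1 r1] := sg_rep m1 (subsetP sG _ yG).
  by have [B1 rB1] := flat_two_sided (ltnW m1) r1 yc; exists (A1 c), B1.
have [B rB] := flat_two_sided (ltnW m1) rx sc.
have [uA uB eB] := rB; set W := entangled_row tau; have Wf : row_free W := entangled_row_free tau.
have [Wr WrK] := row_freeP Wf.
have v0E : flat c v0 = Phi *m W by rewrite flat_entangled.
have XB : flat c v0 *m B = k *: (Phi *m perm_mx tau *m W).
  have := eB v0; rewrite act // => /esym; rewrite -!mulmxA scalemxAr => /(can_inj (mulKmx uA)) ->.
  by rewrite mulmxA.
have ts d : d != 0 -> two_sided (flat (F := F) c) x (d *: A c) (d^-1 *: B).
  move=> d0; split; rewrite ?unitmxZ ?unitfE ?invr_eq0 // => v.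
  by rewrite eB -scalemxAr -!scalemxAl scalerA mulVf // scale1r.
have inj := bij_inj (flat_bij F m c).
have pr2 : prime 2 by [].
split=> [t1 [R eR]|mu C eA eC].
  have P1 : perm_mx tau = 1%:M :> 'M[F]_m by rewrite t1 perm_mx1.
  rewrite P1 mulmx1 in XB.
  have := @row_fixed_col_fixed _ _ _ _ 2 (flat (F := F) c) LG v0 x _ _ (Wr *m (k *: R) *m W)
    pr2 inj tsL copL xL px (ts k k0).
  rewrite -scalemxAr XB scalerA mulVf // scale1r v0E => /(_ erefl).
  have -> : (k *: A c) *m (Phi *m W) = Phi *m W *m (Wr *m (k *: R) *m W).
    rewrite !mulmxA -(mulmxA Phi W Wr) WrK mulmx1.
    by rewrite -scalemxAl eR -scalemxAr.
  move=> /(_ erefl); rewrite !mulmxA -(mulmxA Phi W Wr) WrK mulmx1 => /(row_free_inj Wf) e.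
  by exists k; rewrite eR scalemxAr.
have mu0 : mu != 0.
  apply: contraTneq uA => mu0; rewrite eA mu0 unitmxE det_scalar expr0n.
  by rewrite gtn_eqF ?unitr0 // ltnW.
have := @col_fixed_row_fixed _ _ _ _ 2 (flat (F := F) c) LG v0 pr2 tsL copL x _ _ ((mu * k) *: C)
  xL px (ts mu^-1 _).
rewrite invr_eq0 mu0 invrK eA scale_scalar_mx mulVf // mul1mx -scalemxAr XB v0E scalerA.
rewrite -scalemxAl mulmxA eC => /(_ isT erefl erefl).
rewrite scalemxAl => /(row_free_inj Wf) e.
by exists (mu * k).
Qed.

End Transfer.

Section EntangledApplications.
Local Open Scope ring_scope.
Variables (F : finFieldType) (m t : nat).
Hypotheses (m1 : (1 < m)%N) (ch2 : 2%N \in [pchar F]).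
Variables (G : {group {perm tensV F m t}}).
Hypotheses (sG : G \subset tensor_group F m t) (cop : forall v, coprime #|orbit 'P G v| 2).
Variables (x : {perm tensV F m t}) (a b c : 'I_t).
Hypotheses (xG : x \in G) (x2 : (x ^+ 2 = 1)%g).
Hypotheses (un : uniq [:: a; b; c]) (sa : sg x a = b) (sb : sg x b = a) (sc : sg x c = c).

Let i0 := Ordinal (ltnW m1).
Let i1 := Ordinal m1.
Let tau := tperm i0 i1.

Let tauK : (tau * tau = 1)%g. Proof. exact: tperm2. Qed.
Let i01 : (i0 == i1) = false. Proof. by []. Qed.

(** Makes [ghz_stab] available: for Phi = 1, fixators preserve the set {a,b,c}. *)
Lemma entangled1_ghz (A : 'I_t -> 'M[F]_m) r (s : 'S_m) : rep x A (sg x) -> (s * s = 1)%g ->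
  (forall d, r d != 0) -> exists2 P, forall i, P i \in unitmx &
  entangled A a b c r 1%:M s = tens_act P (ghz F m (set_blk [set a; b; c])).
Proof.
move=> rx ss r0; have sK k : s (s k) = k by rewrite -permM ss perm1.
have one0 : const_mx 1 != 0 :> 'cV[F]_m.
  by apply/eqP => /matrixP/(_ i0 0)/eqP; rewrite !mxE oner_eq0.
have [Q QP] : exists Q : 'I_t -> 'M[F]_m, forall d, Q d \in unitmx /\ Q d *m const_mx 1 = r d.
  apply: (@fin_all_exists _ (fun=> 'M[F]_m) (fun d Q => Q \in unitmx /\ Q *m const_mx 1 = r d)).
  by move=> d; have [Q uQ eQ] := unit_vector_map one0 (r0 d); exists Q.
exists (fun i => if i == c then 1%:M else if i == a then 1%:M
  else if i == b then A b *m perm_mx s else Q i) => [i|].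
  case: ifP => _; rewrite ?unitmx1 //; case: ifP => _; rewrite ?unitmx1 //.
  by case: ifP => _; rewrite ?unitmx_mul ?unitmx_perm ?rx.1 //; have [] := QP i.
rewrite ghz_tsum; last by apply/set0Pn; exists a; rewrite !inE eqxx.
rewrite tens_act_tsum; apply: eq_tsum => k i; rewrite !inE.
have [->|nic] := eqVneq i c; first by rewrite orbT mul1mx; apply/matrixP => u v; rewrite !mxE ord1 eqxx andbT.
have [->|nia] := eqVneq i a; first by rewrite mul1mx.
have [_|nib] := eqVneq i b; last by have [_ ->] := QP i.
rewrite /= -mulmxA; congr (_ *m _); apply/matrixP => u v.
rewrite -row_permE !mxE; congr (_ && _)%:R.
by apply/eqP/eqP => [->|<-]; rewrite ?sK.
Qed.

(** With Phi = 1 the transfer forces a scalar matrix where there is none: the matrix of a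
    transposition tau if A_c is scalar, and A_c itself, with tau = 1, if it is not. *)
Lemma no_distinguished_triple :
  ~ (forall y, y \in G -> sg y @: [set a; b; c] = [set a; b; c] -> sg y c = c).
Proof.
move=> fixc; have [A rx] := sg_rep m1 (subsetP sG _ xG).
have [r [rho r_ok]] := compatible_vectors m1 ch2 rx x2.
have C1 : (1 < #|[set a; b; c]|)%N.
  apply: (@leq_trans #|[set a; b]|); last exact/subset_leq_card/subsetUl.
  by rewrite cards2; move: un; rewrite /= !inE negb_or => /andP[/andP[-> _] _].
have stab s : (s * s = 1)%g -> forall y, y \in G ->
    y (entangled A a b c r 1%:M s) = entangled A a b c r 1%:M s -> sg y c = c.
  move=> ss y yG; have [P uP ->] := entangled1_ghz rx ss (fun d => let: And3 h _ _ := r_ok d in h).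
  move=> fy; apply: fixc => //; apply: (set_blk_stab C1 yG) => i j e.
  exact: (ghz_stab m1 (subsetP sG _ yG) uP fy e).
case: (boolP (is_scalar_mx (A c))) => [/is_scalar_mxP[mu eA]|nsc].
  have [_ /(_ mu (perm_mx tau) eA)] := entangled_transfer m1 sG cop xG x2 rx un sa sb sc r_ok tauK (stab _ tauK).
  rewrite mulmx1 mul1mx => /(_ erefl)[k] /matrixP/(_ i0 i0)/eqP.
  by rewrite !mxE tpermL [i1 == i0]eq_sym i01 mulr0 eqxx eq_sym oner_eq0.
have ss : (1 * 1 = 1 :> 'S_m)%g by rewrite mulg1.
have [/(_ erefl) h _] := entangled_transfer m1 sG cop xG x2 rx un sa sb sc r_ok ss (stab _ ss).
case: h => [|k]; first by exists (A c); rewrite mulmx1 mul1mx.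
rewrite mulmx1 => e; case/negP: nsc; apply/is_scalar_mxP; exists k^-1.
have k0 : k != 0.
  by apply: contra_eq_neq e => ->; rewrite scale0r eq_sym; apply/eqP => /matrixP/(_ i0 i0)/eqP; rewrite !mxE eqxx oner_eq0.
by rewrite -[A c]scale1r -(mulVf k0) -scalerA e scalemx1.
Qed.

End EntangledApplications.

(** * Three factors of dimension at least 3 *)

Section ThreeFactors.
Local Open Scope ring_scope.
Variables (F : finFieldType) (m t : nat).

(** Bases at position d make the left factor of [flat_tsum] invertible, and bases at a second
    position e make the rows of the right factor independent. *)
Lemma rank_flat_tsum (U : 'I_m -> 'I_t -> 'cV[F]_m) d e : d != e ->
  (\matrix_(i, k) U k d i 0 : 'M[F]_m) \in unitmx -> (\matrix_(i, k) U k e i 0 : 'M[F]_m) \in unitmx ->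
  (forall k i, U k i != 0) -> \rank (flat d (tsum U)) = m.
Proof.
move=> de ud ue U0; rewrite flat_tsum.
rewrite mxrankMfree -?row_free_unit ?mxrank_unit //.
apply: inj_row_free => y y0; apply/matrixP => i0 k0; rewrite ord1 mxE {i0}.
have [rr rrP] : exists rr : 'I_t -> 'I_m, forall j, U k0 j (rr j) 0 != 0.
  suff h j : exists i, U k0 j i 0 != 0 by have [rr rrP] := fin_all_exists h; exists rr.
  apply/existsP; rewrite -negb_forall; apply: contra (U0 k0 j) => /forallP h.
  by apply/eqP/matrixP => i z; rewrite ord1 mxE (eqP (h i)).
have [je lje] : exists j, lift d j = e.
  by case: (unliftP d e) => [j ->|e0]; [exists j|move: de; rewrite e0 eqxx].
pose z := \col_k (y 0 k * \prod_(j | j != je) U k (lift d j) (rr (lift d j)) 0).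
have : (\matrix_(i, k) U k e i 0 : 'M[F]_m) *m z = 0.
  apply/matrixP => i w; rewrite ord1 !mxE {w}.
  pose h : {ffun 'I_t.-1 -> 'I_m} := [ffun j => if j == je then i else rr (lift d j)].
  have := congr1 (fun M : 'rV_ _ => M 0 (enum_rank h)) y0; rewrite !mxE; apply: etrans.
  apply: eq_bigr => k _; rewrite !mxE enum_rankK [in RHS](bigD1 je) //= ffunE eqxx lje mulrCA.
  by congr (_ * (_ * _)); apply: eq_bigr => j jj; rewrite ffunE (negbTE jj).
move/(congr1 (mulmx (invmx (\matrix_(i, k) U k e i 0)))); rewrite mulKmx // mulmx0.
move/matrixP/(_ k0 0)/eqP; rewrite !mxE mulf_eq0 => /orP[/eqP //|].
by rewrite prodf_seq_eq0 => /hasP[j _ /andP[_]]; rewrite (negbTE (rrP _)).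
Qed.

Hypotheses (m1 : (1 < m)%N) (ch2 : 2%N \in [pchar F]).
Variables (G : {group {perm tensV F m t}}).
Hypotheses (sG : G \subset tensor_group F m t) (cop : forall v, coprime #|orbit 'P G v| 2).
Variables (x : {perm tensV F m t}) (a b c : 'I_t).
Hypotheses (xG : x \in G) (x2 : (x ^+ 2 = 1)%g).
Hypotheses (un : uniq [:: a; b; c]) (sa : sg x a = b) (sb : sg x b = a) (sc : sg x c = c).
Hypotheses (all3 : forall i, i \in [:: a; b; c]) (m2 : (2 < m)%N).

Let i0 := Ordinal (ltnW m1).
Let i1 := Ordinal m1.
Let tau := tperm i0 i1.
Let i01 : (i0 == i1) = false. Proof. by []. Qed.

(** The flattening has rank m > 2 at a and at b but at most 2 at c, and by [rank_flat_rep] a fixator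
    cannot move c to a position of larger rank. *)
Lemma entangled_fixes (A : 'I_t -> 'M[F]_m) r Phi s y : rep x A (sg x) -> (s * s = 1)%g ->
  (forall k, col k Phi != 0) -> (\rank Phi <= 2)%N -> y \in G ->
  y (entangled A a b c r Phi s) = entangled A a b c r Phi s -> sg y c = c.
Proof.
move=> rx ss Phi0 rPhi yG fy.
have nab : a != b by move: un; rewrite /= !inE negb_or => /andP[/andP[]].
have nac : a != c by move: un; rewrite /= !inE negb_or => /andP[/andP[]].
have nbc : b != c by move: un; rewrite /= !inE negb_or => /andP[_ /andP[]].
have [B rB] := sg_rep m1 (subsetP sG _ yG).
have := rank_flat_rep c (entangled A a b c r Phi s) rB; rewrite fy.
set v0 := entangled _ _ _ _ _ _ _.
have rc : (\rank (flat c v0) <= 2)%N by rewrite flat_entangled //; apply: leq_trans (mxrankM_maxl _ _) rPhi.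
suff rm d : d != c -> \rank (flat d v0) = m.
  move=> le; apply/eqP; apply: contraTT m2 => /rm rd; rewrite -leqNgt.
  by rewrite -rd; apply: leq_trans le rc.
have d0 k : delta_mx k 0 != 0 :> 'cV[F]_m.
  by apply/eqP => /matrixP/(_ k 0)/eqP; rewrite !mxE !eqxx oner_eq0.
pose U k i := if i == c then col k Phi else if i == a then delta_mx k 0
  else if i == b then A b *m delta_mx (s k) 0 else r i.
have U0 k i : U k i != 0.
  rewrite /U; have := all3 i; rewrite !inE; have [_|nic] := eqVneq i c; first by rewrite Phi0.
  have [_|nia] := eqVneq i a; first by rewrite d0.
  rewrite orbF => /= ->; apply: contra (d0 (s k)) => /eqP h.
  by rewrite -[delta_mx _ _](mulKmx (rx.1 b)) h mulmx0.
have ua : (\matrix_(i, k) U k a i 0 : 'M[F]_m) \in unitmx.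
  suff -> : (\matrix_(i, k) U k a i 0 : 'M[F]_m) = 1%:M by rewrite unitmx1.
  by apply/matrixP => i k; rewrite !mxE /U (negbTE nac) eqxx mxE andbT.
have ub : (\matrix_(i, k) U k b i 0 : 'M[F]_m) \in unitmx.
  suff -> : (\matrix_(i, k) U k b i 0 : 'M[F]_m) = A b *m perm_mx s.
    by rewrite unitmx_mul rx.1 unitmx_perm.
  have sK k : s (s k) = k by rewrite -permM ss perm1.
  apply/matrixP => i k; rewrite -[perm_mx s]trmxK tr_perm_mx.
  have -> : (s^-1 = s)%g by apply/eqP; rewrite eq_invg_mul ss.
  rewrite !mxE /U (negbTE nbc) eq_sym (negbTE nab) eqxx mxE.
  by apply: eq_bigr => j _; rewrite !mxE andbT eq_sym.
move=> dc; have := all3 d; rewrite !inE (negbTE dc) orbF => /orP[]/eqP->.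
  by apply: (@rank_flat_tsum U a b).
by apply: (@rank_flat_tsum U b a); rewrite 1?eq_sym.
Qed.

Lemma three_factors_small : False.
Proof.
have [A rx] := sg_rep m1 (subsetP sG _ xG).
have [r [rho r_ok]] := compatible_vectors m1 ch2 rx x2.
case: (boolP (is_scalar_mx (A c))) => [/is_scalar_mxP[mu eA]|nsc].
  have tauK : (tau * tau = 1)%g by exact: tperm2.
  pose e k : 'cV[F]_m := delta_mx k 0.
  pose w k : 'rV[F]_m := const_mx 1 - delta_mx 0 k.
  (* Left and right multiplication by tau agree on Phi, so its row space is stable; but they change
     its (0,0) entry from 1 to 0. The all-one part of w keeps every column nonzero. *)
  pose Phi := e i0 *m w i1 + e i1 *m w i0.
  have Phi0 k : col k Phi != 0.
    apply/eqP => /matrixP h; have := h i0 0; have /eqP := h i1 0.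
    rewrite !mxE !big_ord1 !mxE !eqxx i01 [i1 == i0]eq_sym i01 /= !(mul0r, mul1r, add0r, addr0).
    rewrite subr_eq0; have [->|] := eqVneq k i0; last by rewrite oner_eq0.
    by rewrite i01 subr0 => _ /eqP; rewrite oner_eq0.
  have rPhi : (\rank Phi <= 2)%N.
    by apply: leq_trans (mxrank_add _ _) _; apply: (@leq_add _ _ 1 1); exact: mulmx_max_rank.
  have [_ /(_ mu (perm_mx tau) eA)] := entangled_transfer m1 sG cop xG x2 rx un sa sb sc r_ok tauK
    (fun y yG fy => entangled_fixes rx tauK Phi0 rPhi yG fy).
  have Pe k : perm_mx tau *m e k = e (tau k).
    by apply/matrixP => i j; rewrite -row_permE !mxE -{1}[k](tpermK i0 i1) (inj_eq perm_inj).
  have wP k : w k *m perm_mx tau = w (tau k).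
    have Pt : perm_mx tau = perm_mx tau^-1 :> 'M[F]_m by rewrite tpermV.
    rewrite Pt -col_permE; apply/matrixP => i j; rewrite !mxE.
    by rewrite -{1}[k](tpermK i0 i1) (inj_eq perm_inj).
  case=> [|k].
    by rewrite mulmxDr mulmxDl !mulmxA !Pe -!mulmxA !wP tpermL tpermR addrC.
  rewrite mulmxDl -!mulmxA !wP tpermL tpermR => /matrixP/(_ i0 i0)/eqP.
  rewrite !mxE !big_ord1 !mxE !eqxx i01 /= !(mul0r, mul1r, add0r, addr0, subr0, subrr, mulr0).
  by rewrite eq_sym oner_eq0.
have ss : (1 * 1 = 1 :> 'S_m)%g by rewrite mulg1.
have [l l0 AA] : exists2 l, l != 0 & A c *m A c = l%:M.
  have := repM rx rx; rewrite -[(x * x)%g]/(x ^+ 2)%g x2 => r2.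
  have s2 := rep1_perm m1 r2; rewrite s2 in r2.
  have [l l0] := rep_scalar c r2 (rep1 F m t); rewrite -[in A (_ c)]sc permK => e.
  by exists l => //; rewrite e scalemx1.
have [u [d [d0 Nu NNu]]] : exists (u : 'cV[F]_m) d, [/\ d != 0, (A c - d%:M) *m u != 0 &
    (A c - d%:M) *m ((A c - d%:M) *m u) = 0].
  move: (A c) nsc AA; case: (m) (ltnW m1) => [|n] // _ M nsc MM.
  have [_ [d [_ d0 _ N2]]] := eigenvector_sq_scalar ch2 l0 MM.
  have N0 : M - d%:M != 0.
    by apply: contra nsc; rewrite subr_eq0 => /eqP->; exact: scalar_mx_is_scalar.
  by have [u [Nu NNu]] := nilpotent_chain N2 N0; exists u, d.
set N := A c - d%:M in Nu NNu; have AE : A c = d%:M + N by rewrite addrC subrK.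
(* Column 0 of Phi will be N u and all others u: a column space that A_c stabilises without acting
   on it as a scalar. *)
pose w0 : 'rV[F]_m := delta_mx 0 i0; pose w : 'rV[F]_m := const_mx 1 - w0.
pose Phi := u *m w + N *m u *m w0.
have PhiE k : col k Phi = if k == i0 then N *m u else u.
  rewrite colE mulmxDl -!mulmxA.
  have -> : w0 *m delta_mx k 0 = (k == i0)%:R%:M.
    by apply/matrixP => i j; rewrite -colE !mxE !ord1 eqxx.
  have -> : w *m delta_mx k 0 = (k != i0)%:R%:M.
    by apply/matrixP => i j; rewrite -colE !mxE !ord1 eqxx mulr1n; case: eqP; rewrite /= ?subrr ?subr0.
  by case: eqP; rewrite ?mulmx1 ?mul_mx_scalar ?scale1r ?scale0r ?add0r ?mulmx0 ?addr0.
have u0 : u != 0 by apply: contraNneq Nu => ->; rewrite mulmx0.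
have Phi0 k : col k Phi != 0 by rewrite PhiE; case: ifP.
have rPhi : (\rank Phi <= 2)%N.
  by apply: leq_trans (mxrank_add _ _) _; apply: (@leq_add _ _ 1 1); exact: mulmx_max_rank.
have [/(_ erefl) h _] := entangled_transfer m1 sG cop xG x2 rx un sa sb sc r_ok ss
    (fun y yG fy => entangled_fixes rx ss Phi0 rPhi yG fy).
have APhi : A c *m Phi = d *: Phi + N *m u *m w.
  by rewrite AE mulmxDl mul_scalar_mx /Phi mulmxDr !mulmxA -(mulmxA N N) NNu mul0mx addr0.
case: h => [|k].
  exists (d%:M + delta_mx i0 0 *m w).
  by rewrite APhi [RHS]mulmxDr mul_mx_scalar mulmxA -colE PhiE eqxx.
rewrite APhi => /(congr1 (col i1)); rewrite !linearZ /= linearD linearZ /= PhiE.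
rewrite [i1 == i0]eq_sym i01.
have -> : col i1 (N *m u *m w) = N *m u.
  rewrite colE -mulmxA; have -> : w *m delta_mx i1 0 = 1%:M; last by rewrite mulmx1.
  by apply/matrixP => i j; rewrite -colE !mxE !ord1 eqxx [i1 == i0]eq_sym i01 subr0.
move=> e; have := congr1 (mulmx N) e; rewrite -scalemxAr mulmxDr -scalemxAr NNu addr0 scalerA => e1.
have kd : k * d = 1.
  by apply/eqP; rewrite -subr_eq0; apply: contraR Nu => /negbTE; have := e1; move/eqP; rewrite -{2}[N *m u]scale1r -subr_eq0 -scalerBl scaler_eq0 => /orP[->|] //.
move: e; rewrite scalerDr scalerA kd scale1r => /eqP; rewrite -subr_eq0 addrAC subrr add0r scaler_eq0 (negbTE Nu) orbF.
by move/eqP=> k0; move: kd; rewrite k0 mul0r => /eqP; rewrite eq_sym oner_eq0.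
Qed.

End ThreeFactors.

(** * Counting fixed points *)

Section FixedPointCount.
Local Open Scope group_scope.
Variables (T : finType) (G : {group {perm T}}) (p : nat).

Definition fixpts (x : {perm T}) := [set v | x v == v].

Lemma card_fixptsJ x g : #|fixpts (x ^ g)| = #|fixpts x|.
Proof.
rewrite -(card_imset (fixpts x) (@perm_inj _ g)); congr #|pred_of_set _|.
apply/setP => v; rewrite inE conjgE !permM; apply/eqP/imsetP => [e|[w]].
  by exists (g^-1 v); rewrite ?inE ?permKV //; apply/eqP/(@perm_inj _ g); rewrite permKV.
by rewrite inE => /eqP e ->; rewrite permK e.
Qed.

(** Counts pairs of a conjugate of x and a vector it fixes; every vector occurs. *)
Lemma card_le_class_fixpts x : prime p -> (forall v, coprime #|orbit 'P G v| p) ->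
  x \in G -> p.-elt x -> #|T| <= #|x ^: G| * #|fixpts x|.
Proof.
move=> pr_p cop xG px.
have -> : (#|x ^: G| * #|fixpts x| = \sum_(y in x ^: G) \sum_(v : T) (y v == v))%N.
  rewrite -sum_nat_const; apply: eq_bigr => _ /imsetP[g _ ->].
  rewrite -(card_fixptsJ x g) -sum1_card (big_mkcond (fun v => v \in _)) /=.
  by apply: eq_bigr => v _; rewrite inE; case: eqP.
rewrite exchange_big -sum1_card; apply: leq_sum => v _ /=.
have [g gG /setIP[_ /astab1P/= fx]] := p_elt_conj_astab1 (subxx G) (subsetIl _ _) (cop v) pr_p xG px.
have fx1 : (x ^ g) v = v := fx.
by rewrite (bigD1 (x ^ g)) ?memJ_class //= fx1 eqxx.
Qed.

(** The centraliser of x contains the cyclic group of x. *)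
Lemma class_mul_prime x : x \in G -> #|x ^: G| * #[x] <= #|G|.
Proof.
move=> xG; rewrite -index_cent1 mulnC -(Lagrange (subsetIl G 'C[x])) leq_pmul2r ?indexg_gt0 //.
by apply: subset_leq_card; rewrite cycle_subG inE xG cent1id.
Qed.

End FixedPointCount.

Section TensorCount.
Local Open Scope ring_scope.
Variables (F : finFieldType) (m t : nat).
Local Notation q := #|F|.

Lemma card_tensV : #|tensV F m t| = (q ^ (m ^ t))%N.
Proof. by rewrite card_ffun card_ffun !card_ord. Qed.

Lemma rep_sub x (A : 'I_t -> 'M[F]_m) s v w : rep x A s -> x (v - w) = x v - x w.
Proof.
case=> _ e; rewrite !e; apply/ffunP => g; rewrite !ffunE -sumrB; apply: eq_bigr => f _.
by rewrite !ffunE mulrBr.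
Qed.

(** [Y] is closed under subtraction and meets the fixed space trivially, so the sums of a fixed
    vector and an element of [Y] are distinct. *)
Lemma card_fixpts_complement (A : 'I_t -> 'M[F]_m) s x (Y : {set tensV F m t}) :
  rep x A s -> (forall v w, v \in Y -> w \in Y -> v - w \in Y) ->
  (forall v, v \in Y -> x v = v -> v = 0) -> (#|fixpts x| * #|Y| <= #|tensV F m t|)%N.
Proof.
move=> rx subY triv; rewrite -cardsX.
rewrite -(@card_in_imset _ _ (fun u : tensV F m t * tensV F m t => u.1 + u.2)) ?max_card //.
move=> [v w] [v' w'] /setXP[/= fv Yw] /setXP[/= fv' Yw'] e.
have e1 : w' - w = v - v' by apply/eqP; rewrite subr_eq addrAC e addrAC subrr add0r.
have d0 : w' - w = 0.
  apply: triv; first exact: subY.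
  by rewrite e1 (rep_sub _ _ rx); move: fv fv'; rewrite !inE => /eqP-> /eqP->.
move: e1; rewrite d0 => /esym/eqP; rewrite subr_eq0 => /eqP->.
by move/eqP: d0; rewrite subr_eq0 => /eqP->.
Qed.

Lemma card_supported (Q : pred {ffun 'I_t -> 'I_m}) :
  #|[set v : tensV F m t | [forall f, (v f != 0) ==> Q f]]| = (q ^ #|Q|)%N.
Proof.
rewrite -(card_pffun_on (0 : F) Q F) //; apply: eq_card => v; rewrite inE.
apply/forallP/pffun_onP => [h|[/subsetP h _] f].
  by split=> [|? //]; apply/subsetP => f; apply/implyP/h.
by apply/implyP/h.
Qed.

(** The complement consists of tensors supported on index o at i and on indices other than b at s i,
    where A_(s i) has a nonzero (b,o) entry. Such a v has a single row at i, so x v flattens at s i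
    to A e_o times a row w. If x v = v, row b vanishes and forces w = 0. *)
Lemma card_fixpts_moved (A : 'I_t -> 'M[F]_m) s x i : (0 < m)%N -> rep x A s -> s i != i ->
  (#|fixpts x| * q ^ ((m - 1) * m ^ (t - 2)) <= q ^ (m ^ t))%N.
Proof.
move=> m0 rx ns; pose o := Ordinal m0.
have [b bP] : exists b, A (s i) b o != 0.
  apply/existsP; rewrite -negb_forall; apply/negP => /forallP h.
  have : A (s i) *m delta_mx o (0 : 'I_1) = 0.
    by apply/matrixP => k l; rewrite -colE !mxE (eqP (h k)).
  move/(congr1 (mulmx (invmx (A (s i))))); rewrite mulKmx ?rx.1 // mulmx0.
  by move/matrixP/(_ o 0)/eqP; rewrite !mxE !eqxx oner_eq0.
pose Q := [pred f : {ffun 'I_t -> 'I_m} | (f i == o) && (f (s i) != b)].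
pose Y := [set v : tensV F m t | [forall f, (v f != 0) ==> Q f]].
have YP (v : tensV F m t) : reflect (forall f, ~~ Q f -> v f = 0) (v \in Y).
  rewrite inE; apply: (iffP forallP) => h f.
    by move=> nQ; apply/eqP; apply: contraR nQ => v0; have := h f; rewrite v0.
  by apply/implyP; apply: contraR => nQ; rewrite h.
have cQ : #|Q| = ((m - 1) * m ^ (t - 2))%N.
  pose P j : pred 'I_m := if j == i then pred1 o else if j == s i then predC1 b else predT.
  have -> : #|Q| = #|family P|.
    apply: eq_card => f; rewrite !inE; apply/andP/familyP => [[/eqP fi fs] j|h].
      by rewrite /P; case: eqP => [->|_]; [rewrite inE fi|case: eqP => [->|_]].
    have := h i; have := h (s i); rewrite /P !eqxx (negbTE ns) !inE => h1 ->.
    by move: h1; rewrite /in_mem /=.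
  rewrite card_family foldrE big_map big_enum /= (bigD1 i) //= (bigD1 (s i)) //= {1 2}/P !eqxx (negbTE ns).
  rewrite card1 mul1n; congr (_ * _)%N.
    by have := cardC1 b; rewrite card_ord subn1.
  rewrite (eq_bigr (fun=> m)) => [|j /andP[j1 j2]]; last by rewrite /P (negbTE j1) (negbTE j2) card_ord.
  rewrite prod_nat_const; congr (_ ^ _)%N.
  have := cardC (pred2 i (s i)); rewrite card2 card_ord eq_sym ns => /(congr1 (subn^~ 2)) <-.
  by rewrite addKn; apply: eq_card => j; rewrite !inE negb_or.
rewrite -cQ -card_supported -card_tensV.
apply: (card_fixpts_complement rx) => [v w /YP hv /YP hw|v /YP hv fv].
  by apply/YP => f nQ; rewrite !ffunE hv // hw // subr0.
have [B eB] := flat_rep i rx.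
have fi : flat i v = delta_mx o 0 *m row o (flat i v).
  apply/matrixP => k h; rewrite [RHS]mxE big_ord1 !mxE eqxx andbT.
  case: (eqVneq k o) => [->|ko]; rewrite ?mul1r ?mul0r // hv //= insert_at_c.
  by rewrite (negbTE ko).
have := eB v; rewrite fv fi mulmxA -mulmxA => e.
set w := row o _ *m B in e.
have w0 : w = 0.
  apply/matrixP => k h; rewrite ord1 {k} [RHS]mxE.
  have := congr1 (fun M : 'M_(_, _) => M b h) e; rewrite -colE [RHS]mxE big_ord1 [col _ _ _ _]mxE mxE hv.
    by move/esym/eqP; rewrite mulf_eq0 (negbTE bP) => /eqP.
  by rewrite /= insert_at_c eqxx andbF.
apply: (bij_inj (flat_bij F m (s i))); rewrite e w0 mulmx0.
by apply/matrixP => k h; rewrite !mxE ffunE.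
Qed.

Lemma card_tensor_group : (1 < m)%N ->
  (#|tensor_group F m t| <= t`! * #|[set M : 'M[F]_m | M \in unitmx]| ^ t)%N.
Proof.
move=> m1; pose U := [set M : 'M[F]_m | M \in unitmx].
have [g gP] : exists g : {perm tensV F m t} -> {ffun 'I_t -> 'M[F]_m}, forall x,
    x \in tensor_group F m t -> rep x (g x) (sg x).
  suff h (x : {perm tensV F m t}) : exists A : {ffun 'I_t -> 'M[F]_m}, x \in tensor_group F m t -> rep x A (sg x).
    by have [g gP] := fin_all_exists h; exists g.
  case: (boolP (x \in tensor_group F m t)) => [/(sg_rep m1)[A [uA eA]]|_]; last by exists [ffun=> 0].
  exists (finfun A) => _; split=> [i|v]; rewrite ?ffunE // eA; apply: eq_tens_act => i.
  by rewrite ffunE.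
rewrite -(@card_in_imset _ _ (fun x => (sg x, g x))); last first.
  move=> x y /gP[_ rx] /gP[_ ry] e; have es := congr1 fst e; have eg := congr1 snd e.
  by apply/permP => v; rewrite rx ry; move: es eg => /= -> ->.
have := @card_ffun_on 'I_t _ (mem U); rewrite card_ord => <-.
rewrite -card_Sn -cardsT.
rewrite -(cardsE (ffun_on _)) -cardsX; apply: subset_leq_card; apply/subsetP => _ /imsetP[x xt ->].
by rewrite in_setX !inE /=; apply/ffun_onP => i; rewrite inE (gP x xt).1.
Qed.

End TensorCount.

(** * Excluding seven or more factors *)

Section ManyFactors.

Lemma fact_le_exp t : t`! <= 2 ^ 'C(t, 2).
Proof.
elim: t => // t IH; rewrite factS binS bin1 addnC expnD leq_mul // ltn_expl //.
Qed.

Lemma many_factors_exponent2 t : 8 <= t -> 'C(t, 2) + 4 * t <= 2 ^ (t - 2).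
Proof.
move=> /subnK <-; elim: (t - 8) => // k IH.
rewrite addSn binS bin1 subSn; last by lia.
rewrite expnS; have : k + 8 + 4 <= 2 ^ (k + 8 - 2).
  rewrite -addnBA // expnD; have : k < 2 ^ k by exact: ltn_expl.
  have -> : 2 ^ (8 - 2) = 64 by []. move: (2 ^ k) => z; clear; lia.
by move: IH; move: ('C(_, _)) (2 ^ _) => y z; clear; lia.
Qed.

Lemma many_factors_exponent m t : 7 <= t -> 2 < m ->
  'C(t, 2) + m ^ 2 * t <= (m - 1) * m ^ (t - 2).
Proof.
move=> t7 m3.
have h k : 'C(k + 7, 2) + (k + 7) <= 2 * 3 ^ (k + 3).
  elim: k => // k IH; rewrite !addSn binS bin1 expnS.
  have : k < 3 ^ k by exact: ltn_expl.
  move: IH; rewrite expnD; have -> : 3 ^ 3 = 27 by [].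
  move: ('C(_, _)) (3 ^ _) => y z; clear; lia.
have := h (t - 7); rewrite subnK // => h1.
have -> : t - 2 = 2 + (t - 7 + 3) by lia.
rewrite expnD mulnCA; apply: (@leq_trans (m ^ 2 * ('C(t, 2) + t))).
  by rewrite mulnDr leq_add2r leq_pmull // expn_gt0; lia.
rewrite leq_mul2l; apply/orP; right; apply: (leq_trans h1).
by apply: leq_mul; [lia|rewrite leq_exp2r //; lia].
Qed.

(** For m = 2 and t = 7 the crude exponent 21 + 28 exceeds 32, so the exact order of GL_2(q) is
    used. From q = 8 on it is bounded by q^4, and 7! < 2 * 8^4. *)
Lemma seven_qubits_bound q : 1 < q -> 7`! * (q * q.-1 ^ 2 * q.+1) ^ 7 < 2 * q ^ 32.
Proof.
move=> q1; have [q8|] := leqP 8 q.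
  have -> : q ^ 32 = q ^ 4 * (q ^ 4) ^ 7 by rewrite -expnM -expnD.
  rewrite mulnA; apply: (@leq_ltn_trans (7`! * (q ^ 4) ^ 7)).
    rewrite leq_mul2l; apply/orP; right; rewrite leq_exp2r //.
    have -> : q ^ 4 = q * q ^ 2 * q by rewrite !expnS expn0 !muln1 !mulnA.
    by case: (q) q1 => // k k1; rewrite -[k.+1.-1]/k -!mulnA leq_mul2l; apply/orP; right; nia.
  rewrite ltn_pmul2r ?expn_gt0 ?(ltnW q1) //; apply: (@leq_trans (2 * 8 ^ 4)) => //.
  by rewrite leq_mul2l leq_exp2r.
have -> : 7`! = 72 * 70 by [].
move=> q8; have : [|| q == 2, q == 3, q == 4, q == 5, q == 6 | q == 7] by lia.
case/or4P=> [/eqP->|/eqP->|/eqP->|/or3P[]/eqP->]; lia.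
Qed.

Local Open Scope ring_scope.

Lemma card_unitmx2 (F : finFieldType) :
  #|[set M : 'M[F]_2 | M \in unitmx]| = (#|F| * #|F|.-1 ^ 2 * #|F|.+1)%N.
Proof.
rewrite -card_GL_2 cardsT card_sub; apply: eq_card => M.
by rewrite !inE.
Qed.

Lemma at_most_six_factors (F : finFieldType) m t p (G : {group {perm tensV F m t}}) x :
  (1 < m)%N -> prime p -> G \subset tensor_group F m t -> (forall v, coprime #|orbit 'P G v| p) ->
  x \in G -> (p.-elt x)%g -> sg x != 1%g -> (t <= 6)%N.
Proof.
move=> m1 pr_p sG cop xG px sx; rewrite leqNgt; apply/negP => t7.
have [A rx] := sg_rep m1 (subsetP sG _ xG).
have [i ni] : exists i, sg x i != i.
  apply/existsP; rewrite -negb_forall; apply: contra sx => /forallP h.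
  by apply/eqP/permP => i; rewrite perm1 (eqP (h i)).
have ox : (1 < #[x]%g)%N.
  rewrite order_gt1; apply: contra ni => /eqP x1.
  by move: rx; rewrite x1 (sgE m1 (rep1 F m t)) perm1.
set q := #|F|; have q1 : (1 < q)%N by exact: finNzRing_gt1.
set u := #|[set M : 'M[F]_m | M \in unitmx]|; set E := ((m - 1) * m ^ (t - 2))%N.
(* The factor 2 is a lower bound for the order of x, which divides the class length out of |G|. *)
have le : (2 * q ^ E <= t`! * u ^ t)%N.
  apply: leq_trans (card_tensor_group F t m1); apply: leq_trans (subset_leq_card sG).
  apply: leq_trans (class_mul_prime xG); rewrite mulnC; apply: leq_mul => //.
  have h1 := card_le_class_fixpts pr_p cop xG px.
  have h2 := card_fixpts_moved (ltnW m1) rx ni.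
  have V0 : (0 < q ^ (m ^ t))%N by rewrite expn_gt0 (ltnW q1).
  rewrite -(leq_pmul2l V0); rewrite card_tensV -/q in h1.
  apply: leq_trans (leq_mul h1 (leqnn _)) _; rewrite -mulnA mulnC leq_mul2r.
  by apply/orP; right; exact: h2.
have lt : (t`! * u ^ t < 2 * q ^ E)%N; last by move: (leq_ltn_trans le lt); rewrite ltnn.
(* Uses t! <= q^C(t,2) and |GL_m(q)| <= q^(m^2). *)
have crude : ('C(t, 2) + m ^ 2 * t <= E)%N -> (t`! * u ^ t < 2 * q ^ E)%N.
  move=> hE; apply: (@leq_ltn_trans (q ^ E)); last first.
    by rewrite ltn_Pmull // expn_gt0 (ltnW q1).
  apply: leq_trans (leq_pexp2l (ltnW q1) hE); rewrite expnD; apply: leq_mul.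
    by apply: leq_trans (fact_le_exp t) _; case: ('C(t, 2)) => // n; rewrite leq_exp2r.
  rewrite expnM leq_exp2r; last by apply: leq_trans t7.
  by apply: leq_trans (max_card _) _; rewrite card_mx mulnn.
have [m2|m3] := leqP m 2; last by apply: crude; exact: many_factors_exponent.
have me : m = 2%N by apply/eqP; rewrite eqn_leq m2.
have [t8|t7'] := leqP 8 t.
  apply: crude; rewrite /E me mul1n; exact: many_factors_exponent2.
have te : t = 7%N by apply/eqP; rewrite eqn_leq -ltnS t7'.
rewrite /E /u; move: me te; clear => me te; subst m t.
by rewrite card_unitmx2; apply: seven_qubits_bound; exact: finNzRing_gt1.
Qed.

End ManyFactors.

Lemma sq_id_odd (gT : finGroupType) (D : {group gT}) g :
  odd #|D| -> g \in D -> (g * g = 1)%g -> g = 1%g.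
Proof.
move=> oD gD g2; apply/eqP; rewrite -order_eq1 -dvdn1.
have : (#[g]%g %| gcdn #|D| 2)%N.
  by rewrite dvdn_gcd order_dvdG // order_dvdn expgS expg1 g2 /=.
by have /eqnP-> : coprime #|D| 2 by rewrite coprimen2.
Qed.

Lemma card_pchar (F : finFieldType) p : (p \in [pchar F])%R -> exists2 n, 0 < n & #|F| = p ^ n.
Proof.
move=> ch; have := pprimeChar_pgroup ch; rewrite /pgroup cardsT => /p_natP[n e].
by exists n => //; case: n e (finNzRing_gt1 F) => // ->.
Qed.

(** * Regular vectors of odd subgroups of GL_2(q), q even *)

Section RegularVector.
Local Open Scope ring_scope.
Variables (F : finFieldType).
Hypothesis ch2 : 2%N \in [pchar F].
Implicit Types v w z : 'cV[F]_2.

Lemma mulmx_ext n k (A B : 'M[F]_(n, k)) : (forall z : 'cV_k, A *m z = B *m z) -> A = B.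
Proof.
move=> h; apply/matrixP => i j; have := h (delta_mx j 0); rewrite -!colE.
by move/matrixP/(_ i 0); rewrite !mxE.
Qed.

Definition det2 v w := v 0 0 * w 1 0 - v 1 0 * w 0 0.

Lemma det2_mul (A : 'M_2) v w : det2 (A *m v) (A *m w) = \det A * det2 v w.
Proof. rewrite det_mx22 /det2 !mxE !sum_ord2; ring. Qed.

Lemma ord2_cases (i : 'I_2) : i = 0 \/ i = 1.
Proof. by case: i => [[|[|]]] // ?; [left|right]; apply: val_inj. Qed.

Lemma det2_cramer v w z : det2 v w *: z = det2 z w *: v + det2 v z *: w.
Proof.
apply/matrixP => i j; rewrite !mxE ord1 /det2.
have [->|->] := ord2_cases i.
  ring.
ring.
Qed.

Lemma det2vv v : det2 v v = 0. Proof. by rewrite /det2; ring. Qed.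
Lemma det2Z a v w : det2 v (a *: w) = a * det2 v w. Proof. by rewrite /det2 !mxE; ring. Qed.
Lemma det2D v w z : det2 v (w + z) = det2 v w + det2 v z. Proof. by rewrite /det2 !mxE; ring. Qed.
Lemma det2B v w z : det2 v (w - z) = det2 v w - det2 v z. Proof. by rewrite /det2 !mxE; ring. Qed.

Lemma det2_mate v : v != 0 -> exists w, det2 v w = 1.
Proof.
move=> v0; have [h|h] := eqVneq (v 0 0) 0.
  have v1 : v 1 0 != 0.
    apply: contra v0 => /eqP v1; apply/eqP/matrixP => i j; rewrite ord1 [RHS]mxE.
    by have [->|->] := ord2_cases i.
  exists (\col_i (- (i == 0)%:R / v 1 0)); rewrite /det2 !mxE /= h mul0r mulrCA divff //; ring.
exists (\col_i ((i == 1)%:R / v 0 0)); rewrite /det2 !mxE /= mulrCA divff //; ring.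
Qed.

Variable D : {group {'GL_2[F]}}.
Hypotheses (oD : odd #|D|) (ZD : forall c : F, c != 0 -> exists2 z, z \in D & GLval z = c%:M).

Local Notation M g := (GLval g : 'M[F]_2).

Let dM (k : {'GL_2[F]}) : \det (M k) != 0. Proof. exact: (GL_det k). Qed.

Let opp2 (V : lmodType F) (u : V) : - u = u.
Proof. by rewrite -scaleN1r (oppr_pchar2 ch2) scale1r. Qed.

(** A transvection has order at most 2 in characteristic 2, and the group is odd. *)
Lemma fix_det1 g v : g \in D -> v != 0 -> M g *m v = v -> \det (M g) = 1 -> g = 1%g.
Proof.
move=> gD v0 gv dg; have [w vw] := det2_mate v0.
apply: (sq_id_odd oD gD); apply: val_inj; apply: mulmx_ext => z /=.
have e u : det2 v u = 0 -> u = det2 u w *: v by move=> d0; rewrite -[LHS]scale1r -vw det2_cramer d0 scale0r addr0.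
have : det2 v (M g *m z - z) = 0.
  have : det2 v (M g *m z) = det2 v z by rewrite -[in LHS]gv det2_mul dg mul1r.
  by rewrite det2B => ->; rewrite subrr.
move/e => e1; have := congr1 (mulmx (M g)) e1; rewrite mulmxBr -scalemxAr gv -e1 => /eqP.
rewrite subr_eq => /eqP e2; rewrite -mulmxA mul1mx e2.
by rewrite addrAC -{1}[M g *m z]opp2 addNr add0r opp2.
Qed.

(** The commutator fixes v and has determinant 1. *)
Lemma fix_commute g h v : g \in D -> h \in D -> v != 0 ->
  M g *m v = v -> M h *m v = v -> M g *m M h = M h *m M g.
Proof.
move=> gD hD v0 gv hv; have e (k l : {'GL_2[F]}) : M k *m v = v -> M l *m v = v -> M (k * l)%g *m v = v.
  by move=> kv lv; rewrite GL_MxE -mulmxA lv kv.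
have : ((h * g)^-1 * (g * h) = 1)%g.
  apply: (@fix_det1 _ v); rewrite ?groupM ?groupV ?groupM //.
    rewrite GL_MxE -mulmxA (e g h gv hv) -{1}(e h g hv gv) GL_VxE mulKmx //.
    exact: (GL_unitmx (h * g)%g).
  rewrite GL_MxE det_mulmx GL_VxE det_inv !GL_MxE !det_mulmx mulrC [\det (M h) * _]mulrC divff //.
  by apply: mulf_neq0; [exact: (dM g)|exact: (dM h)].
by move/(congr1 (fun k => (h * g) * k)%g); rewrite mulKVg mulg1 => /(congr1 (@GLval _ _)).
Qed.

(* Otherwise every nonzero v is fixed by some g <> 1 in D, whose other eigenline
   contains a unique v' with det2 v v' = 1 and does not depend on g; v |-> v' is
   then a fixed-point-free involution of the q^2 - 1 nonzero vectors, q even. *)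
Lemma regular_vector : exists2 v : 'cV[F]_2, v != 0 & forall g, g \in D -> M g *m v = v -> g = 1%g.
Proof.
case: (boolP [exists v : 'cV[F]_2, (v != 0) && [forall g in D, (M g *m v == v) ==> (g == 1%g)]]).
  case/existsP => v /andP[v0 /forall_inP h]; exists v => // g gD e.
  by apply/eqP; have := h g gD; rewrite e eqxx.
rewrite negb_exists => /forallP hno.
have no (v : 'cV[F]_2) : v != 0 -> exists g, [/\ g \in D, M g *m v = v & \det (M g) != 1].
  move=> v0; have := hno v; rewrite v0 /= negb_forall => /existsP[g].
  rewrite negb_imply negb_imply => /and3P[gD /eqP gv g1]; exists g; split=> //.
  by apply: contra g1 => /eqP dg; rewrite (fix_det1 gD v0 gv dg).
pose mate (v w : 'cV[F]_2) := (det2 v w == 1) && [forall g in D, (M g *m v == v) ==> (det2 w (M g *m w) == 0)].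
have mateP v w : reflect (det2 v w = 1 /\ forall g, g \in D -> M g *m v = v -> det2 w (M g *m w) = 0) (mate v w).
  apply: (iffP andP) => [[/eqP e /forall_inP h]|[-> h]]; split=> //.
    by move=> g gD gv; apply/eqP; have := h g gD; rewrite gv eqxx.
  by apply/forall_inP => g gD; apply/implyP => /eqP gv; rewrite h.
have dt1 v w : det2 v w = 1 -> v != 0.
  by move=> e; apply: contra_eq_neq e => ->; rewrite /det2 !mxE !mul0r subrr eq_sym oner_eq0.
have span v w z : det2 v w = 1 -> z = det2 z w *: v + det2 v z *: w.
  by move=> e; rewrite -det2_cramer e scale1r.
have dtC v w : det2 v w = det2 w v by rewrite -[RHS](@opp2 F^o) /det2; ring.
have eig v w (g : {'GL_2[F]}) : det2 v w = 1 -> M g *m v = v -> det2 w (M g *m w) = 0 -> M g *m w = \det (M g) *: w.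
  move=> e gv d0; rewrite [LHS](span _ _ _ e) dtC d0 scale0r add0r.
  by rewrite -{1}gv det2_mul e mulr1.
(* h commutes with g, hence preserves its eigenline for the eigenvalue mu <> 1. *)
have eigen_comm v w (g h : {'GL_2[F]}) (mu : F) : det2 v w = 1 -> mu != 1 -> g \in D -> h \in D -> M g *m v = v ->
    M g *m w = mu *: w -> M h *m v = v -> det2 w (M h *m w) = 0.
  move=> e mu1 gD hD gv gw hv.
  have := congr1 (mulmx^~ w) (fix_commute gD hD (dt1 _ _ e) gv hv).
  rewrite -!mulmxA gw -scalemxAr (span _ _ (M h *m w) e) mulmxDr -!scalemxAr gv gw.
  move/(congr1 (det2 w)); rewrite !(det2D, det2Z) !det2vv !mulr0 !addr0 [det2 w v]dtC e !mulr1 => /eqP.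
  rewrite -subr_eq0 -{1}[det2 _ w]mul1r -mulrBl mulf_eq0 subr_eq0 eq_sym (negbTE mu1) => /eqP.
  by rewrite dtC.
have mate_ex v : v != 0 -> exists w, mate v w.
  move=> v0; have [g [gD gv dg]] := no v v0; have [w0 e0] := det2_mate v0.
  set mu := \det (M g) in dg; have mu1 : mu - 1 != 0 by rewrite subr_eq0.
  pose al := det2 (M g *m w0) w0; have gw0 : M g *m w0 = al *: v + mu *: w0.
    by rewrite [LHS](span _ _ _ e0) -{2}gv det2_mul e0 mulr1.
  (* Corrects [w0] along v to an eigenvector for mu; solving for the coefficient needs mu <> 1. *)
  pose w := w0 + (al / (mu - 1)) *: v; have e : det2 v w = 1 by rewrite det2D det2Z det2vv mulr0 addr0.
  have gw : M g *m w = mu *: w.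
    rewrite mulmxDr -scalemxAr gv gw0 scalerDr scalerA addrAC addrC; congr (_ + _).
    rewrite -scalerDl; congr (_ *: _); field; exact: mu1.
  by exists w; apply/mateP; split=> // h hD hv; exact: eigen_comm e dg gD hD gv gw hv.
have mate_uniq v w z : mate v w -> mate v z -> w = z.
  move=> /mateP[e hw] /mateP[e' hz]; have v0 := dt1 _ _ e; have [g [gD gv dg]] := no v v0.
  have := span _ _ z e; rewrite e' scale1r => zE; rewrite zE.
  have gw := eig _ _ _ e gv (hw g gD gv); have gz := eig _ _ _ e' gv (hz g gD gv).
  have : det2 w (M g *m z) = det2 w (\det (M g) *: z) by rewrite gz.
  rewrite [in LHS]zE mulmxDr -scalemxAr gv gw det2D !det2Z det2vv mulr0 addr0 [det2 w v]dtC e mulr1.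
  rewrite [det2 w z]dtC => /eqP; rewrite -subr_eq0 -{1}[det2 z w]mul1r -mulrBl mulf_eq0 subr_eq0 eq_sym (negbTE dg).
  by move=> /eqP->; rewrite scale0r add0r.
(* The scalar multiple det(g)^-1 g lies in [D] and fixes w, which exchanges the roles of v and w. *)
have mate_sym v w : mate v w -> mate w v.
  move=> /mateP[e hw]; have v0 := dt1 _ _ e; have [g [gD gv dg]] := no v v0.
  have gw := eig _ _ _ e gv (hw g gD gv); set mu := \det (M g) in dg gw.
  have mu0 : mu != 0 := dM g.
  have [z zD zE] := ZD (invr_neq0 mu0).
  have e' : det2 w v = 1 by rewrite dtC.
  apply/mateP; split=> // h hD hw'.
  have muV : mu^-1 != 1 by rewrite invr_eq1.
  apply: (eigen_comm _ _ (z * g)%g h mu^-1 e' muV _ hD _ _ hw').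
  - exact: groupM.
  - by rewrite GL_MxE zE mul_scalar_mx -scalemxAl gw scalerA mulVf // scale1r.
  - by rewrite GL_MxE zE mul_scalar_mx -scalemxAl gv.
pose f v := if v == 0 then 0 else odflt 0 [pick w | mate v w].
have fE v w : mate v w -> f v = w.
  move=> h; rewrite /f ifN; last by case/mateP: h => /dt1.
  by case: pickP => [z /(mate_uniq _ _ _ h)|/(_ w)]; rewrite ?h.
have fP v : v != 0 -> mate v (f v) by move=> v0; have [w h] := mate_ex v v0; rewrite (fE v w h).
have ff : involutive f.
  move=> v; have [->|v0] := eqVneq v 0; first by rewrite /f eqxx eqxx.
  exact/fE/mate_sym/fP.
have f2 : (perm (inv_inj ff) ^+ 2 = 1)%g.
  by apply/permP => v; rewrite expgS expg1 permM !permE ff.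
have [||v v0] := involution_fix (S := [set v : 'cV[F]_2 | v != 0]) f2.
- move=> v; rewrite !inE permE => v0.
  by have /mateP[e _] := mate_sym _ _ (fP v v0); exact: dt1 e.
- have -> : #|[set v : 'cV[F]_2 | v != 0]| = (#|F| ^ 2).-1.
    have := cardC1 (0 : 'cV[F]_2); rewrite card_mx muln1 => <-.
    by apply: eq_card => v; rewrite !inE.
  have [[|n] // _ ->] := card_pchar ch2.
  by rewrite -expnM -subn1 oddB ?expn_gt0 // oddX.
rewrite inE in v0 => e; rewrite permE in e; have /mateP[] := fP v v0; rewrite e det2vv => /esym/eqP.
by rewrite oner_eq0.
Qed.

End RegularVector.

(** * The group of components at one position *)

Section Parts.
Local Open Scope ring_scope.
Variables (F : finFieldType) (n t : nat).
Local Notation q := #|F|.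
Local Notation V := (tensV F n.+1 t).
Implicit Types (A B : 'I_t -> 'M[F]_n.+1).

Definition scl a (v : V) : V := [ffun f => a * v f].

Lemma tens_act_scaled A B (k : 'I_t -> F) v : (forall i, A i = k i *: B i) ->
  tens_act A v = scl (\prod_i k i) (tens_act B v).
Proof.
move=> e; apply/ffunP => g; rewrite !ffunE mulr_sumr.
apply: eq_bigr => f _; rewrite mulrA -big_split /=; congr (_ * _).
by apply: eq_bigr => i _; rewrite e mxE.
Qed.

Lemma rep_scl A s x a v : rep x A s -> x (scl a v) = scl a (x v).
Proof.
case=> _ e; rewrite !e; apply/ffunP => g; rewrite !ffunE mulr_sumr.
by apply: eq_bigr => f _; rewrite !ffunE mulrCA.
Qed.

Lemma rep_X A x k : rep x A 1%g -> rep (x ^+ k)%g (fun i => A i ^+ k) 1%g.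
Proof.
move=> r; elim: k => [|k IH]; first exact: rep1.
have := repM r IH; rewrite mulg1 -expgS => -[u e]; split=> [i|v].
  by rewrite exprSr -[_ * _]/(_ *m _); have := u i; rewrite invg1 perm1.
by rewrite e; apply: eq_tens_act => i; rewrite invg1 perm1 exprSr.
Qed.

Lemma rep1_scalars (k : 'I_t -> F) : \prod_i k i = 1 -> rep (1%g : {perm V}) (fun i => (k i)%:M) 1%g.
Proof.
move=> k1; split=> [i|v].
  rewrite unitmxE det_scalar unitfE expf_neq0 //.
  by have /eqP := k1; apply: contraTneq => h; rewrite (bigD1 i) //= h mul0r eq_sym oner_eq0.
rewrite perm1 perm_act1 (@tens_act_scaled _ (fun=> 1%:M) k).
  by rewrite tens_act1 k1; apply/ffunP => f; rewrite ffunE mul1r.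
by move=> i; rewrite scalemx1.
Qed.

Variable H : {group {perm V}}.

(** Every choice of components of every h counts, so that for t > 1 all nonzero scalars belong to
    the set. *)
Definition parts i := [set g : {'GL_n.+1[F]} | [exists h in H, [exists A : {ffun 'I_t -> 'M[F]_n.+1},
  [&& [forall j, A j \in unitmx], [forall v, h v == tens_act A (perm_act 1%g v)] & A i == GLval g]]]].

Lemma partsP i (g : {'GL_n.+1[F]}) :
  reflect (exists h A, [/\ h \in H, rep h A 1%g & A i = GLval g]) (g \in parts i).
Proof.
rewrite inE; apply: (iffP exists_inP) => [[h hH /existsP[A /and3P[/forallP u /forallP e /eqP Ai]]]|[h [A [hH [u e] Ai]]]].
  by exists h, A; split=> //; split=> // v; exact/eqP.
exists h => //; apply/existsP; exists (finfun A); apply/and3P; split.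
- by apply/forallP => j; rewrite ffunE.
- by apply/forallP => v; rewrite e; apply/eqP/eq_tens_act => j; rewrite ffunE.
- by rewrite ffunE Ai.
Qed.

Lemma parts_group_set i : group_set (parts i).
Proof.
apply/group_setP; split; first by apply/partsP; exists 1%g, (fun=> 1%:M); split; [|exact: rep1|].
move=> g g' /partsP[h [A [hH r e]]] /partsP[h' [A' [hH' r' e']]]; apply/partsP.
exists (h' * h)%g; eexists; split; [exact: groupM| |].
  by have := repM r' r; rewrite mulg1; exact.
by rewrite /= invg1 perm1 e e'.
Qed.
Canonical parts_group i := Group (parts_group_set i).

Lemma scalar_parts i c : (1 < t)%N -> c != 0 -> exists2 z, z \in parts i & GLval z = c%:M.
Proof.
move=> t1 c0; have u : (c%:M : 'M[F]_n.+1) \in unitmx by rewrite unitmxE det_scalar unitfE expf_neq0.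
exists (insubd (1%g : {'GL_n.+1[F]}) (c%:M : 'M[F]_n.+1)); last by rewrite -[LHS]/(val _) insubdK.
have [j ji] : exists j : 'I_t, j != i.
  have := cardC1 i; rewrite card_ord => e; have : (0 < t.-1)%N by case: (t) t1 => [|[]].
  by rewrite -e => /card_gt0P[j]; exists j.
apply/partsP; exists 1%g, (fun l => (if l == i then c else if l == j then c^-1 else 1)%:M).
split=> //; last by rewrite eqxx -[RHS]/(val _) insubdK.
apply: rep1_scalars; rewrite (bigD1 i) //= eqxx (bigD1 j) //= (negbTE ji) eqxx mulrA divff // mul1r.
by apply: big1 => l /andP[/negbTE-> /negbTE->].
Qed.

(** The |H|-th power of a part is a component of the identity, hence scalar, and q - 1 is odd. *)
Lemma odd_parts i : 2%N \in [pchar F] -> odd #|H| -> odd #|parts i|.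
Proof.
move=> ch oH; rewrite -[odd _]negbK -dvdn2; apply/negP => d2.
have [||g gD og] := @Cauchy _ 2 (parts_group i) => //.
have [h [A [hH r Ai]]] := partsP _ _ gD.
have [n0 n0P qE] := card_pchar ch.
have oq : odd q.-1 by rewrite -subn1 oddB ?qE ?expn_gt0 // oddX; case: n0 n0P {qE}.
have gN : (g ^+ (#|H| * q.-1) = 1)%g.
  apply: val_inj; rewrite /= -[LHS]/(GLval (g ^+ _)) .
  have gX k : GLval (g ^+ k)%g = GLval g ^+ k.
    by elim: k => // k IH; rewrite expgS GL_ME IH -exprS.
  rewrite gX -Ai exprM.
  have := rep_X #|H| r; rewrite expg_cardG // => r1; have [c e] := rep1_scalar i r1.
  have u := r1.1 i; rewrite e; have c0 : c != 0.
    by move: u; rewrite e unitmxE det_scalar unitfE expf_eq0.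
  rewrite -scalemx1 exprZn expr1n.
  have -> : c ^+ q.-1 = 1; last by rewrite scale1r.
  by apply: (mulIf c0); rewrite -exprSr prednK ?expf_card ?mul1r // ltnW ?finNzRing_gt1.
have : (#[g]%g %| #|H| * q.-1)%N by rewrite order_dvdn gN.
by rewrite og dvdn2 oddM oH oq.
Qed.

End Parts.

Section Lines.
Local Open Scope ring_scope.
Variable F : finFieldType.

(** The point of the projective line spanned by v; [option F] has its q + 1 elements. *)
Definition slope (v : 'cV[F]_2) : option F := if v 0 0 == 0 then None else Some (v 1 0 / v 0 0).

Lemma slope_eq v w : v != 0 -> w != 0 -> slope v = slope w -> exists2 k, k != 0 & w = k *: v.
Proof.
have vec (u z : 'cV[F]_2) : u 0 0 = z 0 0 -> u 1 0 = z 1 0 -> u = z.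
  by move=> e0 e1; apply/matrixP => i j; rewrite ord1; have [->|->] := ord2_cases i.
rewrite /slope => v0 w0; have [v00|v00] := eqVneq (v 0 0); have [w00|w00] := eqVneq (w 0 0) => //.
  have nz (u : 'cV[F]_2) : u != 0 -> u 0 0 = 0 -> u 1 0 != 0.
    by move=> u0 e; apply: contra u0 => /eqP e1; apply/eqP/vec; rewrite !mxE.
  move=> _; exists (w 1 0 / v 1 0); first by rewrite mulf_neq0 ?invr_eq0 ?nz.
  by apply: vec; rewrite !mxE ?v00 ?w00 ?mulr0 // divfK ?nz.
case=> e; exists (w 0 0 / v 0 0); first by rewrite mulf_neq0 ?invr_eq0.
by apply: vec; rewrite !mxE; [rewrite divfK|rewrite mulrAC -mulrA e mulrCA divff // mulr1].
Qed.

End Lines.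

(** * Three factors of dimension 2 *)

Section ThreeQubits.
Local Open Scope ring_scope.
Variables (F : finFieldType).
Hypothesis ch2 : 2%N \in [pchar F].
Local Notation q := #|F|.
Local Notation V := (tensV F 2 3).
Variables (G H : {group {perm V}}).
Hypotheses (sG : G \subset tensor_group F 2 3) (cop : forall v, coprime #|orbit 'P G v| 2).
Hypotheses (HE : forall y, (y \in H) = (y \in G) && (sg y == 1%g)) (oH : odd #|H|).
Variables (x : {perm V}) (a b c : 'I_3).
Hypotheses (xG : x \in G) (x2 : (x ^+ 2 = 1)%g).
Hypotheses (un : uniq [:: a; b; c]) (sa : sg x a = b) (sb : sg x b = a) (sc : sg x c = c).

Let m1 : (1 < 2)%N. Proof. by []. Qed.

Definition same_swap := [set y in x ^: G | sg y == sg x]%g.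

Let ss : (sg x * sg x = 1)%g.
Proof. by have := sgMG m1 sG xG xG; rewrite -[(x * x)%g]/(x ^+ 2)%g x2 (sgE m1 (rep1 F 2 3)). Qed.

Let sV : ((sg x)^-1 = sg x)%g. Proof. by apply/eqP; rewrite eq_invg_mul ss. Qed.

Let all3 i : i \in [:: a; b; c].
Proof.
have sub : {subset [:: a; b; c] <= enum 'I_3} by move=> j _; rewrite mem_enum.
by have [|_ ->] := uniq_min_size un sub; rewrite ?size_enum_ord ?mem_enum.
Qed.

(** The class splits by induced permutation into at most 6 pieces, and conjugation in [G] carries
    each nonempty piece into [same_swap]. *)
Lemma card_class_le_swaps : (#|x ^: G|%g <= 6 * #|same_swap|)%N.
Proof.
pose C s := [set y in x ^: G | sg y == s]%g.
have cC s : (#|C s| <= #|same_swap|)%N.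
  have [->|[y0]] := set_0Vmem (C s); first by rewrite cards0.
  rewrite inE => /andP[/imsetP[g gG ->] /eqP sy0].
  rewrite -(cardJg (C s) g^-1); apply/subset_leq_card/subsetP => _ /imsetP[y yC ->].
  move: yC; rewrite !inE => /andP[yx /eqP sy].
  have yG : y \in G by apply: subsetP yx; exact: class_subG.
  rewrite memJ_norm ?yx; last by rewrite groupV (subsetP (class_norm x G)).
  rewrite conjgE invgK !(sgMG m1 sG) ?groupM ?groupV // (sgVG m1 sG) // sy -sy0 conjgE !(sgMG m1 sG) ?groupM ?groupV //.
  by rewrite (sgVG m1 sG) // !mulgA mulgV mul1g -mulgA mulgV mulg1 eqxx.
have -> : (x ^: G = \bigcup_(s : 'S_3) C s)%g.
  by apply/setP => y; apply/idP/bigcupP => [yx|[s _]]; [exists (sg y); rewrite // !inE yx eqxx|rewrite inE => /andP[]].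
apply: (@leq_trans (\sum_(s : 'S_3) #|C s|)%N).
  elim/big_ind2: _ => [|A n B k hA hB|//]; first by rewrite cards0.
  by apply: leq_trans (leq_add hA hB); rewrite cardsU leq_subr.
apply: (@leq_trans (\sum_(s : 'S_3) #|same_swap|)%N); first by apply: leq_sum => s _.
by rewrite sum_nat_const card_Sn.
Qed.

Section Bound.
Variable A : 'I_3 -> 'M[F]_2.
Hypothesis rx : rep x A (sg x).

(** As y^2 = 1, B_a B_b is scalar, so B_b is determined by B_a up to a scalar. The overall scalar
    has square 1 and is therefore 1. *)
Lemma swaps_determined y y' B B' : y \in same_swap -> y' \in same_swap ->
  rep y B (sg x) -> rep y' B' (sg x) ->
  (exists k, B' a = k *: B a) -> (exists k, B' c = k *: B c) -> y = y'.
Proof.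
move=> yS y'S ry ry' [ka eka] [kc ekc].
have two z : z \in same_swap -> (z ^+ 2 = 1)%g.
  by rewrite inE => /andP[/imsetP[g _ ->] _]; rewrite -conjXg x2 conj1g.
have sq (z : {perm V}) (E : 'I_3 -> 'M[F]_2) : rep z E (sg x) -> (z ^+ 2 = 1)%g -> exists2 l, l != 0 & E a *m E b = l%:M.
  move=> r z2; have := repM r r; rewrite -[(z * z)%g]/(z ^+ 2)%g z2 ss => r2.
  have [l l0] := rep_scalar a r2 (rep1 F 2 3); rewrite sV sa => e.
  by exists l => //; rewrite e scalemx1.
have [l l0 el] := sq y B ry (two y yS); have [l' l'0 el'] := sq y' B' ry' (two y' y'S).
have ka0 : ka != 0.
  by apply: contra_neq l'0 => k0; move: el'; rewrite eka k0 scale0r mul0mx => /matrixP/(_ 0 0); rewrite !mxE.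
have ekb : B' b = (ka^-1 * l' / l) *: B b.
  have : B a *m B' b = (ka^-1 * l')%:M.
    by rewrite -[B a]scale1r -(mulVf ka0) -scalerA -eka -scalemxAl el' scale_scalar_mx.
  move/(congr1 (mulmx (invmx (B a)))); rewrite mulKmx ?ry.1 // mul_mx_scalar => ->.
  rewrite -[in RHS](mulKmx (ry.1 a) (B b)) el mul_mx_scalar scalerA; congr (_ *: _).
  by rewrite divfK.
have [k ke] : exists k : 'I_3 -> F, forall i, B' i = k i *: B i.
  suff h i : exists k, B' i = k *: B i by have [k ke] := fin_all_exists h; exists k.
  by have := all3 i; rewrite !inE => /or3P[]/eqP->; [exists ka|exists (ka^-1 * l' / l)|exists kc].
set K := \prod_i k i; have yE v : y' v = scl K (y v) by rewrite ry'.2 ry.2 (tens_act_scaled _ ke).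
have K2 : K ^+ 2 = 1.
  pose v : V := [ffun=> 1]; have : y' (y' v) = v.
    by rewrite -permM -[(y' * y')%g]/(y' ^+ 2)%g (two y' y'S) perm1.
  rewrite yE yE (rep_scl _ _ ry) -permM -[(y * y)%g]/(y ^+ 2)%g (two y yS) perm1.
  by move/ffunP/(_ [ffun=> 0]); rewrite !ffunE mulr1 expr2.
have K1 : K = 1.
  have : K ^+ 2 == 1 by rewrite K2.
  by rewrite sqrf_eq1 (oppr_pchar2 ch2) orbb => /eqP.
by apply/permP => v; rewrite yE K1; apply/ffunP => f; rewrite ffunE mul1r.
Qed.

Lemma class_parts : exists B : {perm V} -> 'I_3 -> 'M[F]_2,
  forall y, y \in same_swap -> rep y (B y) (sg x).
Proof.
suff h (y : {perm V}) : exists B : 'I_3 -> 'M[F]_2, y \in same_swap -> rep y B (sg x).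
  by have [B hB] := fin_all_exists h; exists B.
case: (boolP (y \in same_swap)) => [|_]; last by exists (fun=> 0).
rewrite inE => /andP[yx /eqP sy].
have yG : y \in G by apply: subsetP yx; exact: class_subG.
by have [B rB] := sg_rep m1 (subsetP sG _ yG); exists B => _; rewrite -sy.
Qed.

(** x y lies in [H], so B_i times a component of x lies in the odd group [parts i]. Modulo scalars
    its elements are told apart by the line to which they send a regular vector. *)
Lemma slope_injective i : exists f : {perm V} -> option F, forall y y' B B',
  y \in same_swap -> y' \in same_swap -> rep y B (sg x) -> rep y' B' (sg x) ->
  f y = f y' -> exists k, B' i = k *: B i.
Proof.
have [C rC] := class_parts.
have [v v0 reg] := @regular_vector F ch2 (parts_group H i)
  (odd_parts i ch2 oH) (fun k k0 => @scalar_parts F 1 3 H i k isT k0).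
have part y B : y \in same_swap -> rep y B (sg x) -> exists2 g : {'GL_2[F]},
    g \in parts H i & GLval g = B i *m A (sg x i).
  move=> yS ry; have r2 := repM rx ry; rewrite ss in r2.
  have u : B i *m A (sg x i) \in unitmx by rewrite unitmx_mul ry.1 rx.1.
  exists (insubd (1%g : {'GL_2[F]}) (B i *m A (sg x i))).
    apply/partsP; exists (x * y)%g; eexists; split; [|exact: r2|].
      rewrite HE groupM //=; first by rewrite (sgE m1 r2) eqxx.
      by move: yS; rewrite inE => /andP[yx _]; apply: subsetP yx; exact: class_subG.
    by rewrite -[RHS]/(val _) insubdK // sV.
  by rewrite -[LHS]/(val _) insubdK.
exists (fun y => slope (C y i *m A (sg x i) *m v)) => y y' B B' yS y'S ry ry' e.
have [g gP gE] := part y _ yS (rC y yS); have [g' gP' gE'] := part y' _ y'S (rC y' y'S).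
have nz (h : {'GL_2[F]}) : (GLval h : 'M[F]_2) *m v != 0.
  by apply: contra v0 => /eqP h0; rewrite -[v](mulKmx (GL_unitmx h)) h0 mulmx0.
have n1 : C y i *m A (sg x i) *m v != 0 by rewrite -gE nz.
have n2 : C y' i *m A (sg x i) *m v != 0 by rewrite -gE' nz.
have [k k0 ek] := slope_eq n1 n2 e.
rewrite -gE -gE' in ek.
have [z zP zE] := @scalar_parts F 1 3 H i k^-1 isT (invr_neq0 k0).
have mem := groupM zP (groupM (groupVr gP) gP').
have := reg _ mem.
rewrite GL_MxE zE mul_scalar_mx -scalemxAl GL_MxE -mulmxA ek -scalemxAr GL_VxE.
rewrite mulKmx ?(GL_unitmx g) // scalerA mulVf // scale1r => /(_ erefl).
move/(congr1 (fun h => k *: (GLval g *m GLval h))); rewrite !GL_MxE zE mul_scalar_mx -scalemxAr GL_VxE.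
rewrite mulKVmx ?(GL_unitmx g) // scalerA divff // scale1r mulmx1 gE gE'.
rewrite scalemxAl => /(can_inj (mulmxK (rx.1 (sg x i)))) eC.
have [l l0 El] := rep_scalar i ry (rC y yS); have [l' l'0 El'] := rep_scalar i ry' (rC y' y'S).
exists (l' * k / l); rewrite El' eC El !scalerA; congr (_ *: _).
by field.
Qed.

Lemma swaps_bound : (#|same_swap| <= q.+1 ^ 2)%N.
Proof.
have [C rC] := class_parts; have [f fP] := slope_injective a; have [g gP] := slope_injective c.
have -> : (q.+1 ^ 2)%N = #|{: option F * option F}| by rewrite card_prod !card_option mulnn.
rewrite -(@card_in_imset _ _ (fun y => (f y, g y))) ?max_card // => y y' yS y'S /= e.
have ef := congr1 fst e; have eg := congr1 snd e.
apply: (swaps_determined yS y'S (rC y yS) (rC y' y'S)).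
  exact: fP yS y'S (rC y yS) (rC y' y'S) ef.
exact: gP yS y'S (rC y yS) (rC y' y'S) eg.
Qed.

(** A conjugating element keeps position c, so the component at c stays scalar and only the slope at
    a is free. *)
Lemma swaps_bound_scalar : is_scalar_mx (A c) -> (#|same_swap| <= q.+1)%N.
Proof.
case/is_scalar_mxP => l eA; have [C rC] := class_parts; have [f fP] := slope_injective a.
have sc_c y : y \in same_swap -> exists2 k, k != 0 & C y c = k%:M.
  move=> yS; have r1 := rC y yS; move: yS; rewrite inE => /andP[/imsetP[g gG yE] /eqP sy].
  have [R rR] := sg_rep m1 (subsetP sG _ gG).
  have := repM (repM (repV rR) rx) rR; rewrite -(mulgA g^-1%g) -conjgE -yE => r2.
  have s2 := rep_perm_uniq m1 r2 r1; rewrite s2 in r2.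
  have gc : sg g c = c.
    have : sg x (sg g c) = sg g c.
      by rewrite -{1}s2 -!mulgA !permM permK sc.
    have := all3 (sg g c); rewrite !inE => /or3P[]/eqP-> //.
      by rewrite sa => e; move: un; rewrite e /= inE eqxx.
    by rewrite sb => e; move: un; rewrite e /= inE eqxx.
  have gVc : (sg g)^-1%g c = c by rewrite -{1}gc permK.
  have xVc : (sg x)^-1%g c = c by rewrite sV.
  have [k k0] := rep_scalar c r1 r2; rewrite gVc xVc eA gc mul_scalar_mx -scalemxAr mulmxV ?rR.1 //.
  rewrite scale_scalar_mx scale_scalar_mx mulr1 => e; exists (k * l) => //.
  apply: contraTneq (r1.1 c) => h; rewrite e h unitmxE det_scalar expr0n /= unitr0 //.
rewrite -card_option -(@card_in_imset _ _ f) ?max_card // => y y' yS y'S e.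
apply: (swaps_determined yS y'S (rC y yS) (rC y' y'S)).
  exact: fP yS y'S (rC y yS) (rC y' y'S) e.
have [k k0 ->] := sc_c y yS; have [k' k'0 ->] := sc_c y' y'S.
by exists (k' / k); rewrite scale_scalar_mx divfK.
Qed.

(** If u is no eigenvector of A_c, the tensors with u at position c meet the fixed space
    trivially. *)
Lemma fixpts_nonscalar : ~~ is_scalar_mx (A c) -> (#|fixpts x| * q ^ 4 <= q ^ 8)%N.
Proof.
move=> nsc; have [u Au] : exists u : 'cV[F]_2, det2 u (A c *m u) != 0.
  apply/existsP; rewrite -negb_forall; apply: contra nsc => /forallP h.
  pose e i : 'cV[F]_2 := delta_mx i 0.
  have := h (e 0); have := h (e 1); have := h (e 0 + e 1).
  rewrite mulmxDr -!colE /det2 !mxE /= !mulr1n !(mul0r, mul1r, sub0r, subr0, add0r, addr0).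
  rewrite oppr_eq0 => + /eqP h1 /eqP h2; rewrite h1 h2 add0r addr0 subr_eq0 => /eqP h3.
  apply/is_scalar_mxP; exists (A c 0 0); apply/matrixP => i j; rewrite !mxE.
  by have [->|->] := ord2_cases i; have [->|->] := ord2_cases j.
pose N := #|{ffun 'I_2 -> 'I_2}|.
have [fV fVK Vf] := flat_bij F 2 c.
pose Y := [set fV (u *m w) | w : 'rV[F]_N].
have u0 : u != 0 by apply: contraNneq Au => ->; rewrite /det2 !mxE !mul0r subrr.
have cY : #|Y| = (q ^ 4)%N.
  rewrite card_imset; first by rewrite card_mx mul1n /N card_ffun !card_ord.
  move=> w w' /(can_inj Vf) e; apply/matrixP => i j; rewrite ord1.
  have /matrixP E := e; have [h|h] := eqVneq (u 0 0) 0.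
    have u1 : u 1 0 != 0.
      apply: contra u0 => /eqP u1; apply/eqP/matrixP => k l; rewrite ord1 [RHS]mxE.
      by have [->|->] := ord2_cases k.
    by have := E 1 j; rewrite !mxE !big_ord1; apply: mulfI.
  by have := E 0 j; rewrite !mxE !big_ord1; apply: mulfI.
have -> : (q ^ 8 = #|V|)%N by rewrite card_tensV.
rewrite -cY; apply: (card_fixpts_complement rx).
  move=> _ _ /imsetP[w _ ->] /imsetP[w' _ ->]; apply/imsetP; exists (w - w') => //.
  apply: (can_inj fVK); rewrite Vf mulmxBr -[u *m w]Vf -[u *m w']Vf.
  by apply/matrixP => k l; rewrite !mxE !ffunE !Vf.
move=> _ /imsetP[w _ ->] fx; have [B [_ uB eB]] := flat_two_sided (isT : (0 < 2)%N) rx sc.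
have := eB (fV (u *m w)); rewrite fx Vf mulmxA -mulmxA.
set w' := w *m B => e.
have w'0 : w' = 0.
  apply/matrixP => k l; rewrite ord1 [RHS]mxE {k}; move/matrixP: e => e.
  have := e 0 l; have := e 1 l; rewrite !mxE !big_ord1 => e1 e0.
  have : det2 u (A c *m u) * w' 0 l = 0.
    rewrite /det2 mulrBl -!mulrA; move: e1 e0; rewrite !mxE => <- <-; ring.
  by move/eqP; rewrite mulf_eq0 (negbTE Au) => /eqP h; rewrite -[RHS]h [RHS]mxE.
apply: (can_inj fVK); rewrite Vf e w'0 mulmx0.
by apply/matrixP => k l; rewrite !mxE ffunE.
Qed.

End Bound.

(** The count gives q^e <= 6 N with e = 2, N = q + 1 or e = 4, N = (q + 1)^2. Both fail from q = 8
    on; the first still holds at q = 4. *)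
Lemma three_qubits_small : (q < 8)%N.
Proof.
rewrite ltnNge; apply/negP => q8; have [A rx] := sg_rep m1 (subsetP sG _ xG).
have px : (2.-elt x)%g.
  by apply: (@pnat_dvd _ 2); [rewrite order_dvdn x2|rewrite pnat_id].
have h := card_le_class_fixpts (isT : prime 2) cop xG px; rewrite card_tensV in h.
have hc := card_class_le_swaps.
have le e N : (#|same_swap| <= N)%N -> (#|fixpts x| * q ^ e <= q ^ 8)%N -> (q ^ e <= 6 * N)%N.
  move=> hN hf; have q0 : (0 < q ^ 8)%N by rewrite expn_gt0 (leq_trans _ q8).
  rewrite -(leq_pmul2l q0); apply: leq_trans (leq_mul h (leqnn _)) _.
  rewrite -mulnA mulnC leq_mul //; apply: leq_trans hc _; by rewrite leq_mul2l hN.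
case: (boolP (is_scalar_mx (A c))) => scA.
  have ab : sg x a != a by rewrite sa; apply: contraTneq un => ->; rewrite /= inE eqxx.
  have := card_fixpts_moved (isT : (0 < 2)%N) rx ab; have -> : ((2 - 1) * 2 ^ (3 - 2) = 2)%N by [].
  move/(le _ _ (swaps_bound_scalar rx scA)); move: q8; move: (q) => z; clear; nia.
have := le _ _ (swaps_bound rx) (fixpts_nonscalar rx scA).
have -> : (q ^ 4 = (q ^ 2) ^ 2)%N by rewrite -expnM.
have : (64 <= q ^ 2)%N by rewrite -[64%N]/(8 ^ 2)%N leq_exp2r.
have : (q.+1 ^ 2 <= 2 * q ^ 2)%N by move: q8; move: (q) => z; clear; nia.
move: (_.+1 ^ 2)%N (q ^ 2)%N => y z; clear; nia.
Qed.

End ThreeQubits.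

Lemma GL_of_unit (F : finFieldType) k (A : 'M[F]_k.+1) : (A \in unitmx)%R ->
  exists g : {'GL_k.+1[F]}, GLval g = A.
Proof. by move=> u; exists (insubd (1%g : {'GL_k.+1[F]}) A); rewrite -[LHS]/(val _) insubdK. Qed.

(** * Odd-order groups of symmetrizers *)

Section LinearGroups.
Local Open Scope ring_scope.
Variables (F : finFieldType) (k : nat) (gT : finGroupType) (rho : gT -> 'M[F]_k.+1).
Hypotheses (rho1 : rho 1%g = 1%:M) (rhoM : forall g h, rho (g * h)%g = rho g *m rho h).
Hypothesis rho_inj : injective rho.
Local Notation q := #|F|.
Implicit Types (g h : gT) (v w : 'cV[F]_k.+1) (E : {group gT}).

Lemma rhoVK g v : rho g^-1%g *m (rho g *m v) = v.
Proof. by rewrite mulmxA -rhoM mulVg rho1 mul1mx. Qed.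

Lemma rhoKV g v : rho g *m (rho g^-1%g *m v) = v.
Proof. by rewrite mulmxA -rhoM mulgV rho1 mul1mx. Qed.

Lemma rho_unit g : rho g \in unitmx.
Proof. by apply: (@mulmx1_unit _ _ _ (rho g^-1%g) _).1; rewrite -rhoM mulgV rho1. Qed.

Lemma rho_mul_inj g : injective (mulmx (rho g) : 'cV_k.+1 -> 'cV_k.+1).
Proof. exact: can_inj (rhoVK g). Qed.

Lemma rho_mul_eq0 g v : (rho g *m v == 0) = (v == 0).
Proof. by rewrite -(inj_eq (@rho_mul_inj g) v 0) mulmx0. Qed.

(** The inverse turns left multiplication into a right action. *)
Definition lin_to v g : 'cV[F]_k.+1 := rho g^-1%g *m v.

Lemma lin_toP : is_action [set: gT] lin_to.
Proof.
split=> [g v w /rho_mul_inj //|v g h _ _].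
by rewrite /lin_to invMg rhoM mulmxA.
Qed.
Definition lin_act := Action lin_toP.

Lemma lin_astab1 E v g : (g \in 'C_E[v | lin_act])%g = (g \in E) && (rho g *m v == v).
Proof.
rewrite inE; congr (_ && _); apply/astab1P/eqP => /= [e|e].
  by rewrite -[in LHS]e /= /lin_to rhoKV.
by rewrite /lin_to -{1}e rhoVK.
Qed.

Lemma card_nonzero_vectors : #|[set v : 'cV[F]_k.+1 | v != 0]| = (q ^ k.+1 - 1)%N.
Proof.
have := cardC1 (0 : 'cV[F]_k.+1); rewrite card_mx muln1 subn1 => <-.
by apply: eq_card => u; rewrite !inE.
Qed.

Lemma orbit_nonzero E v : v != 0 -> orbit lin_act E v \subset [set w | w != 0].
Proof.
move=> v0; apply/subsetP => _ /imsetP[g _ ->]; rewrite inE /= /lin_to.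
by rewrite rho_mul_eq0.
Qed.

Lemma semiregular_dvd E (S : {set 'cV[F]_k.+1}) :
  (forall g v, g \in E -> v \in S -> rho g *m v \in S) ->
  (forall g v, g \in E -> v \in S -> rho g *m v = v -> g = 1%g) -> (#|E| %| #|S|)%N.
Proof.
move=> ES reg; have act : [acts E, on S | lin_act]%g.
  apply/subsetP => g gE; rewrite !inE; apply/subsetP => v vS; rewrite inE /=.
  by apply: ES => //; rewrite groupV.
rewrite (card_uniform_partition (n := #|E|) _ (orbit_partition act)) ?dvdn_mull // => _ /imsetP[v vS ->].
rewrite card_orbit (_ : 'C_E[v | lin_act]%g = 1%g) ?indexg1 //.
apply/trivgP/subsetP => g; rewrite lin_astab1 => /andP[gE /eqP gv].
by rewrite (reg g v) // set11.
Qed.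

Definition scalars E := [set g in E | is_scalar_mx (rho g)].

Lemma scalars_group_set E : group_set (scalars E).
Proof.
apply/group_setP; split; first by rewrite inE group1 rho1 scalar_mx_is_scalar.
move=> g h; rewrite !inE => /andP[gE /is_scalar_mxP[a ea]] /andP[hE /is_scalar_mxP[b eb]].
by rewrite groupM // rhoM ea eb -scalar_mxM scalar_mx_is_scalar.
Qed.
Canonical scalars_group E := Group (scalars_group_set E).

Lemma scalarsP E g : reflect (g \in E /\ exists2 c, c != 0 & rho g = c%:M) (g \in scalars E).
Proof.
rewrite inE; apply: (iffP andP) => -[gE].
  move/is_scalar_mxP => [c e]; split=> //; exists c => //.
  by apply: contraTneq (rho_unit g) => c0; rewrite e c0 unitmxE det_scalar expr0n /= unitr0.
by case=> c _ ->; rewrite scalar_mx_is_scalar.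
Qed.

Lemma scalars_comm E z g : z \in scalars E -> commute z g.
Proof.
by case/scalarsP => _ [c _ e]; apply: rho_inj; rewrite !rhoM e scalar_mxC.
Qed.

Lemma card_nonzero : #|[set c : F | c != 0]| = q.-1.
Proof. by have := cardC1 (0 : F) => <-; apply: eq_card => c; rewrite !inE. Qed.

Definition invsym := [set S : 'M[F]_k.+1 | (S^T == S) && (S \in unitmx)].

Section WithScalars.
Variable E : {group gT}.
Hypothesis ZE : forall c : F, c != 0 -> exists2 z, z \in E & rho z = c%:M.

Lemma scalar_fun : exists z : F -> gT, forall c, c != 0 -> z c \in E /\ rho (z c) = c%:M.
Proof.
suff h c : exists g : gT, c != 0 -> g \in E /\ rho g = c%:M.
  by have [z zP] := fin_all_exists h; exists z.
have [->|c0] := eqVneq c 0; first by exists 1%g.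
by have [g ? ?] := ZE c0; exists g.
Qed.

Lemma card_scalars : #|scalars E| = q.-1.
Proof.
have [z zP] := scalar_fun; rewrite -card_nonzero -(@card_in_imset _ _ z [set c | c != 0]).
  apply: eq_card => g; apply/scalarsP/imsetP => [[gE [c c0 e]]|[c]].
    by exists c; rewrite ?inE //; apply: rho_inj; rewrite (zP c c0).2.
  by rewrite inE => c0 ->; have [zE e] := zP c c0; split=> //; exists c.
move=> c d; rewrite !inE => c0 d0 e; have := (zP c c0).2; rewrite e (zP d d0).2.
by move/matrixP/(_ 0 0); rewrite !mxE eqxx.
Qed.

(** A scalar multiple of a symmetrizer is another one, so (c, X) maps injectively to the resulting
    group element and invertible symmetric matrix. *)
Lemma symmetrizer_count :
  (forall X, X \in unitmx -> exists2 g, g \in E & (rho g *m X)^T = rho g *m X) ->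
  (q.-1 * #|[set X : 'M[F]_k.+1 | X \in unitmx]| <= #|E| * #|invsym|)%N.
Proof.
move=> symE; have [z zP] := scalar_fun.
have [s sP] : exists s : 'M[F]_k.+1 -> gT, forall X, X \in unitmx ->
    s X \in E /\ (rho (s X) *m X)^T = rho (s X) *m X.
  suff h (X : 'M[F]_k.+1) : exists g, X \in unitmx -> g \in E /\ (rho g *m X)^T = rho g *m X.
    by have [s sP] := fin_all_exists h; exists s.
  case: (boolP (X \in unitmx)) => [/symE[g gE e]|_]; last by exists 1%g.
  by exists g.
rewrite -card_nonzero -!cardsX.
rewrite -(@card_in_imset _ _ (fun u : F * 'M[F]_k.+1 => ((z u.1 * s u.2)%g, rho (z u.1) *m rho (s u.2) *m u.2))).
  apply/subset_leq_card/subsetP => _ /imsetP[[c X] /setXP[c0 uX] ->].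
  rewrite !inE /= in c0 uX; have [zS zE] := zP c c0; have [sE eX] := sP X uX.
  apply/setXP; split; first exact: groupM.
  rewrite inE zE -mulmxA mul_scalar_mx linearZ /= eX eqxx /=.
  by rewrite unitmxZ ?unitfE // unitmx_mul rho_unit.
move=> [c X] [d Y] /setXP[c0 uX] /setXP[d0 uY] e.
rewrite !inE /= in c0 d0 uX uY; have e1 := congr1 fst e; have e2 := congr1 snd e.
rewrite /= in e1 e2; rewrite -!rhoM e1 in e2.
have XY : X = Y by apply: (can_inj (mulKmx (rho_unit _))) e2.
have := e1; rewrite XY => /mulIg/(congr1 rho); rewrite (zP c c0).2 (zP d d0).2.
by move/matrixP/(_ 0 0); rewrite !mxE eqxx !mulr1n => ->.
Qed.

End WithScalars.
End LinearGroups.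

(** * Restriction of symmetrizer groups to subspaces *)

Section Restriction.
Local Open Scope ring_scope.
Variables (F : finFieldType) (n k : nat) (D : {group {'GL_n.+1[F]}}).
Variables (P : 'M[F]_(n.+1, k.+1)) (L : 'M[F]_(k.+1, n.+1)).
Hypothesis LP : L *m P = 1%:M.

(** The group induced on the column space of [P] by its stabiliser in [D]; for square invertible [P]
    it is a conjugate of [D]. *)
Definition restriction := [set g : {'GL_k.+1[F]} | [exists c in D, GLval c *m P == P *m GLval g]].

Lemma restrictionP (g : {'GL_k.+1[F]}) :
  reflect (exists2 c, c \in D & GLval c *m P = P *m GLval g) (g \in restriction).
Proof.
by rewrite inE; apply: (iffP exists_inP) => -[c cD /eqP e]; exists c => //; apply/eqP.
Qed.

Lemma restriction_group_set : group_set restriction.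
Proof.
apply/group_setP; split; first by apply/restrictionP; exists 1%g; rewrite // !GL_1E mul1mx mulmx1.
move=> g h /restrictionP[c cD ec] /restrictionP[d dD ed]; apply/restrictionP.
exists (c * d)%g; first exact: groupM.
by rewrite !GL_MxE -mulmxA ed mulmxA ec mulmxA.
Qed.
Canonical restriction_group := Group restriction_group_set.

Lemma restriction_scalars : (forall c : F, c != 0 -> exists2 z, z \in D & GLval z = c%:M) ->
  forall c : F, c != 0 -> exists2 z, z \in restriction & GLval z = c%:M.
Proof.
move=> ZD c c0; have [z zD ez] := ZD c c0.
have u : (c%:M : 'M[F]_k.+1) \in unitmx by rewrite unitmxE det_scalar unitfE expf_neq0.
have [g e] := GL_of_unit u; exists g => //.
by apply/restrictionP; exists z; rewrite // e ez scalar_mxC.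
Qed.

(** If c induces g, then c^|D| = 1 induces g^|D|, so the order of g is odd. *)
Lemma restriction_odd : odd #|D| -> odd #|restriction|.
Proof.
move=> oD; rewrite -[odd _]negbK -dvdn2; apply/negP => d2.
have [||g gR og] := @Cauchy _ 2 restriction_group => //.
have [c cD ec] := restrictionP _ gR.
have e j : GLval (c ^+ j)%g *m P = P *m GLval (g ^+ j)%g.
  elim: j => [|j IH]; first by rewrite !GL_1E mul1mx mulmx1.
  by rewrite !expgS !GL_MxE -mulmxA IH !mulmxA ec.
have := e #|D|; rewrite expg_cardG // GL_1E mul1mx => /(congr1 (mulmx L)).
rewrite mulmxA LP mul1mx => gN; have : (#[g]%g %| #|D|)%N.
  by rewrite order_dvdn; apply/eqP/val_inj; rewrite -[LHS]/(GLval _) -gN.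
by rewrite og dvdn2 oD.
Qed.

(* A symmetrizer of P M P^T stabilises the column space of P and induces
   there a symmetrizer of M. *)
Lemma restriction_symmetrizer :
  (forall X : 'M[F]_n.+1, exists2 g, g \in D & (GLval g *m X)^T = GLval g *m X) ->
  forall X : 'M[F]_k.+1, X \in unitmx ->
    exists2 g, g \in restriction & (GLval g *m X)^T = GLval g *m X.
Proof.
move=> symD X uX; have [c cD] := symD (P *m X *m P^T).
rewrite !mulmxA !trmx_mul trmxK => e.
pose g := X^T *m (P^T *m ((GLval c)^T *m L^T)) *m invmx X.
have PL : P^T *m L^T = 1%:M by rewrite -trmx_mul LP trmx1.
have eg : GLval c *m P = P *m g.
  have := congr1 (fun Y => Y *m L^T *m invmx X) e.
  rewrite /= -(mulmxA _ P^T L^T) PL mulmx1 mulmxK // => <-.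
  by rewrite /g !mulmxA.
clearbody g; have ug : g \in unitmx.
  have : (L *m invmx (GLval c) *m P) *m g = 1%:M.
    by rewrite -mulmxA -eg -mulmxA mulKmx ?LP // (GL_unitmx c).
  by case/mulmx1_unit.
have [g0 g0E] := GL_of_unit ug.
exists g0; first by apply/restrictionP; exists c; rewrite ?g0E.
have cP : P^T *m (GLval c)^T = g^T *m P^T by rewrite -!trmx_mul eg.
move: e; rewrite cP eg => e1; rewrite g0E trmx_mul.
have := congr1 (fun Y => L *m Y *m L^T) e1.
by rewrite /= !mulmxA LP !mul1mx -!(mulmxA _ P^T) PL !mulmx1.
Qed.

End Restriction.

(** * Symmetrizers in dimension 2 *)

Section SymmetrizerDim2.
Local Open Scope ring_scope.
Variables (F : finFieldType).
Hypothesis ch2 : 2%N \in [pchar F].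
Local Notation q := #|F|.

Lemma card_unitmx n : #|[set X : 'M[F]_n.+1 | X \in unitmx]| = #|'GL_n.+1[F]%g|.
Proof. by rewrite cardsT card_sub; apply: eq_card => X; rewrite !inE. Qed.

(* A symmetric matrix of order 2 is determined by its diagonal and its
   determinant, squaring being injective. *)
Lemma card_invsym2 : (#|invsym F 1| <= q ^ 2 * q.-1)%N.
Proof.
rewrite -(card_nonzero F) -mulnn -[X in (X * X)%N]cardsT -!cardsX.
rewrite -(@card_in_imset _ _ (fun S : 'M[F]_2 => (S 0 0, S 1 1, \det S))).
  apply/subset_leq_card/subsetP => x /imsetP[S]; rewrite inE => /andP[_ uS] ->.
  by rewrite !in_setX !inE /= -unitfE -unitmxE.
move=> S S'; rewrite !inE => /andP[/eqP sS _] /andP[/eqP sS' _] [e0 e1].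
have sy (X : 'M[F]_2) : X^T = X -> X 1 0 = X 0 1 by move=> e; rewrite -[in LHS]e mxE.
rewrite !det_mx22 (sy S) // (sy S') // e0 e1 => /addrI/oppr_inj/eqP.
rewrite -!expr2 -subr_eq0.
have -> : S 0 1 ^+ 2 - S' 0 1 ^+ 2 = (S 0 1 - S' 0 1) ^+ 2.
  by rewrite -!(pFrobenius_autE ch2) rmorphB.
rewrite sqrf_eq0 subr_eq0 => /eqP e; apply/matrixP => i j.
by have [->|->] := ord2_cases i; have [->|->] := ord2_cases j; rewrite ?e0 ?e1 ?sy ?e.
Qed.

Variable E : {group {'GL_2[F]}}.
Hypotheses (oE : odd #|E|) (ZE : forall c : F, c != 0 -> exists2 z, z \in E & GLval z = c%:M).
Hypothesis symE : forall X : 'M[F]_2, X \in unitmx ->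
  exists2 g, g \in E & (GLval g *m X)^T = GLval g *m X.

Let rho : {'GL_2[F]} -> 'M[F]_2 := fun g => GLval g.
Let rho1 : rho 1%g = 1%:M. Proof. by []. Qed.
Let rhoM g h : rho (g * h)%g = rho g *m rho h. Proof. by []. Qed.
Let rho_inj : injective rho. Proof. exact: val_inj. Qed.

(** Write |E| = l (q - 1). The count gives q^2 - 1 <= l q, hence l >= q, and l is odd while q is
    even. *)
Lemma symmetrizers_dim2_card : (q ^ 2 - 1 <= #|E|)%N.
Proof.
have sZ : scalars_group rho1 rhoM E \subset E by apply/subsetP => g; rewrite inE => /andP[].
have := cardSg sZ; rewrite /= (card_scalars rho1 rhoM rho_inj ZE) => /dvdnP[l El].
have [n n0 qE] := card_pchar ch2.
have oq : ~~ odd q by rewrite qE oddX; case: (n) n0.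
have ol : odd l by move: oE; rewrite El oddM => /andP[].
have := symmetrizer_count rho1 rhoM ZE symE; rewrite card_unitmx card_GL_2 El.
move/leq_trans => /(_ _ (leq_mul (leqnn _) card_invsym2)).
have q1 : (1 < q)%N := finNzRing_gt1 F; move: oq q1 ol; clear; move: (q) => [|[|r]] // oq _ ol.
rewrite [r.+2.-1]/= => h.
have {}h : (r.+1 * r.+3 <= l * r.+2)%N.
  have p0 : (0 < r.+1 ^ 2 * r.+2)%N by [].
  rewrite -(leq_pmul2l p0); apply: leq_trans (leq_trans h _); nia.
have lr : (r.+2 <= l)%N.
  rewrite leqNgt; apply/negP => lr; have : (l * r.+2 <= r.+1 * r.+2)%N by rewrite leq_mul2r -(ltnS l) lr orbT.
  by move: h; clear; nia.
have lr3 : (r.+3 <= l)%N.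
  by rewrite ltn_neqAle lr andbT; apply: contraNneq oq => ->.
by move: lr3; clear; nia.
Qed.

(** A regular orbit has length |E| >= q^2 - 1, so it contains all nonzero vectors and every
    stabiliser is trivial. *)
Lemma symmetrizers_dim2_semiregular h (w : 'cV[F]_2) : h \in E -> w != 0 -> GLval h *m w = w -> h = 1%g.
Proof.
move=> hE w0 hw; have [v v0 reg] := regular_vector ch2 oE ZE.
have [g gE gv] : exists2 g, g \in E & rho g *m v = w.
  have inj : {in E &, injective (fun g => rho g *m v)}.
    move=> g g' gE g'E /= e; have : (g^-1 * g' = 1)%g.
      apply: reg; first by rewrite groupM ?groupV.
      by rewrite -[GLval _]/(rho _) rhoM -mulmxA -e (rhoVK rho1 rhoM).
    by move/(congr1 (mulg g)); rewrite mulKVg mulg1 => ->.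
  have sub : [set rho g *m v | g in E] \subset [set w : 'cV[F]_2 | w != 0].
    by apply/subsetP => _ /imsetP[g _ ->]; rewrite inE (rho_mul_eq0 rho1 rhoM).
  have : [set rho g *m v | g in E] == [set w : 'cV[F]_2 | w != 0].
    rewrite eqEcard sub card_in_imset //.
    by rewrite (card_nonzero_vectors F 1) symmetrizers_dim2_card.
  move/eqP/setP/(_ w); rewrite inE w0 => /imsetP[g gE ->]; by exists g.
have : (g^-1 * (h * g) = 1)%g.
  apply: reg; first by rewrite !groupM ?groupV.
  by rewrite -[GLval _]/(rho _) !rhoM -!mulmxA gv -[rho h *m w]/(GLval h *m w) hw -gv (rhoVK rho1 rhoM).
by move/(congr1 (mulg g)); rewrite mulKVg mulg1 => /(canRL (mulgK g)); rewrite mulgV.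
Qed.

End SymmetrizerDim2.

Section RankTools.
Local Open Scope ring_scope.
Variable F : fieldType.

Lemma rank1_factor m n (N : 'M[F]_(m, n)) : (\rank N <= 1)%N -> exists (e : 'cV_m) (l : 'rV_n), N = e *m l.
Proof.
have := mulmx_base N; move: (col_base N) (row_base N); move: (\rank N) => [|[|]] // C R <- _; last by exists C, R.
by exists 0, 0; rewrite mul0mx [R]flatmx0 mulmx0.
Qed.

Lemma indep_cols n (u w : 'cV[F]_n) : u != 0 -> (exists k, w = k *: u) \/ \rank (row_mx u w) = 2%N.
Proof.
move=> u0; case: (boolP (w^T <= u^T)%MS) => [/sub_rVP[k e]|nwu]; [left|right].
  by exists k; rewrite -[w]trmxK e linearZ /= trmxK.
apply/eqP; rewrite eqn_leq rank_leq_col -mxrank_tr tr_row_mx -addsmxE.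
have r1 : \rank u^T = 1%N by rewrite rank_rV -trmx0 (inj_eq trmx_inj) u0.
apply: (@leq_ltn_trans (\rank u^T)); first by rewrite r1.
apply: rank_ltmx; rewrite ltmxE addsmxSl /=.
by apply: contra nwu => h; apply: submx_trans (addsmxSr _ _) h.
Qed.

Lemma kill_rank n m (N : 'M[F]_(m, n)) (u w : 'cV_n) : N *m u = 0 -> N *m w = 0 ->
  \rank (row_mx u w) = 2%N -> (\rank N + 2 <= n)%N.
Proof. by move=> Nu Nw <-; apply: mulmx0_rank_max; rewrite mul_mx_row Nu Nw row_mx0. Qed.

Lemma singular_vector n (N : 'M[F]_n) : N \notin unitmx -> exists2 u : 'cV_n, u != 0 & N *m u = 0.
Proof.
move=> nu; have : kermx N^T != 0 by rewrite kermx_eq0 row_free_unit unitmx_tr.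
case/rowV0Pn => u /sub_kermxP/(congr1 trmx); rewrite trmx_mul trmxK trmx0 => e u0.
by exists u^T; rewrite // -trmx0 (inj_eq trmx_inj).
Qed.

Lemma unit_kernel n (N : 'M[F]_n) (u : 'cV_n) : N \in unitmx -> N *m u = 0 -> u = 0.
Proof. by move=> uN e; rewrite -[u](mulKmx uN) e mulmx0. Qed.

Lemma rank1_image n (N : 'M[F]_n) : (\rank N <= 1)%N -> N != 0 ->
  exists z : 'cV_n, N *m z != 0 /\ forall v, exists k, N *m v = k *: (N *m z).
Proof.
move=> /rank1_factor[e [l ->]] N0; have [z z0] : exists z : 'cV[F]_n, l *m z != 0.
  have : l != 0 by apply: contraNneq N0 => ->; rewrite mulmx0.
  case/rV0Pn => i li; exists (delta_mx i 0); rewrite -colE.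
  by apply: contra li => /eqP/matrixP/(_ 0 0); rewrite !mxE => ->.
have sc (v : 'cV[F]_n) : e *m l *m v = (l *m v) 0 0 *: e.
  by rewrite -mulmxA {1}[l *m v]mx11_scalar mul_mx_scalar.
have lz0 : (l *m z) 0 0 != 0.
  by apply: contra z0 => /eqP h; by rewrite [l *m z]mx11_scalar h -scalemx1 scale0r.
exists z; split.
  rewrite sc scaler_eq0 (negbTE lz0) /=; apply: contra N0 => /eqP->; by rewrite mul0mx.
by move=> v; exists ((l *m v) 0 0 / (l *m z) 0 0); rewrite !sc scalerA divfK.
Qed.

Lemma mul_row3 n (u v w : 'cV[F]_n) (x : 'cV_(1 + (1 + 1))) :
  exists a b c, row_mx u (row_mx v w) *m x = a *: u + b *: v + c *: w.
Proof.
rewrite -[x]vsubmxK mul_row_col; move: (usubmx x) (dsubmx x) => x1 {}x.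
rewrite -[x]vsubmxK mul_row_col; move: (usubmx x) (dsubmx x) => x2 x3.
exists (x1 0 0), (x2 0 0), (x3 0 0).
by rewrite {1}[x1]mx11_scalar {1}[x2]mx11_scalar {1}[x3]mx11_scalar !mul_mx_scalar addrA.
Qed.

End RankTools.

(** * The commutant of a 3 x 3 matrix without eigenvector *)

Section Irreducible3.
Local Open Scope ring_scope.
Variables (F : fieldType) (Y : 'M[F]_3).
Hypothesis noeig : forall (v : 'cV_3) c, Y *m v = c *: v -> v = 0.

(** If N kills u, it kills Y u as well, which is independent of u. A nonzero N then has rank 1, and
    its image is a line stable under Y. *)
Lemma commutant_unit N : Y *m N = N *m Y -> N != 0 -> N \in unitmx.
Proof.
move=> YN N0; apply: contraR N0 => /singular_vector[u u0 Nu]; apply/eqP.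
have [[k e]|r2] := indep_cols (Y *m u) u0; first by rewrite (noeig e) eqxx in u0.
have NYu : N *m (Y *m u) = 0 by rewrite mulmxA -YN -mulmxA Nu mulmx0.
apply/eqP; apply: contraT => N0; have r1 : (\rank N <= 1)%N by rewrite -(leq_add2r 2) (kill_rank Nu NYu r2).
have [z [Nz im]] := rank1_image r1 N0; have [k e] := im (Y *m z).
have e0 : N *m z = 0 by apply: (@noeig _ k); rewrite mulmxA YN -mulmxA e.
by rewrite e0 eqxx in Nz.
Qed.

(** A functional l vanishing on u, Y u and Y^2 u gives two functionals l and Y^T l vanishing on the
    plane of u and Y u. They are independent because Y^T has no eigenvector either. *)
Lemma krylov_unit (u : 'cV_3) : u != 0 ->
  (row_mx u (row_mx (Y *m u) (Y *m (Y *m u))) : 'M_3) \in unitmx.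
Proof.
move=> u0; set K := row_mx u _; rewrite -unitmx_tr; apply: contraT => /singular_vector[l l0 Kl].
have K0 : l^T *m K = 0 by rewrite -[K]trmxK -trmx_mul Kl trmx0.
have [[k e]|r2] := indep_cols (Y *m u) u0; first by rewrite (noeig e) eqxx in u0.
have : row_mx (l^T *m u) (row_mx (l^T *m (Y *m u)) (l^T *m (Y *m (Y *m u)))) = 0 by move: K0; rewrite /K !mul_mx_row.
rewrite -[0 in RHS]row_mx0 => /eq_row_mx[lu]; rewrite -[0 in RHS]row_mx0 => /eq_row_mx[lYu lYYu].
have [[k e]|r2'] := indep_cols (Y^T *m l) l0.
  have : Y - k%:M \notin unitmx.
    rewrite -unitmx_tr; apply/negP => h; have : (Y - k%:M)^T *m l = 0.
      by rewrite linearB /= tr_scalar_mx mulmxBl mul_scalar_mx e subrr.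
    by move/(unit_kernel h)=> e0; rewrite e0 eqxx in l0.
  case/singular_vector => v v0; rewrite mulmxBl mul_scalar_mx => /eqP; rewrite subr_eq0 => /eqP/noeig e0.
  by rewrite e0 eqxx in v0.
have := kill_rank (N := (row_mx l (Y^T *m l))^T) (u := u) (w := Y *m u).
rewrite mxrank_tr r2' tr_row_mx !mul_col_mx lu lYu trmx_mul trmxK -!mulmxA lYu lYYu col_mx0.
by move=> /(_ erefl erefl r2).
Qed.

(** N agrees with some polynomial in Y at u; the difference commutes with Y and is singular, hence
    zero. *)
Lemma commutant_poly N : Y *m N = N *m Y -> exists a b c, N = a%:M + b *: Y + c *: (Y *m Y).
Proof.
move=> YN; pose u : 'cV[F]_3 := delta_mx 0 0.
have u0 : u != 0 by apply/eqP => /matrixP/(_ 0 0)/eqP; rewrite !mxE eqxx oner_eq0.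
have uK := krylov_unit u0; set K := row_mx u _ in uK.
have Kw : K *m (invmx K *m (N *m u)) = N *m u by rewrite mulKVmx.
have [a [b [c e]]] := mul_row3 u (Y *m u) (Y *m (Y *m u)) (invmx K *m (N *m u)).
exists a, b, c; apply/eqP; rewrite -subr_eq0; apply: contraT => N0.
have [] : (N - (a%:M + b *: Y + c *: (Y *m Y)) \in unitmx) /\ (N - (a%:M + b *: Y + c *: (Y *m Y))) *m u = 0.
  split.
    apply: commutant_unit N0; rewrite mulmxBr mulmxBl YN; congr (_ - _).
    by rewrite !mulmxDr !mulmxDl -!scalemxAr -!scalemxAl mulmxA scalar_mxC.
  by rewrite mulmxBl -Kw [X in X - _]e !mulmxDl mul_scalar_mx -!scalemxAl mulmxA subrr.
by move/unit_kernel => h /h e0; rewrite e0 eqxx in u0.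
Qed.

Lemma commutant_comm N N' : Y *m N = N *m Y -> Y *m N' = N' *m Y -> N *m N' = N' *m N.
Proof.
move=> /commutant_poly[a [b [c ->]]] YN; rewrite !mulmxDl !mulmxDr -!scalemxAl -!scalemxAr.
by rewrite scalar_mxC YN -mulmxA YN mulmxA YN mulmxA.
Qed.

Lemma commutant_noeig N : Y *m N = N *m Y -> ~~ is_scalar_mx N ->
  forall (v : 'cV_3) c, N *m v = c *: v -> v = 0.
Proof.
move=> YN nsc v c e; apply: (@unit_kernel _ _ (N - c%:M)); last by rewrite mulmxBl mul_scalar_mx e subrr.
apply: commutant_unit; first by rewrite mulmxBr mulmxBl YN scalar_mxC.
by apply: contra nsc; rewrite subr_eq0 => /eqP->; exact: scalar_mx_is_scalar.
Qed.

End Irreducible3.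

(** * Symmetrizers in dimension 3 *)

Section SymmetrizerDim3.
Local Open Scope ring_scope.
Variables (F : finFieldType) (gT : finGroupType) (rho : gT -> 'M[F]_3).
Hypotheses (rho1 : rho 1%g = 1%:M) (rhoM : forall g h, rho (g * h)%g = rho g *m rho h).
Hypotheses (rho_inj : injective rho) (ch2 : 2%N \in [pchar F]).
Local Notation q := #|F|.
Variable E : {group gT}.
Hypotheses (oE : odd #|E|) (ZE : forall c : F, c != 0 -> exists2 z, z \in E & rho z = c%:M).
Hypothesis symE : forall X : 'M[F]_3, X \in unitmx ->
  exists2 g, g \in E & (rho g *m X)^T = rho g *m X.
(** The inheritance from dimension 2, supplied by [symmetrizers_star]: on a stable plane, an element
    with an eigenvector is scalar. *)
Hypothesis star : forall h (u w : 'cV[F]_3) l a b, h \in E -> u != 0 -> rho h *m u = l *: u ->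
  rho h *m w = a *: u + b *: w -> rho h *m w = l *: w.
Hypothesis q4 : (4 <= q)%N.
Implicit Types (g h : gT) (u v w : 'cV[F]_3).

Local Notation Z := (scalars_group rho1 rhoM E).
Local Notation act := (lin_act rho1 rhoM).
Local Notation stab u := ('C_E[u | act]%g).

(** By [star] two eigenlines share an eigenvalue l, so h - l has rank 1. Its image is again an
    eigenline for l, and [star] on a plane through that line contradicts h - l being nonzero. *)
Lemma one_eigenline h u w l k : h \in E -> ~~ is_scalar_mx (rho h) -> u != 0 ->
  rho h *m u = l *: u -> rho h *m w = k *: w -> exists c, w = c *: u.
Proof.
move=> hE nsc u0 hu hw; have [//|r2] := indep_cols w u0.
have hw' : rho h *m w = l *: w by apply: (star hE u0 hu (a := 0) (b := k)); rewrite scale0r add0r.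
set N := rho h - l%:M; have NE v : rho h *m v = l *: v + N *m v.
  by rewrite mulmxBl mul_scalar_mx addrC subrK.
have ker v : rho h *m v = l *: v -> N *m v = 0 by move=> e; rewrite mulmxBl mul_scalar_mx e subrr.
have r1 : (\rank N <= 1)%N by rewrite -(leq_add2r 2) (kill_rank (ker _ hu) (ker _ hw') r2).
have N0 : N != 0.
  by apply: contra nsc; rewrite subr_eq0 => /eqP->; exact: scalar_mx_is_scalar.
have [z [Nz im]] := rank1_image r1 N0; have [c e] := im (N *m z).
have he : rho h *m (N *m z) = l *: (N *m z).
  by apply: (star hE u0 hu (a := 0) (b := l + c)); rewrite NE e scale0r add0r scalerDl.
have : rho h *m z = l *: z.
  by apply: (star hE Nz he (a := 1) (b := l)); rewrite NE scale1r addrC.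
by move/ker => e0; rewrite e0 eqxx in Nz.
Qed.

Definition line_stab u := [set g in E | [exists c, rho g *m u == c *: u]].

Lemma line_stabP u g : reflect (g \in E /\ exists c, rho g *m u = c *: u) (g \in line_stab u).
Proof.
rewrite inE; apply: (iffP andP) => -[gE]; first by case/existsP => c /eqP e; split=> //; exists c.
by case=> c e; split=> //; apply/existsP; exists c; apply/eqP.
Qed.

Lemma line_stab_group_set u : group_set (line_stab u).
Proof.
apply/group_setP; split; first by apply/line_stabP; split=> //; exists 1; rewrite rho1 mul1mx scale1r.
move=> g h /line_stabP[gE [c ec]] /line_stabP[hE [d ed]]; apply/line_stabP; split; first exact: groupM.
by exists (d * c); rewrite rhoM -mulmxA ed -scalemxAr ec scalerA.
Qed.
Canonical line_stab_group u := Group (line_stab_group_set u).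

Lemma line_stab_sub u : line_stab u \subset E.
Proof. by apply/subsetP => g /line_stabP[]. Qed.

Lemma scalars_line_stab u : Z \subset line_stab u.
Proof.
apply/subsetP => g /(scalarsP rho1 rhoM)[gE [c _ e]]; apply/line_stabP; split=> //.
by exists c; rewrite e mul_scalar_mx.
Qed.

Lemma eigenvalue_neq0 g u c : u != 0 -> rho g *m u = c *: u -> c != 0.
Proof.
move=> u0 e; apply: contra u0 => /eqP c0; rewrite -(rho_mul_eq0 rho1 rhoM g).
by rewrite e c0 scale0r.
Qed.

(** The line stabiliser is the product of the vector stabiliser and the scalars, which meet
    trivially. *)
Lemma card_line_stab u : u != 0 -> #|line_stab u| = (#|stab u| * q.-1)%N.
Proof.
move=> u0; rewrite -(card_scalars rho1 rhoM rho_inj ZE) -TI_cardMg; last first.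
  apply/trivgP/subsetP => g /setIP[]; rewrite lin_astab1 => /andP[_ /eqP gu].
  case/(scalarsP rho1 rhoM) => _ [c _ e]; rewrite inE; apply/eqP/rho_inj; rewrite rho1 e.
  move: gu; rewrite e mul_scalar_mx -{2}[u]scale1r => /eqP.
  by rewrite -subr_eq0 -scalerBl scaler_eq0 (negbTE u0) orbF subr_eq0 => /eqP->.
apply: eq_card => g; apply/line_stabP/mulsgP => [[gE [c e]]|[h z]].
  have c0 := eigenvalue_neq0 u0 e; have [z zE ez] := ZE c0.
  exists (g * z^-1)%g z; last by rewrite mulgKV.
    rewrite lin_astab1 groupM ?groupV //=; apply/eqP; rewrite rhoM -mulmxA.
    have -> : rho z^-1%g *m u = c^-1 *: u.
      by apply: (rho_mul_inj rho1 rhoM (g := z)); rewrite (rhoKV rho1 rhoM) ez mul_scalar_mx scalerA divff // scale1r.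
    by rewrite -scalemxAr e scalerA mulVf // scale1r.
  by apply/(scalarsP rho1 rhoM); split=> //; exists c.
rewrite lin_astab1 => /andP[hE /eqP hu] /(scalarsP rho1 rhoM)[zE [c _ e]] ->.
by split; [exact: groupM|exists c; rewrite rhoM e -mulmxA mul_scalar_mx -scalemxAr hu].
Qed.

(* This odd group acts semiregularly on the q^3 - q vectors off the line of u. *)
Lemma line_stab_dvd u : u != 0 -> (#|line_stab u| %| q ^ 2 - 1)%N.
Proof.
move=> u0; have [n n0 qE] := card_pchar ch2.
have oT : odd #|line_stab u| := dvdn_odd (cardSg (line_stab_sub u)) oE.
(* Lets the factor q be dropped from q^3 - q. *)
have cop : coprime #|line_stab u| q by rewrite qE coprimeXr // coprimen2.
rewrite -(Gauss_dvdr _ cop) mulnBr muln1 -expnS.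
have -> : (q ^ 3 - q)%N = #|[set v : 'cV[F]_3 | ~~ [exists c, v == c *: u]]|.
  have := cardsC [set v : 'cV[F]_3 | [exists c, v == c *: u]]; rewrite card_mx muln1 => <-.
  have -> : #|[set v : 'cV[F]_3 | [exists c, v == c *: u]]| = q.
    rewrite -(@card_imset _ _ (fun c : F => c *: u)).
      apply: eq_card => v; rewrite inE; apply/existsP/imsetP => [[c /eqP]|[c _]] e; exists c; rewrite ?e //.
    move=> c d /eqP; rewrite -subr_eq0 -scalerBl scaler_eq0 (negbTE u0) orbF subr_eq0.
    by move/eqP.
  by rewrite addKn; apply: eq_card => v; rewrite !inE.
apply: (semiregular_dvd rho1 rhoM (E := line_stab_group u)) => g v gT0; rewrite !inE => nv.
  apply: contra nv => /existsP[c /eqP e]; apply/existsP.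
  have [gE [d ed]] := line_stabP _ _ gT0; have d0 := eigenvalue_neq0 u0 ed.
  exists (c / d); apply/eqP/(rho_mul_inj rho1 rhoM (g := g)).
  by rewrite e -scalemxAr ed scalerA divfK.
move=> gv; have [gE [d ed]] := line_stabP _ _ gT0.
have v0 : v != 0 by apply: contra nv => /eqP->; apply/existsP; exists 0; rewrite scale0r.
case: (boolP (is_scalar_mx (rho g))) => [/is_scalar_mxP[c ec]|nsc].
  apply: rho_inj; rewrite rho1 ec; move: gv; rewrite ec mul_scalar_mx -{2}[v]scale1r => /eqP.
  by rewrite -subr_eq0 -scalerBl scaler_eq0 (negbTE v0) orbF subr_eq0 => /eqP->.
case/existsP: nv; have [|c ->] := one_eigenline gE nsc u0 ed (w := v) (k := 1); last by exists c.
by rewrite scale1r.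
Qed.

(** [symmetrizer_count] with the order of GL_3(q) and at most q^6 symmetric matrices. *)
Lemma card_lower : (q.-1 ^ 2 * (q ^ 2 - 1) * (q ^ 3 - 1) <= #|E| * q ^ 3)%N.
Proof.
have := symmetrizer_count rho1 rhoM ZE symE.
have cS : (#|invsym F 2| <= q ^ 6)%N.
  have -> : (q ^ 6 = #|{: ('cV[F]_3 * 'cV[F]_2) * F}|)%N by rewrite !card_prod !card_mx !muln1 -expnD -expnSr.
  rewrite -(@card_in_imset _ _ (fun S : 'M[F]_3 => (col 0 S, (\col_(i < 2) S (lift 0 i) 1), S 2%:R 2%:R))) ?max_card //.
  move=> S S'; rewrite !inE => /andP[/eqP sS _] /andP[/eqP sS' _] [/matrixP e0 /matrixP e1 e2].
  have sy (X : 'M[F]_3) i j : X^T = X -> X i j = X j i by move=> e; rewrite -[in LHS]e mxE.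
  have c0 i : S i 0 = S' i 0 by have := e0 i 0; rewrite !mxE.
  have c1 i : S i 1 = S' i 1.
    have [j ->|->] := unliftP 0 i; first by have := e1 j 0; rewrite !mxE.
    by rewrite (sy S) // (sy S') // c0.
  apply/matrixP => i j.
  have : [\/ j = 0, j = 1 | j = 2%:R] by case: j => [[|[|[|]]]] // ?; [constructor 1|constructor 2|constructor 3]; exact: val_inj.
  case=> ->; rewrite ?c0 ?c1 //.
  have : [\/ i = 0, i = 1 | i = 2%:R] by case: i => [[|[|[|]]]] // ?; [constructor 1|constructor 2|constructor 3]; exact: val_inj.
  by case=> ->; rewrite ?e2 // (sy S) // (sy S') // ?c0 ?c1.
rewrite card_unitmx card_GL // big_nat_recr //= big_nat_recr //= big_nat1 expn1.
move/leq_trans => /(_ _ (leq_mul (leqnn _) cS)).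
have -> : 'C(3, 2) = 3%N by [].
have q0 : (0 < q ^ 3)%N by rewrite expn_gt0 (leq_trans _ q4).
have -> : (q ^ 6 = q ^ 3 * q ^ 3)%N by rewrite -expnD.
rewrite (subn1 q) => h; rewrite -(leq_pmul2r q0) -[X in (_ <= X)%N]mulnA; apply: leq_trans h.
by move: (q.-1) (q ^ 3)%N (q ^ 2 - 1)%N (q ^ 3 - 1)%N => w x y z; clear; rewrite -mulnn; lia.
Qed.

(** The source of the condition q >= 4: the inequality fails at q = 2. *)
Lemma cube_bound : (q ^ 3 < 3 * q.-1 ^ 3)%N.
Proof. by move: q4; move: (q) => z; case: z => [|[|[|[|r]]]] // _; rewrite !expnS expn0 !muln1 -[_.-1]/(r.+3); nia. Qed.

Let qm1 : (q ^ 2 - 1 = q.-1 * q.+1)%N.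
Proof. by move: q4; move: (q) => z; case: z => [|r] // _; rewrite -[_.-1]/r; nia. Qed.

Let cube_pred : (q ^ 3 - 1 = q.-1 * (q ^ 2 + q + 1))%N.
Proof.
by move: q4; move: (q) => z; case: z => [|r] // _; rewrite -[_.-1]/r !expnS expn0 !muln1; lia.
Qed.

Let odd_q : ~~ odd q.
Proof. by have [n n0 ->] := card_pchar ch2; rewrite oddX; case: (n) n0. Qed.

(** The order divides q + 1 with odd quotient k, and k >= 3 would make |E| too small for
    [card_lower], by [cube_bound]. *)
Lemma card_stab u : u != 0 -> #|stab u| = q.+1.
Proof.
move=> u0; have := line_stab_dvd u0; rewrite card_line_stab // qm1 mulnC dvdn_pmul2l ?ltn_predRL ?(leq_trans _ q4) //.
case/dvdnP => k e; have ok : odd k.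
  have : odd q.+1 by rewrite /= odd_q.
  by rewrite e oddM => /andP[].
have k3 : ~~ (3 <= k)%N.
  apply/negP => k3; have s3 : (3 * #|stab u| <= q.+1)%N by rewrite e leq_mul2r k3 orbT.
  have c1 : (#|E| <= #|stab u| * (q ^ 3 - 1))%N.
    have := card_orbit_stab act E u; rewrite mulnC => <-; rewrite leq_mul2l -(card_nonzero_vectors F 2).
    by rewrite subset_leq_card ?orbT // orbit_nonzero.
  have q0 : (0 < q ^ 3 - 1)%N by rewrite subn_gt0 -{1}(exp1n 3) ltn_exp2r // (leq_trans _ q4).
  have c2 : (q.-1 ^ 2 * (q.-1 * q.+1) <= #|stab u| * q ^ 3)%N.
    rewrite -(leq_pmul2r q0) -qm1 [X in (_ <= X)%N]mulnAC.
    exact: leq_trans card_lower (leq_mul c1 (leqnn (q ^ 3))).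
  have := leq_mul (leqnn 3) c2; rewrite [X in (_ <= X)%N]mulnA => /leq_trans/(_ (leq_mul s3 (leqnn _))).
  have -> : (3 * (q.-1 ^ 2 * (q.-1 * q.+1)) = q.+1 * (3 * q.-1 ^ 3))%N.
    by rewrite [(q.-1 ^ 3)%N]expnSr; move: (q.-1 ^ 2)%N (q.-1) (q.+1) => x y z; lia.
  by rewrite leq_pmul2l // leqNgt cube_bound.
have k1 : k = 1%N by case: k e ok k3 => [|[|[|]]].
by rewrite e k1 mul1n.
Qed.

(** All orbits on nonzero vectors have length |E| / (q + 1). Their number is odd, and three or more
    of them would again contradict [card_lower]. *)
Lemma transitive_card : #|E| = ((q ^ 3 - 1) * q.+1)%N /\
  forall u v, u != 0 -> v != 0 -> exists2 g, g \in E & rho g *m u = v.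
Proof.
pose S := [set v : 'cV[F]_3 | v != 0].
have actS : [acts E, on S | act]%g.
  apply/subsetP => g gE; rewrite !inE; apply/subsetP => v; rewrite !inE => v0.
  by rewrite /= /lin_to (rho_mul_eq0 rho1 rhoM).
have orbE u : u != 0 -> (#|orbit act E u| * q.+1 = #|E|)%N.
  by move=> u0; rewrite -(card_orbit_stab act E u) card_stab.
pose o := (#|E| %/ q.+1)%N.
have orbo u : u != 0 -> #|orbit act E u| = o by move=> u0; rewrite /o -(orbE u u0) mulnK.
have pS := orbit_partition actS.
have := card_uniform_partition (n := o) _ pS; rewrite (card_nonzero_vectors F 2) => e.
have {}e : (q ^ 3 - 1 = #|orbit act E @: S| * o)%N.
  by apply: e => x /imsetP[u]; rewrite inE => u0 ->; exact: orbo.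
set k := #|_| in e.
have ok : odd k.
  have : odd (q ^ 3 - 1) by rewrite oddB ?expn_gt0 ?(leq_trans _ q4) // oddX (negbTE odd_q).
  by rewrite e oddM => /andP[].
pose u1 : 'cV[F]_3 := delta_mx 0 0.
have u10 : u1 != 0 by apply/eqP => /matrixP/(_ 0 0)/eqP; rewrite !mxE eqxx oner_eq0.
have Eo : (#|E| = o * q.+1)%N by rewrite -(orbE u1 u10) orbo.
have q0 : (0 < q ^ 3 - 1)%N by rewrite subn_gt0 -{1}(exp1n 3) ltn_exp2r // (leq_trans _ q4).
have k3 : ~~ (3 <= k)%N.
  apply/negP => k3; have c1 : (3 * o <= q ^ 3 - 1)%N by rewrite e leq_mul2r k3 orbT.
  have := leq_mul (leqnn 3) card_lower; rewrite Eo qm1.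
  have -> : (3 * (o * q.+1 * q ^ 3) = (3 * o) * (q.+1 * q ^ 3))%N by rewrite !mulnA.
  move=> /leq_trans/(_ (leq_mul c1 (leqnn _))).
  have -> : (3 * (q.-1 ^ 2 * (q.-1 * q.+1) * (q ^ 3 - 1)) = (q ^ 3 - 1) * (q.+1 * (3 * q.-1 ^ 3)))%N.
    by rewrite [(q.-1 ^ 3)%N]expnSr; move: (q.-1 ^ 2)%N (q.-1) (q.+1) (q ^ 3 - 1)%N => x y z w; lia.
  by rewrite leq_pmul2l // leq_pmul2l // leqNgt cube_bound.
have k1 : k = 1%N by case: k e ok k3 => [|[|[|]]].
have oE' : o = (q ^ 3 - 1)%N by rewrite e k1 mul1n.
split=> [|u v u0 v0]; first by rewrite Eo oE'.
have : orbit act E u == S.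
  by rewrite eqEcard (orbit_nonzero rho1 rhoM) //= (card_nonzero_vectors F 2) orbo // oE'.
move/eqP/setP/(_ v); rewrite inE v0 => /imsetP[g gE ->].
by exists g^-1%g; rewrite ?groupV.
Qed.

Lemma scalarsJ z g : (z ^ g \in Z)%g -> (z ^ g)%g = z.
Proof.
move=> zZ; have e : ((z ^ g) ^ g^-1 = z ^ g)%g.
  by apply/conjg_fixP/commgP; exact: (scalars_comm rho1 rhoM rho_inj _ zZ).
by rewrite -[RHS](conjgK g) e.
Qed.

Let u1 : 'cV[F]_3 := delta_mx 0 0.
Let u10 : u1 != 0. Proof. by apply/eqP => /matrixP/(_ 0 0)/eqP; rewrite !mxE eqxx oner_eq0. Qed.
Let q1 : (1 < q)%N. Proof. exact: leq_trans q4. Qed.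

Lemma nonscalar g : g \in E -> g \notin Z -> ~~ is_scalar_mx (rho g).
Proof. by move=> gE; apply: contra => sc; rewrite inE gE. Qed.

Lemma rhoJ g h v : rho (g ^ h)%g *m v = rho h^-1%g *m (rho g *m (rho h *m v)).
Proof. by rewrite conjgE !rhoM -!mulmxA. Qed.

(** A nonscalar element has at most one eigenline, so only elements stabilising that line can
    conjugate it back into the stabiliser. *)
Lemma line_stab_TI : normedTI (line_stab u1 :\: Z) E (line_stab_group u1).
Proof.
apply/normedTI_memJ_P; split; last 1 first.
- move=> a g /setDP[aT aZ] gE; have aE := subsetP (line_stab_sub u1) _ aT.
  have [_ [c ac]] := line_stabP _ _ aT.
  apply/idP/idP => [/setDP[/line_stabP[_ [d ad]] _]|gT0].
    apply/line_stabP; split=> //.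
    apply: (one_eigenline aE (nonscalar aE aZ) u10 ac (k := d)).
    by apply: (rho_mul_inj rho1 rhoM (g := g^-1%g)); rewrite -rhoJ ad -scalemxAr (rhoVK rho1 rhoM).
  apply/setDP; split; first exact: (groupJ (G := line_stab_group u1)).
  by apply: contra aZ => h; rewrite -(scalarsJ h).
- rewrite -card_gt0 cardsD (setIidPr (scalars_line_stab u1)) card_line_stab // card_stab //.
  rewrite (card_scalars rho1 rhoM rho_inj ZE) subn_gt0.
  by apply: ltn_Pmull; [rewrite ltnS ltnW|rewrite ltn_predRL].
- exact: line_stab_sub.
Qed.

Definition eigenless g := forall v c, rho g *m v = c *: v -> v = 0.

Lemma eigenlessJ g h : eigenless g -> eigenless (g ^ h)%g.
Proof.
move=> ng v c; rewrite rhoJ => e; apply: (rho_mul_inj rho1 rhoM (g := h)); rewrite mulmx0.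
by apply: (ng _ c); rewrite scalemxAr -e (rhoKV rho1 rhoM).
Qed.

Section Eigenless.
Variable y : gT.
Hypotheses (yE : y \in E) (ny : eigenless y).
Local Notation T := ('C_E[y]%g).

Lemma eigenless_notin_scalars g : eigenless g -> g \notin Z.
Proof.
move=> ng; apply/negP => /(scalarsP rho1 rhoM)[_ [c _ e]].
by have := u10; rewrite (@ng u1 c) ?eqxx // e mul_scalar_mx.
Qed.

Lemma cent_commute z : z \in T -> rho y *m rho z = rho z *m rho y.
Proof. by case/setIP => _ /cent1P e; rewrite -!rhoM e. Qed.

Lemma cent_eigenless z : z \in T :\: Z -> eigenless z.
Proof.
case/setDP => zT zZ; apply: (commutant_noeig ny (cent_commute zT)).
by apply: nonscalar zZ; case/setIP: zT.
Qed.

Lemma cent_comm z (w : gT) : z \in T -> w \in T -> rho z *m rho w = rho w *m rho z.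
Proof. by move=> zT wT; apply: (commutant_comm ny); exact: cent_commute. Qed.

End Eigenless.

(** The commutant of a matrix without eigenvector is commutative, and its nonscalar elements have no
    eigenvector either. *)
Lemma cent_eq y z : y \in E -> eigenless y -> z \in 'C_E[y]%g :\: Z -> 'C_E[z]%g = 'C_E[y]%g.
Proof.
move=> yE ny zA; have nz := cent_eigenless ny zA; case/setDP: (zA) => zT zZ.
have zE : z \in E by case/setIP: zT.
have yz : y \in 'C_E[z]%g by rewrite inE yE cent1C; case/setIP: zT.
apply/setP => w; apply/idP/idP => wT; have wE := subsetP (subsetIl _ _) _ wT; rewrite inE wE;
  apply/cent1P/rho_inj; rewrite !rhoM.
  by rewrite (cent_comm nz yz wT).
by rewrite (cent_comm ny zT wT).
Qed.

(* The conjugates of y in its commutative centralizer are roots of the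
   characteristic polynomial of y. *)
Lemma cent_norm_index y : y \in E -> eigenless y -> (#|'N_E('C_E[y]) : 'C_E[y]|%g <= 3)%N.
Proof.
move=> yE ny; set T := 'C_E[y]%G; set N := 'N_E(T)%G.
have yT : y \in T by rewrite inE yE cent1id.
have sTN : T \subset N by rewrite subsetI subsetIl normG.
have CN : 'C_N[y]%g = T.
  apply/eqP; rewrite eqEsubset; apply/andP; split; first by rewrite setSI // subsetIl.
  by apply/subsetP => w wT; rewrite inE (subsetP sTN) //=; case/setIP: wT.
have -> : #|N : T|%g = #|(y ^: N)%g| by rewrite -index_cent1 CN.
have sT : {subset (y ^: N)%g <= T}.
  by move=> _ /imsetP[g gN ->]; rewrite memJ_norm //; case/setIP: gN.
pose p := map_poly (@scalar_mx _ 3) (char_poly (rho y)).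
pose rs := [seq rho z | z <- enum (y ^: N)%g].
have p0 : p != 0 by rewrite map_poly_eq0 monic_neq0 ?char_poly_monic.
have sp : (size p <= 4)%N by apply: leq_trans (size_poly _ _) _; rewrite size_char_poly.
have : (size rs < size p)%N.
  apply: max_ring_poly_roots p0 _ _.
    apply/allP => _ /mapP[z + ->]; rewrite mem_enum => /imsetP[g gN ->].
    have e : invmx (rho g^-1%g) = rho g.
      by rewrite -[LHS]mul1mx -rho1 -(mulgV g) rhoM mulmxK // (rho_unit rho1 rhoM).
    have := horner_mx_uconj (char_poly (rho y)) (rho y) (rho_unit rho1 rhoM g^-1%g).
    rewrite Cayley_Hamilton mulmx0 mul0mx e -!rhoM -mulgA -conjgE => h.
    by apply/eqP; rewrite -[RHS]h.
  have : uniq (enum (y ^: N)%g) := enum_uniq _.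
  have : {subset enum (y ^: N)%g <= T} by move=> z; rewrite mem_enum => /sT.
  rewrite /rs; elim: (enum _) => //= z zs IH sub /andP[nz uz].
  have zT : z \in T by apply: sub; rewrite inE eqxx.
  rewrite IH //; last by move=> w wz; apply: sub; rewrite inE wz orbT.
  rewrite andbT; apply/allP => _ /mapP[w wz ->].
  have wT : w \in T by apply: sub; rewrite inE wz orbT.
  rewrite /diff_roots; apply/andP; split; first by apply/eqP; exact: (cent_comm ny zT wT).
  apply: (commutant_unit ny).
    by rewrite mulmxBr mulmxBl !(cent_commute (y := y)).
  by rewrite subr_eq0 (inj_eq rho_inj); apply: contraNneq nz => <-.
rewrite size_map -cardE => h; by have := leq_trans h sp.
Qed.

Lemma cent_TI y : y \in E -> eigenless y -> normedTI ('C_E[y]%g :\: Z) E 'N_E('C_E[y])%G.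
Proof.
move=> yE ny; apply/normedTI_P; split.
- apply/set0Pn; exists y; apply/setDP; split; first by rewrite inE yE cent1id.
  exact: eigenless_notin_scalars.
- rewrite subsetI subsetIl normsD ?subsetIr //; apply: subset_trans (subsetIl _ _) _.
  apply: cents_norm; apply/centsP => g _ z zZ; apply: commute_sym.
  exact: (scalars_comm rho1 rhoM rho_inj _ zZ).
move=> g gE /pred0Pn[z /andP[zA /imsetP[w wA zE]]].
have e : ('C_E[y] :^ g = 'C_E[y])%g.
  rewrite -[in RHS](cent_eq yE ny zA) zE cent1J -[in RHS](conjGid gE) -conjIg.
  by rewrite (cent_eq yE ny wA).
by rewrite inE gE; apply/normP.
Qed.

Lemma card_line_class :
  #|class_support (line_stab u1 :\: Z) E| = (q.-1 * q * (q ^ 2 + q + 1))%N.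
Proof.
have [cE _] := transitive_card.
rewrite (card_support_normedTI line_stab_TI) cardsD (setIidPr (scalars_line_stab u1)).
rewrite card_line_stab // card_stab // (card_scalars rho1 rhoM rho_inj ZE); congr (_ * _)%N.
  by rewrite mulSn addnC addnK mulnC.
have := Lagrange (line_stab_sub u1 : line_stab_group u1 \subset E).
rewrite /= card_line_stab // card_stab // cE => h.
have p0 : (0 < q.+1 * q.-1)%N by rewrite muln_gt0 ltn_predRL q1.
apply/eqP; rewrite -(eqn_pmul2l p0) h cube_pred; apply/eqP.
by move: (q.-1) (q.+1) (q ^ 2 + q + 1)%N => a b d; lia.
Qed.

(** By transitivity the other elements are scalar or conjugate into one line stabiliser. With s =
    q^2 + q + 1 they number (q - 1)(1 + q s), fewer than |E| = (q - 1)(q + 1) s. *)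
Lemma eigenless_exists : exists2 y, y \in E & eigenless y.
Proof.
have [cE trans] := transitive_card.
have [y yE] : exists2 y, y \in E & y \notin Z :|: class_support (line_stab u1 :\: Z) E.
  apply/subsetPn; apply/negP => /subset_leq_card/leq_trans/(_ (leq_card_setU _ _)).
  rewrite (card_scalars rho1 rhoM rho_inj ZE) card_line_class cE.
  move: q4; move: (q) => z; case: z => [|r] // r4; rewrite -[_.-1]/r !expnS expn0 !muln1.
  by move: r4; clear; nia.
rewrite inE negb_or => /andP[yZ yA]; exists y => // v c e; apply/eqP; apply: contraNT yA => v0.
have [g gE gv] := trans u1 v u10 v0.
rewrite -(conjgK g y); apply: memJ_class_support; last by rewrite groupV.
apply/setDP; split.
  apply/line_stabP; split; first exact: groupJ.
  by exists c; rewrite rhoJ gv e -scalemxAr -gv (rhoVK rho1 rhoM).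
by apply: contra yZ => h; rewrite -(scalarsJ h).
Qed.

(* The conjugates of the line stabilisers and of a centralizer C_E[y], y without
   eigenvector, are disjoint up to scalars and too numerous for |E|. *)
Lemma symmetrizers_dim3 : False.
Proof.
have [cE _] := transitive_card; have [y yE ny] := eigenless_exists.
pose A := line_stab u1 :\: Z; pose B := 'C_E[y]%g :\: Z.
have sZT : Z \subset 'C_E[y]%g.
  apply/subsetP => z zZ; have [zE _] := scalarsP rho1 rhoM E z zZ.
  by rewrite inE zE; apply/cent1P; exact: (scalars_comm rho1 rhoM rho_inj _ zZ).
have eB b : b \in class_support B E -> eigenless b.
  case/imset2P => c g cB _ ->; apply: eigenlessJ; apply: (cent_eigenless ny); exact: cB.
have sub : Z :|: class_support A E :|: class_support B E \subset E.
  rewrite !subUset; apply/andP; split; first apply/andP; first split.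
  - by apply/subsetP => z /(scalarsP rho1 rhoM)[].
  - by apply: class_support_subG => //; apply: subset_trans (subsetDl _ _) (line_stab_sub _).
  - by apply: class_support_subG => //; apply: subset_trans (subsetDl _ _) (subsetIl _ _).
have disB : (Z :|: class_support A E) :&: class_support B E = set0.
  apply/setP => b; rewrite in_set0 in_setI in_setU; apply/negbTE/negP => /andP[+ /eB nb].
  rewrite (negbTE (eigenless_notin_scalars nb)) /= => /imset2P[a g /setDP[/line_stabP[_ [c ac]] _] _ e].
  have := nb (rho g^-1%g *m u1) c; rewrite e rhoJ (rhoKV rho1 rhoM) ac scalemxAr => /(_ erefl)/eqP.
  by rewrite (rho_mul_eq0 rho1 rhoM) (negbTE u10).
have disA : Z :&: class_support A E = set0.
  apply/setP => b; rewrite in_set0 in_setI; apply/negbTE/negP => /andP[bZ /imset2P[a g /setDP[_ aZ] _ e]].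
  by move: bZ; rewrite e => h; case/negP: aZ; rewrite -(scalarsJ h).
have := subset_leq_card sub; rewrite cardsU disB cards0 subn0 cardsU disA cards0 subn0.
rewrite card_line_class (card_support_normedTI (cent_TI yE ny)) cardsD (setIidPr sZT).
rewrite (card_scalars rho1 rhoM rho_inj ZE) cE cube_pred.
have /dvdnP[j ej] : (q.-1 %| #|'C_E[y]%g|)%N.
  by rewrite -(card_scalars rho1 rhoM rho_inj ZE); exact: (cardSg sZT).
(* j is odd, and it is not 1 because y is a nonscalar element of its own centraliser. *)
have j3 : (3 <= j)%N.
  have : odd j.
    have : odd #|'C_E[y]%g| := dvdn_odd (cardSg (subsetIl _ _)) oE.
    by rewrite ej oddM => /andP[].
  have : j != 1%N.
    apply/eqP => j1; have : Z == 'C_E[y]%g :> {set gT}.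
      by rewrite eqEcard sZT ej j1 mul1n (card_scalars rho1 rhoM rho_inj ZE) leqnn.
    move/eqP => e; have := eigenless_notin_scalars ny; rewrite e inE yE.
    by move/cent1P; case.
  by case: (j) => [|[|[|]]].
have := Lagrange (subsetIl E 'N('C_E[y])%g); rewrite cE cube_pred.
rewrite -(Lagrange (_ : 'C_E[y] \subset 'N_E('C_E[y]))%g); last by rewrite subsetI subsetIl normG.
have := cent_norm_index yE ny; rewrite ej.
set n := #|_ : _|%g; set d := #|_ : _|%g => n3 e1.
have r0 : (0 < q.-1)%N by rewrite ltn_predRL.
have e2 : (j * n * d = (q ^ 2 + q + 1) * q.+1)%N.
  by apply/eqP; rewrite -(eqn_pmul2l r0); apply/eqP; move: e1; clear; lia.
set s := (q ^ 2 + q + 1)%N in e2 *.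
have -> : (j * q.-1 - q.-1 = q.-1 * j.-1)%N by rewrite -(subn1 j) mulnBr muln1 (mulnC j).
rewrite -[X in (X + _ + _ <= _)%N]muln1 -!mulnA -!mulnDr leq_pmul2l // => le.
(* From n <= 3 and q + 1 >= 5 follows j d >= 5 s / 3, hence (j - 1) d >= 10 s / 9, whereas [le]
   leaves at most s - 1. *)
have e3 : (5 * s <= 3 * (j * d))%N.
  have : (j * n * d <= j * 3 * d)%N by rewrite !leq_mul.
  rewrite e2; have : (s * 5 <= s * q.+1)%N by rewrite leq_mul.
  by move: (j * d)%N (s * q.+1)%N (mulnAC j 3 d) => a b ->; clear; lia.
have e4 : (2 * (j * d) <= 3 * (j.-1 * d))%N.
  by rewrite !mulnA leq_mul2r; apply/orP; right; move: j3; clear; lia.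
move: le e3 e4; rewrite mulnS [(q * s)%N]mulnC; move: (j * d)%N (j.-1 * d)%N (s * q)%N => a b c'; clear; lia.
Qed.

End SymmetrizerDim3.

Section PrimeOrderElements.
Local Open Scope group_scope.
Variables (gT : finGroupType) (E : {group gT}) (y : gT).
Hypotheses (yE : y \in E) (pr_y : prime #[y]).

(** The quotient embeds in the automorphism group of <[y]>, of order #[y] - 1. *)
Lemma norm_cent_index : #|'N_E(<[y]>) : 'C_E[y]| %| #[y].-1.
Proof.
have <- : #|Aut <[y]>| = #[y].-1 by rewrite card_Aut_cycle totient_prime.
have -> : #|'N_E(<[y]>) : 'C_E[y]| = #|conj_aut <[y]> @* 'N_E(<[y]>)|.
  rewrite card_morphim ker_conj_aut (setIidPr (subsetIr _ _)) -[RHS]indexgI.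
  by rewrite -setIA (setIidPr (cent_sub _)) cent_cycle.
exact: cardSg (Aut_conj_aut _ _).
Qed.

Lemma prime_cycle_gen w : w \in <[y]>^# -> <[w]> = <[y]>.
Proof. by move=> wy; rewrite -(nt_gen_prime (G := <[y]>%G) _ wy). Qed.

Lemma prime_cycle_norm g w : g \in E -> w \in <[y]>^# -> w ^ g \in <[y]> -> g \in 'N_E(<[y]>).
Proof.
move=> gE wy wg; rewrite inE gE; apply/normP.
rewrite -(prime_cycle_gen wy) -cycleJ (prime_cycle_gen wy); apply: prime_cycle_gen.
rewrite inE wg andbT inE -(conj1g g) (inj_eq (conjg_inj g)).
by case/setD1P: wy.
Qed.

Lemma prime_cycle_normedTI : normedTI <[y]>^# E 'N_E(<[y]>)%G.
Proof.
apply/normedTI_memJ_P; split; last 1 first.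
- move=> w g wy gE; apply/idP/idP => [/setD1P[_ wg]|/setIP[_ gN]].
    exact: prime_cycle_norm wy wg.
  by rewrite memJ_norm // normD1.
- apply/set0Pn; exists y; rewrite !inE cycle_id andbT -order_gt1.
  exact: prime_gt1.
exact: subsetIl.
Qed.

End PrimeOrderElements.

(** * Odd-order subgroups of GL_4(2) *)

Section OddGL42.
Local Open Scope ring_scope.
Variables (F : finFieldType) (gT : finGroupType) (rho : gT -> 'M[F]_4).
Hypotheses (rho1 : rho 1%g = 1%:M) (rhoM : forall g h, rho (g * h)%g = rho g *m rho h).
Hypotheses (rho_inj : injective rho) (F2 : #|F| = 2%N).
Implicit Types (g h c y : gT) (v : 'cV[F]_4) (E : {group gT}).

Definition fixed_vectors g := [set v : 'cV[F]_4 | (v != 0) && (rho g *m v == v)].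

Lemma fixed_vectorsP g v : reflect (v != 0 /\ rho g *m v = v) (v \in fixed_vectors g).
Proof. by rewrite inE; apply: (iffP andP) => -[-> /eqP]. Qed.

Lemma card_fixed_vectors g : exists2 d, (d <= 4)%N & #|fixed_vectors g|.+1 = (2 ^ d)%N.
Proof.
pose K := kermx (rho g - 1%:M)^T; exists (\rank K); first exact: rank_leq_row.
have := card_rowg K; rewrite F2 => <-; rewrite [RHS](cardsD1 0) inE sub0mx add1n; congr _.+1.
rewrite -(card_imset _ (@trmx_inj _ _ _)); apply: eq_card => u; apply/imsetP/setD1P => [[v /fixed_vectorsP[v0 gv] ->]|[u0]].
  rewrite -trmx0 (inj_eq trmx_inj); split=> //; rewrite inE; apply/sub_kermxP.
  by rewrite -trmx_mul mulmxBl gv mul1mx subrr trmx0.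
rewrite inE => /sub_kermxP/(congr1 trmx); rewrite trmx_mul trmxK trmx0 mulmxBl mul1mx => /eqP.
rewrite subr_eq0 => /eqP gu; exists u^T; last by rewrite trmxK.
by apply/fixed_vectorsP; rewrite gu -trmx0 (inj_eq trmx_inj).
Qed.

Lemma fixed_vectors_full g : #|fixed_vectors g| = 15%N -> g = 1%g.
Proof.
move=> c15; apply: rho_inj; rewrite rho1; apply: mulmx_ext => v; rewrite mul1mx.
have [->|v0] := eqVneq v 0; first by rewrite mulmx0.
have : fixed_vectors g == [set v | v != 0].
  rewrite eqEcard (card_nonzero_vectors F 3) F2 c15 leqnn andbT.
  by apply/subsetP => w /fixed_vectorsP[w0 _]; rewrite inE.
by move/eqP/setP/(_ v); rewrite !inE v0 /= => /eqP.
Qed.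

Lemma fixed_vectors_mod y (S : {set 'cV[F]_4}) : prime #[y]%g ->
  (forall v, v \in S -> v != 0) -> (forall g v, g \in <[y]>%g -> v \in S -> rho g *m v \in S) ->
  #|S| = #|[set v in S | rho y *m v == v]| %[mod #[y]%g].
Proof.
move=> pr_y S0 yS; have act : [acts <[y]>%g, on S | lin_act rho1 rhoM]%g.
  apply/subsetP => g gy; rewrite !inE; apply/subsetP => v vS; rewrite inE /=.
  by apply: yS; rewrite ?groupV.
have pg : (#[y].-group <[y]>)%g by rewrite /pgroup -orderE pnat_id.
rewrite (pgroup_fix_mod pg act); congr (_ %% _)%N.
apply: eq_card => v; rewrite in_setI afix_cycle ?in_setT // [RHS]inE; congr (_ && _).
apply/afix1P/eqP => /= [|e]; rewrite /lin_to; last by rewrite -{1}e (rhoVK rho1 rhoM).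
by move=> e; rewrite -{1}e (rhoKV rho1 rhoM).
Qed.

(** The cyclic group of y acts on the fixed vectors of c, and its orbits have length 1 or #[y]. *)
Lemma fixed_vectors_cent y c : prime #[y]%g -> commute c y ->
  #|fixed_vectors c| = #|fixed_vectors c :&: fixed_vectors y| %[mod #[y]%g].
Proof.
move=> pr_y cy; rewrite (fixed_vectors_mod (S := fixed_vectors c) pr_y).
- congr (_ %% _)%N; apply: eq_card => v; rewrite !inE.
  by case: (v != 0) => //=.
- by move=> v /fixed_vectorsP[].
move=> g v /cycleP[i ->] /fixed_vectorsP[v0 cv]; apply/fixed_vectorsP; split.
  by rewrite (rho_mul_eq0 rho1 rhoM).
by rewrite mulmxA -rhoM (commuteX i cy) rhoM -mulmxA cv.
Qed.

Lemma fixed_vectors_order y : prime #[y]%g -> 15 = #|fixed_vectors y| %[mod #[y]%g].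
Proof.
move=> pr_y; have := fixed_vectors_cent pr_y (commute_sym (commute1 y)).
have -> : fixed_vectors 1%g = [set v | v != 0].
  by apply/setP => v; rewrite !inE rho1 mul1mx eqxx andbT.
rewrite (card_nonzero_vectors F 3) F2 => ->; congr (_ %% _)%N; apply: eq_card => v.
by rewrite !inE; case: (v != 0).
Qed.

(** The number of fixed vectors is 2^d - 1 < 15 and congruent to 15 modulo 5, which leaves 0; modulo
    7 the same reasoning leaves 1. *)
Lemma fixed_vectors5 y : #[y]%g = 5%N -> #|fixed_vectors y| = 0%N.
Proof.
move=> oy; have := @fixed_vectors_order y; rewrite oy => /(_ isT).
have [d d4 e] := card_fixed_vectors y; have y1 : y <> 1%g by move=> e1; rewrite e1 order1 in oy.
have : #|fixed_vectors y| <> 15%N by move/fixed_vectors_full.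
by case: d d4 e => [|[|[|[|[|]]]]] // _ [] ->.
Qed.

Lemma fixed_vectors7 y : #[y]%g = 7%N -> #|fixed_vectors y| = 1%N.
Proof.
move=> oy; have := @fixed_vectors_order y; rewrite oy => /(_ isT).
have [d d4 e] := card_fixed_vectors y; have y1 : y <> 1%g by move=> e1; rewrite e1 order1 in oy.
have : #|fixed_vectors y| <> 15%N by move/fixed_vectors_full.
by case: d d4 e => [|[|[|[|[|]]]]] // _ [] ->.
Qed.

Variable E : {group gT}.
Hypothesis oE : odd #|E|.

(** An element commuting with y has a multiple of 5 fixed vectors. If there is one, there are 15, so
    the centraliser acts semiregularly on the 15 nonzero vectors. *)
Lemma card_cent5 y : y \in E -> #[y]%g = 5%N -> (#|'C_E[y]%g| %| 15)%N.
Proof.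
move=> yE oy; have -> : 15%N = #|[set v : 'cV[F]_4 | v != 0]| by rewrite (card_nonzero_vectors F 3) F2.
apply: (semiregular_dvd rho1 rhoM) => g v /setIP[_ /cent1P gy]; rewrite !inE => v0.
  by rewrite (rho_mul_eq0 rho1 rhoM).
move=> gv; have := @fixed_vectors_cent y g; rewrite oy => /(_ isT gy).
rewrite [_ :&: _](_ : _ = set0) ?cards0; last first.
  by apply/eqP; rewrite -subset0 -(cards0_eq (fixed_vectors5 oy)) subsetIr.
have [d d4 e] := card_fixed_vectors g.
have : #|fixed_vectors g| <> 0%N by move/cards0_eq/setP/(_ v); rewrite !inE v0 gv eqxx.
have := @fixed_vectors_full g.
by case: d d4 e => [|[|[|[|[|]]]]] // _ [] -> // ->.
Qed.

(** The centraliser fixes the one vector u fixed by y. An element fixing a second vector has more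
    than one and 1 modulo 7 fixed vectors, hence all 15. So the order divides 14, and it is odd and
    divisible by 7. *)
Lemma card_cent7 y : y \in E -> #[y]%g = 7%N -> #|'C_E[y]%g| = 7%N.
Proof.
move=> yE oy; have /eqP/cards1P[u uE] := fixed_vectors7 oy.
have : u \in fixed_vectors y by rewrite uE set11.
case/fixed_vectorsP => u0 yu.
have d14 : (#|'C_E[y]%g| %| 14)%N.
  have -> : 14%N = #|[set v : 'cV[F]_4 | v != 0] :\ u|.
    have := cardsD1 u [set v : 'cV[F]_4 | v != 0].
    by rewrite (card_nonzero_vectors F 3) F2 inE u0 => -[].
  have fu g : g \in 'C_E[y]%g -> rho g *m u = u.
    case/setIP => _ /cent1P gy; apply/set1P; rewrite -uE; apply/fixed_vectorsP; split.
      by rewrite (rho_mul_eq0 rho1 rhoM).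
    by rewrite mulmxA -rhoM -gy rhoM -mulmxA yu.
  apply: (semiregular_dvd rho1 rhoM) => g v gC; rewrite !inE => /andP[vu v0].
    rewrite (rho_mul_eq0 rho1 rhoM) v0 andbT -{1}(fu g gC).
    by rewrite (inj_eq (rho_mul_inj rho1 rhoM (g := g))).
  move=> gv; have gy : commute g y by case/setIP: gC => _ /cent1P.
  have := @fixed_vectors_cent y g; rewrite oy => /(_ isT gy).
  have -> : fixed_vectors g :&: fixed_vectors y = [set u].
    by rewrite uE; apply/setIidPr; rewrite sub1set; apply/fixed_vectorsP; rewrite fu.
  rewrite cards1; have [d d4 e] := card_fixed_vectors g.
  have : (1 < #|fixed_vectors g|)%N.
    apply: (@leq_trans #|[set u; v]|); first by rewrite cards2 eq_sym vu.
    apply/subset_leq_card/subsetP => w.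
    by rewrite !inE => /orP[]/eqP->; rewrite ?u0 ?v0 /= ?fu ?gv.
  have := @fixed_vectors_full g.
  by case: d d4 e => [|[|[|[|[|]]]]] // _ [] -> // ->.
have o : odd #|'C_E[y]%g| := dvdn_odd (cardSg (subsetIl _ _)) oE.
have d7 : (7 %| #|'C_E[y]%g|)%N.
  by rewrite -oy; apply: order_dvdG; rewrite inE yE cent1id.
apply/eqP; rewrite eqn_dvd d7 andbT -(@Gauss_dvdl _ 7 2) //.
by rewrite coprimen2.
Qed.

Lemma card_norm7 y : y \in E -> #[y]%g = 7%N -> (#|'N_E(<[y]>)%g| %| 21)%N.
Proof.
move=> yE oy; have sCN : 'C_E[y]%g \subset 'N_E(<[y]>)%g.
  by rewrite -cent_cycle setIS // cent_sub.
rewrite -(Lagrange sCN) card_cent7 // (@dvdn_pmul2l 7 _ 3) //.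
have := @norm_cent_index _ E y; rewrite oy => h.
have o : odd #|'N_E(<[y]>) : 'C_E[y]|%g.
  by apply: dvdn_odd oE; apply: dvdn_trans (dvdn_indexg _ _) (cardSg (subsetIl _ _)).
by rewrite -(@Gauss_dvdr _ 2 3) ?coprimen2 // (dvdn_trans (h isT)).
Qed.

Lemma norm_cent5 y : y \in E -> #[y]%g = 5%N -> 'N_E(<[y]>)%g = 'C_E[y]%g.
Proof.
move=> yE oy; have sCN : 'C_E[y]%g \subset 'N_E(<[y]>)%g.
  by rewrite -cent_cycle setIS // cent_sub.
apply/eqP; rewrite eq_sym eqEsubset sCN -indexg_eq1 /=.
have := @norm_cent_index _ E y; rewrite oy => h.
have o : odd #|'N_E(<[y]>) : 'C_E[y]|%g.
  by apply: dvdn_odd oE; apply: dvdn_trans (dvdn_indexg _ _) (cardSg (subsetIl _ _)).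
rewrite -dvdn1 -(Gauss_dvdr (m := #|_ : _|%g) (n := 4%N)) ?muln1 ?h //.
by rewrite (_ : 4 = 2 ^ 2)%N // coprimeXr // coprimen2.
Qed.

(* The elements conjugate to one whose cube generates a given subgroup of order 5
   would be at least 4/5 of E, those of order 7 at least 2/7. *)
Lemma odd_card_not35 : ~~ (35 %| #|E|)%N.
Proof.
apply/negP => d35.
have [||y yE oy] := @Cauchy _ 5 E => //; first exact: dvdn_trans d35.
have [||w wE ow] := @Cauchy _ 7 E => //; first exact: dvdn_trans d35.
have pr_y : prime #[y]%g by rewrite oy.
have pr_w : prime #[w]%g by rewrite ow.
have yC : y \in 'C_E[y]%g by rewrite inE yE cent1id.
have c15 c : c \in 'C_E[y]%g -> (c ^+ 15 = 1)%g.
  by move=> cC; apply/eqP; rewrite -order_dvdn; apply: dvdn_trans (card_cent5 yE oy); exact: order_dvdG.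
have nYC : (<[y]> <| 'C_E[y])%g.
  rewrite /normal cycle_subG yC /=; apply: cents_norm.
  by rewrite centsC cycle_subG; apply/centP => c; case/setIP => _ /cent1P.
have hYC : (5.-Sylow('C_E[y]) <[y]>)%g.
  rewrite pHallE cycle_subG yC /= -orderE oy.
  have d5 : (5 %| #|'C_E[y]%g|)%N by rewrite -oy order_dvdG.
  have d15 := card_cent5 yE oy; have : (#|'C_E[y]%g| \in divisors 15) by rewrite -dvdn_divisors.
  by rewrite p_part !inE => /or4P[] /eqP e; rewrite e in d5 *.
have cube c : c \in 'C_E[y]%g -> (c ^+ 3)%g \in <[y]>%g.
  move=> cC; rewrite (mem_normal_Hall hYC nYC) ?groupX //.
  by apply: (@pnat_dvd _ 5); rewrite ?pnat_id // order_dvdn -expgM c15.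
pose A := [set c in 'C_E[y]%g | (c ^+ 3 != 1)%g].
have TIA : normedTI A E 'C_E[y]%G.
  apply/normedTI_memJ_P; split; last 1 first.
  - move=> a g; rewrite inE => /andP[aC a3] gE; apply/idP/idP => [|gC].
      rewrite inE => /andP[agC _]; suff : g \in 'N_E(<[y]>)%g by rewrite (norm_cent5 yE oy).
      apply: (prime_cycle_norm pr_y gE (w := (a ^+ 3)%g)); first by rewrite !inE a3 cube.
      by rewrite conjXg cube.
    by rewrite inE groupJ // -conjXg -(conj1g g) (inj_eq (conjg_inj g)).
  - by apply/set0Pn; exists y; rewrite inE yC -order_dvdn oy.
  exact: subsetIl.
(* The elements of cube 1, multiplied by the five elements of <[y]>, give distinct elements, so they
   are at most a fifth of the centraliser. *)
have cA : (4 * #|'C_E[y]%g| <= 5 * #|A|)%N.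
  pose B := [set c in 'C_E[y]%g | (c ^+ 3 == 1)%g].
  have : (#|B| * 5 <= #|'C_E[y]%g|)%N.
    rewrite -{1}oy orderE -cardsX -(@card_in_imset _ _ (fun u : gT * gT => u.1 * u.2)%g).
      apply/subset_leq_card/subsetP => _ /imsetP[[c p] /setXP[cB py] ->] /=.
      rewrite inE in cB; case/andP: cB => cC _; rewrite groupM //.
      by apply: subsetP py; rewrite cycle_subG.
    move=> [c p] [d r] /setXP[+ py] /setXP[+ ry] /= e; rewrite [c \in B]inE [d \in B]inE => /andP[cC /eqP c3] /andP[dC /eqP d3].
    have com a b : a \in 'C_E[y]%g -> b \in <[y]>%g -> commute a b.
      by move=> /setIP[_ /cent1P ay] /cycleP[i ->]; exact: commuteX.
    have := congr1 (fun g => (g ^+ 3) ^+ 2)%g e; rewrite /= (expgMn _ (com c p cC py)).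
    rewrite (expgMn _ (com d r dC ry)) c3 d3 !mul1g -!expgM.
    have six a : a \in <[y]>%g -> (a ^+ (3 * 2) = a)%g.
      move=> ay; rewrite -[RHS]mul1g -[1%g](_ : (a ^+ 5 = 1)%g) -?expgSr //.
      by apply/eqP; rewrite -order_dvdn -oy order_dvdG.
    rewrite (six p) // (six r) // => pr; move: e; rewrite pr => /mulIg->.
    by [].
  have : (#|B| + #|A| = #|'C_E[y]%g|)%N.
    rewrite -(cardsID [set c | (c ^+ 3 == 1)%g] 'C_E[y]%g); congr (_ + _)%N; apply: eq_card => c.
      by rewrite !inE.
    by rewrite !inE andbC.
  by move: (#|B|) (#|A|) => b a <-; clear; lia.
have sub : class_support A E :|: class_support <[w]>^#%g E \subset E.
  rewrite subUset !class_support_subG // ?(subset_trans (subsetDl _ _)) ?cycle_subG //.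
  by apply/subsetP => c; rewrite inE => /andP[/setIP[]].
have dis : class_support A E :&: class_support <[w]>^#%g E = set0.
  apply/setP => z; rewrite in_set0 in_setI; apply/negbTE/negP => /andP[/imset2P[a g aA _ ->]].
  rewrite inE in aA; case/andP: aA => aC _ /imset2P[b h /setD1P[b1 bw] _ e].
  case/eqP: b1; have : (#[b]%g %| gcdn 15 7)%N.
    rewrite dvdn_gcd; apply/andP; split; last by rewrite -ow order_dvdG.
    by rewrite -(orderJ b h) -e orderJ order_dvdn c15.
  by rewrite dvdn1 order_eq1 => /eqP.
have := subset_leq_card sub; rewrite cardsU dis cards0 subn0.
rewrite (card_support_normedTI TIA) (card_support_normedTI (prime_cycle_normedTI E pr_w)).
have -> : #|<[w]>^#%g| = 6%N by have := cardsD1 1%g <[w]>%g; rewrite group1 -orderE ow => -[].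
have e1 := Lagrange (subsetIl E 'C[y])%g; have e2 := Lagrange (subsetIl E 'N(<[w]>))%g.
have n21 := dvdn_leq (isT : (0 < 21)%N) (card_norm7 wE ow).
rewrite /= in e1 e2 n21 *.
move: cA n21 e1 e2 (cardG_gt0 E); move: (#|'C_E[y]%g|) (#|A|) (#|'N_E(_)%g|) (#|E : 'C_E[y]|%g) (#|E : 'N_E(<[w]>)|%g) (#|E|).
move=> c a n i j e cA n21 e1 e2 e0 le.
have h1 : (4 * e <= 5 * (a * i))%N by rewrite -e1 !mulnA leq_mul2r cA orbT.
have h2 : (e <= 21 * j)%N by rewrite -e2 leq_mul2r n21 orbT.
by move: le h1 h2 e0; move: (a * i)%N; clear; lia.
Qed.

(** The only divisors of 315 above 21 that 35 does not divide are 45 and 63. The number of Sylow 5-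
    or 7-subgroups would then be 3 or 9, which is not 1 modulo 5 or 7. *)
Lemma odd_card_lt22 : (#|E| %| 315)%N -> (#|E| < 22)%N.
Proof.
move=> d315; rewrite ltnNge; apply/negP => c22; have n35 := odd_card_not35.
have syl p y : prime p -> y \in E -> #[y]%g = p -> (#|E|`_p = p)%N ->
    #|'Syl_p(E)%g| = #|E : 'N_E(<[y]>)|%g.
  move=> pr_p yE oy ep; apply: card_Syl.
  by rewrite pHallE cycle_subG yE -orderE oy ep eqxx.
have : #|E| \in divisors 315 by rewrite -dvdn_divisors.
have -> : divisors 315 = [:: 1; 3; 5; 7; 9; 15; 21; 35; 45; 63; 105; 315]%N by [].
rewrite !inE => cE.
have {}cE : (#|E| == 45%N) || (#|E| == 63%N).
  by move: cE c22 n35; do !(case/orP; [by move/eqP->|]); move/eqP->.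
case/orP: cE => /eqP cE.
  have [||y yE oy] := @Cauchy _ 5 E => //; first by rewrite cE.
  have ep : (#|E|`_5 = 5)%N by rewrite cE p_part.
  have := card_Syl_mod E (isT : prime 5); rewrite (syl 5%N _ isT yE oy ep) norm_cent5 //.
  have := Lagrange (subsetIl E 'C[y])%g; rewrite cE.
  have d5 : (5 %| #|'C_E[y]%g|)%N by rewrite -oy order_dvdG // inE yE cent1id.
  have : (#|'C_E[y]%g| \in divisors 15) by rewrite -dvdn_divisors // card_cent5.
  rewrite !inE => /or4P[] /eqP e; rewrite e in d5 * => //; move: (#|_ : _|%g) => i.
    by move/eqP; rewrite -[45%N]/(5 * 9)%N eqn_pmul2l // => /eqP->.
  by move/eqP; rewrite -[45%N]/(15 * 3)%N eqn_pmul2l // => /eqP->.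
have [||y yE oy] := @Cauchy _ 7 E => //; first by rewrite cE.
have ep : (#|E|`_7 = 7)%N by rewrite cE p_part.
have := card_Syl_mod E (isT : prime 7); rewrite (syl 7%N _ isT yE oy ep).
have := Lagrange (subsetIl E 'N(<[y]>))%g; rewrite cE.
have d7 : (7 %| #|'N_E(<[y]>)%g|)%N.
  by rewrite -oy order_dvdG // inE yE (subsetP (normG _)) ?cycle_id.
have : (#|'N_E(<[y]>)%g| \in divisors 21) by rewrite -dvdn_divisors // card_norm7.
rewrite !inE => /or4P[] /eqP e; rewrite e in d7 * => //; move: (#|_ : _|%g) => i.
  by move/eqP; rewrite -[63%N]/(7 * 9)%N eqn_pmul2l // => /eqP->.
by move/eqP; rewrite -[63%N]/(21 * 3)%N eqn_pmul2l // => /eqP->.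
Qed.

End OddGL42.

Section SymmetrizerGroups.
Local Open Scope ring_scope.
Variables (F : finFieldType).
Local Notation q := #|F|.

(** There are 960 symmetric matrices with nonzero first row. One more singular matrix, the unit at
    (0,0), has to go: |GL_4(2)| = 960 * 21, and the bound |D| > 21 must be strict. *)
Lemma card_invsym4 : q = 2%N -> (#|invsym F 3| <= 959)%N.
Proof.
move=> F2; pose T := ('rV[F]_4 * 'rV[F]_3 * (F * F * F))%type.
pose t0 : T := (delta_mx 0 0, 0, (0, 0, 0)).
pose f (S : 'M[F]_4) : T := (row 0 S, \row_(j < 3) S 1 (lift 0 j), (S 2%:R 2%:R, S 2%:R 3%:R, S 3%:R 3%:R)).
pose U := setX (setX [set~ 0 : 'rV[F]_4] [set: 'rV[F]_3]) [set: F * F * F].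
have cU : #|U :\ t0| = 959%N.
  have := cardsD1 t0 U; rewrite !in_setX !inE /= andbT.
  have -> : delta_mx 0 0 == 0 :> 'rV[F]_4 = false.
    by apply/negbTE/eqP => /matrixP/(_ 0 0)/eqP; rewrite !mxE eqxx oner_eq0.
  by rewrite !cardsX cardsC1 !cardsT !card_prod !card_mx F2 => -[].
have sy (X : 'M[F]_4) i j : X^T = X -> X i j = X j i by move=> e; rewrite -[in LHS]e mxE.
have four (i : 'I_4) : [\/ i = 0, i = 1, i = 2%:R | i = 3%:R].
  by case: i => [[|[|[|[|]]]]] // ?; [constructor 1|constructor 2|constructor 3|constructor 4]; exact: val_inj.
rewrite -cU -(@card_in_imset _ _ f).
  apply/subset_leq_card/subsetP => x /imsetP[S]; rewrite inE => /andP[/eqP sS uS] ->.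
  rewrite in_setD1 !in_setX !inE /= !andbT; apply/andP; split.
    apply/eqP => -[e0 e1 e22 e23 e33].
    have : S *m delta_mx 3%:R (0 : 'I_1) = 0.
      apply/matrixP => i j; rewrite -colE !mxE; case: (four i) => ->; rewrite ?e23 ?e33 //.
        by have := congr1 (fun X : 'rV_4 => X 0 3%:R) e0; rewrite !mxE.
      by have := congr1 (fun X : 'rV_3 => X 0 2%:R) e1; rewrite !mxE => <-; congr (S _ _); exact: val_inj.
    move/(unit_kernel uS)/matrixP/(_ 3%:R 0)/eqP; by rewrite !mxE !eqxx oner_eq0.
  apply/eqP => r0; have : (delta_mx 0 0 : 'rV[F]_4) *m S = 0 by rewrite -rowE.
  move/(congr1 (mulmx^~ (invmx S))); rewrite mulmxK // mul0mx => /matrixP/(_ 0 0)/eqP.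
  by rewrite !mxE eqxx oner_eq0.
move=> S S'; rewrite !inE => /andP[/eqP sS _] /andP[/eqP sS' _] [e0 e1 e22 e23 e33].
have r0 j : S 0 j = S' 0 j by have := congr1 (fun X : 'rV_4 => X 0 j) e0; rewrite !mxE.
have r1 j : S 1 j = S' 1 j.
  have [k ->|->] := unliftP 0 j; first by have := congr1 (fun X : 'rV_3 => X 0 k) e1; rewrite !mxE.
  by rewrite (sy S) // (sy S') // r0.
apply/matrixP => i j; case: (four i) => ->; rewrite ?r0 ?r1 //; case: (four j) => ->;
  by rewrite ?e22 ?e23 ?e33 // (sy S) // (sy S') // ?r0 ?r1 ?e23.
Qed.

Variable n : nat.
Hypothesis ch2 : 2%N \in [pchar F].
Variable D : {group {'GL_n.+1[F]}}.
Hypotheses (oD : odd #|D|) (ZD : forall c : F, c != 0 -> exists2 z, z \in D & GLval z = c%:M).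
Hypothesis symD : forall X : 'M[F]_n.+1, exists2 g, g \in D & (GLval g *m X)^T = GLval g *m X.

(** If u and w are independent, l^-1 h induces on their plane an element of the restricted group
    fixing u, which is trivial by [symmetrizers_dim2_semiregular]. *)
Lemma symmetrizers_star (h : {'GL_n.+1[F]}) (u w : 'cV[F]_n.+1) l a b : h \in D -> u != 0 ->
  GLval h *m u = l *: u -> GLval h *m w = a *: u + b *: w -> GLval h *m w = l *: w.
Proof.
move=> hD u0 hu hw; have [[k ->]|r2] := indep_cols w u0.
  by rewrite -scalemxAr hu !scalerA mulrC.
pose P : 'M[F]_(n.+1, 2) := row_mx u w.
have [L LP] : exists L, L *m P = 1%:M.
  have : row_free P^T by rewrite /row_free mxrank_tr r2.
  case/row_freeP => L e; exists L^T; by rewrite -[P]trmxK -trmx_mul e trmx1.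
pose g : 'M[F]_2 := \matrix_(i, j) (if j == 0 then (if i == 0 then l else 0) else if i == 0 then a else b).
have ePg (x y : F) : P *m (\col_(i < 2) if i == 0 then x else y) = x *: u + y *: w.
  have -> : (\col_(i < 2) if i == 0 then x else y) = col_mx (x%:M : 'M_1) (y%:M : 'M_1).
    apply/matrixP => i j; rewrite !mxE ord1; case: splitP => k ki; rewrite ord1 !mxE eqxx mulr1n.
      by rewrite (_ : i = 0) //; apply: val_inj; rewrite /= ki ord1.
    by rewrite (_ : i = 1) //; apply: val_inj; rewrite /= ki ord1.
  by rewrite /P (@mul_row_col _ _ 1 1) !mul_mx_scalar.
have hP : GLval h *m P = P *m g.
  rewrite {1}/P (mul_mx_row _ u w) hu hw; apply/matrixP => i j.
  have -> : (P *m g) i j = (P *m col j g) i 0 by rewrite !mxE; apply: eq_bigr => k _; rewrite !mxE.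
  have cg : col j g = \col_(k < 2) if k == 0 then (if j == 0 then l else a) else (if j == 0 then 0 else b).
    by apply/matrixP => k z; rewrite !mxE; case: (j == 0); case: (k == 0).
  rewrite cg ePg mxE; case: splitP => k jk; rewrite ord1 in jk *.
    by rewrite (_ : j = 0) ?eqxx ?scale0r ?addr0 //; apply: val_inj.
  by rewrite (_ : j = 1) //; apply: val_inj.
have l0 : l != 0.
  apply: contra u0 => /eqP l0; apply/eqP; rewrite -[u](mulKmx (GL_unitmx h)).
  by rewrite [X in _ *m X]hu l0 scale0r mulmx0.
have ug : g \in unitmx.
  have : (L *m invmx (GLval h) *m P) *m g = 1%:M.
    by rewrite -mulmxA -hP -mulmxA mulKmx ?LP // (GL_unitmx h).
  by case/mulmx1_unit.
have [g0 g0E] := GL_of_unit ug.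
have gR : g0 \in restriction_group D P by apply/restrictionP; exists h; rewrite ?g0E.
have ZR := restriction_scalars P ZD.
have [z zR zE] := ZR l^-1 (invr_neq0 l0).
pose e0 : 'cV[F]_2 := delta_mx 0 0.
have e00 : e0 != 0 by apply/eqP => /matrixP/(_ 0 0)/eqP; rewrite !mxE eqxx oner_eq0.
have : (z * g0 = 1)%g.
  apply: (symmetrizers_dim2_semiregular ch2 (restriction_odd LP oD) ZR
    (restriction_symmetrizer LP symD) (groupM zR gR) e00).
  rewrite GL_MxE zE g0E mul_scalar_mx -scalemxAl -colE.
  apply/matrixP => i j; rewrite !mxE /= ord1 eqxx andbT.
  by case: eqP; rewrite ?mulVf ?mulr0.
move/(congr1 (@GLval _ _)); rewrite GL_MxE zE g0E mul_scalar_mx GL_1E => e.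
have : g = l%:M by rewrite -[g]scale1r -(mulfV l0) -scalerA e scale_scalar_mx mulr1.
move=> gl; have := congr1 (fun X : 'M_2 => X 0 1) gl; have := congr1 (fun X : 'M_2 => X 1 1) gl.
by rewrite !mxE /= hw => -> ->; rewrite scale0r add0r mulr1n.
Qed.

Lemma symmetrizers_dim_ge3 : (2 <= n)%N -> (q < 4)%N.
Proof.
move=> n2; rewrite ltnNge; apply/negP => q4.
pose P : 'M[F]_(n.+1, 3) := pid_mx 3; pose L : 'M[F]_(3, n.+1) := pid_mx 3.
have LP : L *m P = 1%:M by rewrite mul_pid_mx minnn (minn_idPr _) ?pid_mx_1.
apply: (@symmetrizers_dim3 F {'GL_3[F]} (@GLval 3 F) _ _ _ ch2 (restriction_group D P)
  (restriction_odd LP oD) (restriction_scalars P ZD) (restriction_symmetrizer LP symD) _ q4) => //.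
  exact: val_inj.
move=> h u w l a b /restrictionP[c cD cP] u0 hu hw.
have Pi (v v' : 'cV[F]_3) : P *m v = P *m v' -> v = v'.
  by move/(congr1 (mulmx L)); rewrite !mulmxA LP !mul1mx.
apply: (Pi); rewrite mulmxA -cP -mulmxA -scalemxAr.
apply: (@symmetrizers_star c (P *m u) (P *m w) l a b) => //.
- by apply: contra u0 => /eqP e; apply/eqP/Pi; rewrite e mulmx0.
- by rewrite mulmxA cP -mulmxA hu scalemxAr.
by rewrite mulmxA cP -mulmxA hw mulmxDr !scalemxAr.
Qed.

Lemma symmetrizers_dim_ge4 : (3 <= n)%N -> q = 2%N -> False.
Proof.
move=> n3 F2.
pose P : 'M[F]_(n.+1, 4) := pid_mx 4; pose L : 'M[F]_(4, n.+1) := pid_mx 4.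
have LP : L *m P = 1%:M by rewrite mul_pid_mx minnn (minn_idPr _) ?pid_mx_1.
pose E := restriction_group D P; have oE := restriction_odd LP oD.
have ZE := restriction_scalars P ZD.
have cGL : #|'GL_4[F]%g| = (64 * 315)%N.
  by rewrite card_GL // F2 big_nat_recr // big_nat_recr // big_nat_recr // big_nat1.
have dE : (#|E| %| 315)%N.
  have := cardSg (subsetT E); rewrite [#|[set: _]|]cGL Gauss_dvdr //.
  by rewrite (_ : 64 = 2 ^ 6)%N // coprimeXr // coprimen2.
have lt := @odd_card_lt22 F {'GL_4[F]} (@GLval 4 F) erefl (fun _ _ => erefl) val_inj F2 E oE dE.
have := symmetrizer_count (rho := @GLval 4 F) erefl (fun _ _ => erefl) ZE (restriction_symmetrizer LP symD).
rewrite card_unitmx cGL F2 mul1n; have := card_invsym4 F2.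
move: lt; move: (#|invsym F 3|) (#|_|) => s e lt le.
move/leq_trans => /(_ _ (leq_mul (leqnn e) le)).
by move: lt; clear; lia.
Qed.

End SymmetrizerGroups.

(** * Two factors: the swap as matrix transposition *)

Section TwoFactors.
Local Open Scope ring_scope.
Variables (F : finFieldType) (n : nat).
Hypothesis ch2 : 2%N \in [pchar F].
Local Notation q := #|F|.
Local Notation m := n.+1.
Local Notation V := (tensV F m 2).

Definition pr2 (i j : 'I_m) : {ffun 'I_2 -> 'I_m} := [ffun k => if k == 0 then i else j].
Definition mat2 (v : V) : 'M[F]_m := \matrix_(i, j) v (pr2 i j).

Lemma pr2E (f : {ffun 'I_2 -> 'I_m}) : pr2 (f 0) (f 1) = f.
Proof. by apply/ffunP => k; rewrite ffunE; have [->|->] := ord2_cases k. Qed.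

Lemma mat2_tens (A : 'I_2 -> 'M[F]_m) v : mat2 (tens_act A v) = A 0 *m mat2 v *m (A 1)^T.
Proof.
apply/matrixP => i j; rewrite !mxE ffunE.
rewrite (reindex (fun u : 'I_m * 'I_m => pr2 u.1 u.2)) /=; last first.
  exists (fun f : {ffun 'I_2 -> 'I_m} => (f 0, f 1)) => [[k l]|f] _ /=; first by rewrite !ffunE.
  exact: pr2E.
rewrite -(pair_bigA _ (fun k l => (\prod_(z < 2) A z (pr2 i j z) (pr2 k l z)) * v (pr2 k l))) /=.
rewrite exchange_big /=; apply: eq_bigr => l _; rewrite !mxE mulr_suml; apply: eq_bigr => k _.
rewrite big_ord_recl big_ord1 !ffunE /= !mxE.
have -> : lift ord0 ord0 = 1 :> 'I_2 by apply: val_inj.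
by rewrite mulrAC.
Qed.

Lemma mat2_swap (s : 'S_2) v : s 0 = 1 -> s 1 = 0 -> mat2 (perm_act s v) = (mat2 v)^T.
Proof.
move=> s0 s1; apply/matrixP => i j; rewrite !mxE ffunE; congr (v _); apply/ffunP => k.
by rewrite !ffunE; have [->|->] := ord2_cases k; rewrite ?s0 ?s1.
Qed.

Lemma mat2_surj M : exists v, mat2 v = M.
Proof.
by exists [ffun f : {ffun 'I_2 -> 'I_m} => M (f 0) (f 1)]; apply/matrixP => i j; rewrite mxE !ffunE.
Qed.

Variables (G H : {group {perm V}}).
Hypotheses (sG : G \subset tensor_group F m 2) (cop : forall v, coprime #|orbit 'P G v| 2).
Hypotheses (HE : forall y, (y \in H) = (y \in G) && (sg y == 1%g)) (oH : odd #|H|).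
Variable x : {perm V}.
Hypotheses (n1 : (0 < n)%N) (xG : x \in G) (x2 : (x ^+ 2 = 1)%g) (sx : sg x != 1%g).

Let m1 : (1 < m)%N. Proof. by []. Qed.

Let swapP (s : 'S_2) : s != 1%g -> s 0 = 1 /\ s 1 = 0.
Proof.
move=> s1; have s0 : s 0 = 1.
  have [e|//] := ord2_cases (s 0); case/eqP: s1; apply/permP => k; rewrite perm1.
  have [->//|->] := ord2_cases k; have [e1|//] := ord2_cases (s 1).
  by have := perm_inj (etrans e (esym e1)).
split=> //; have [//|e1] := ord2_cases (s 1).
by have := perm_inj (etrans s0 (esym e1)).
Qed.

(** x fixes g^-1 v for some g in [G]. If g swaps the positions, then g^-1 x lies in [H] and sends v
    to the same vector. *)
Lemma fixed_by_base_conj v : exists2 h, h \in H & x (h v) = h v.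
Proof.
have px : (2.-elt x)%g.
  by apply: (@pnat_dvd _ 2); [rewrite order_dvdn x2|rewrite pnat_id].
have [g gG /setIP[_ /astab1P]] := p_elt_conj_astab1 (subxx G) (subsetIl _ _) (cop v) (isT : prime 2) xG px.
rewrite -[LHS]/((x ^ g)%g v) conjgE !permM => fx.
have fg : x (g^-1%g v) = g^-1%g v by apply: (@perm_inj _ g); rewrite fx permKV.
have [s1|s1] := eqVneq (sg g) 1%g.
  by exists g^-1%g => //; rewrite groupV HE gG s1 eqxx.
exists (g^-1 * x)%g; last by rewrite permM !fg.
rewrite HE groupM ?groupV //= (sgMG m1 sG) ?groupV // (sgVG m1 sG) //.
have -> : sg g = sg x.
  have [a0 a1] := swapP s1; have [b0 b1] := swapP sx.
  by apply/permP => k; have [->|->] := ord2_cases k; rewrite ?a0 ?b0 ?a1 ?b1.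
by rewrite mulVg eqxx.
Qed.

Lemma two_factors_small : (2 <= n)%N -> n = 2%N /\ q = 2%N.
Proof.
move=> n2; have [A rx] := sg_rep m1 (subsetP sG _ xG); have [s0 s1] := swapP sx.
have := repM rx rx; rewrite -[(x * x)%g]/(x ^+ 2)%g x2 => r2.
have ssx := rep1_perm m1 r2; rewrite ssx in r2.
have [l l0 AA] : exists2 l, l != 0 & A 1 *m A 0 = l%:M.
  have [l l0] := rep_scalar 1 r2 (rep1 F m 2); rewrite -[in A (_ 1)]s0 permK => e.
  by exists l => //; rewrite e scalemx1.
pose D := parts_group H 0; have oD : odd #|D| := odd_parts 0 ch2 oH.
have ZD (c : F) : c != 0 -> exists2 z, z \in D & GLval z = c%:M by exact: scalar_parts.
have LP : invmx (A 0) *m A 0 = 1%:M by rewrite mulVmx // rx.1.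
(* Restriction along the invertible [A 0] means conjugating [D] by it; this absorbs the matrix by
   which x differs from a plain transposition. *)
have symD N : exists2 g, g \in restriction_group D (A 0) & (GLval g *m N)^T = GLval g *m N.
  have [v vE] := mat2_surj (A 0 *m N); have [h hH fh] := fixed_by_base_conj v.
  have hG : h \in G by move: hH; rewrite HE => /andP[].
  have sh : sg h = 1%g by move: hH; rewrite HE => /andP[_ /eqP].
  have [B rB] := sg_rep m1 (subsetP sG _ hG); rewrite sh in rB.
  pose W := mat2 (h v).
  have WE : W = B 0 *m A 0 *m N *m (B 1)^T by rewrite /W rB.2 perm_act1 mat2_tens vE !mulmxA.
  have fW : W = A 0 *m W^T *m (A 1)^T by rewrite {1}/W -fh rx.2 mat2_tens mat2_swap.
  have sW : (A 1 *m W)^T = l^-1 *: (A 1 *m W).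
    rewrite trmx_mul {2}fW !mulmxA AA mul_scalar_mx -scalemxAl scalerA mulVf // scale1r.
    by [].
  (* Transposing twice gives l^-2 = 1 unless A_1 W = 0, and then l = 1 in characteristic 2. *)
  have symW : (A 1 *m W)^T = A 1 *m W.
    have [->|W0] := eqVneq (A 1 *m W) 0; first by rewrite trmx0.
    have := congr1 trmx sW; rewrite trmxK linearZ /= sW scalerA -{1}[A 1 *m W]scale1r => /eqP.
    rewrite -subr_eq0 -scalerBl scaler_eq0 (negbTE W0) orbF subr_eq0 -expr2 eq_sym sqrf_eq1.
    by rewrite (oppr_pchar2 ch2) orbb => /eqP e; rewrite e scale1r.
  (* W is fixed by x, so A1 W is symmetric, and C N = B1^-1 (A1 W) B1^-T. *)
  pose C := invmx (B 1) *m A 1 *m B 0 *m A 0.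
  have uC : C \in unitmx by rewrite !unitmx_mul unitmx_inv !rx.1 !rB.1.
  have [g gE] := GL_of_unit uC; exists g.
    (* An element of [H] whose component at position 0 is A_0 C A_0^-1. *)
    pose k := (h * (x * h^-1 * x))%g.
    have rk : rep k _ _ := repM rB (repM (repM rx (repV rB)) rx).
    rewrite invg1 mulg1 ssx mulg1 in rk.
    have uP : A 0 *m invmx (B 1) *m A 1 *m B 0 \in unitmx.
      by rewrite !unitmx_mul unitmx_inv !rx.1 !rB.1.
    have [p pE] := GL_of_unit uP.
    apply/restrictionP; exists p; last by rewrite pE gE /C !mulmxA.
    apply/partsP; exists k; eexists; split; [|exact: rk|].
      rewrite HE (sgE m1 rk) eqxx andbT; rewrite !groupM ?groupV //.
    have sV0 : (sg x)^-1%g 0 = 1 by apply: (@perm_inj _ (sg x)); rewrite permKV s1.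
    by rewrite /= !(invg1, perm1, sV0) pE !mulmxA.
  rewrite gE; have CN : C *m N = invmx (B 1) *m (A 1 *m W) *m (invmx (B 1))^T.
    by rewrite WE /C trmx_inv !mulmxA mulmxK ?unitmx_tr ?rB.1.
  by rewrite CN trmx_mul trmxK trmx_mul symW !mulmxA.
have oR := restriction_odd LP oD; have ZR := restriction_scalars (A 0) ZD.
have q4 := symmetrizers_dim_ge3 ch2 oR ZR symD n2.
have q2 : q = 2%N.
  have [k k0 e] := card_pchar ch2; rewrite e in q4 *; case: k k0 q4 {e} => [|[|k]] // _.
  by rewrite ltnNge (@leq_pexp2l 2 2).
split=> //; apply/eqP; rewrite eqn_leq n2 andbT leqNgt; apply/negP => n3.
exact: (symmetrizers_dim_ge4 oR ZR symD n3 q2).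
Qed.

End TwoFactors.

Lemma involution3_shape (s : 'S_3) : (s * s = 1)%g -> s != 1%g ->
  exists a b c, [/\ uniq [:: a; b; c], s a = b, s b = a, s c = c & forall i, i \in [:: a; b; c]].
Proof.
move=> ss s1; have sK i : s (s i) = i by rewrite -permM ss perm1.
have [a na] : exists a, s a != a.
  apply/existsP; rewrite -negb_forall; apply: contra s1 => /forallP h.
  by apply/eqP/permP => i; rewrite perm1 (eqP (h i)).
have [c] : exists c, c \notin [:: a; s a].
  apply/existsP; rewrite -negb_forall; apply/negP => /forallP h.
  have sub : {subset enum 'I_3 <= [:: a; s a]} by move=> i _; exact: h.
  by have := uniq_leq_size (enum_uniq 'I_3) sub; rewrite size_enum_ord.
rewrite !inE negb_or => /andP[ca csa].
have un : uniq [:: a; s a; c].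
  by rewrite /= !inE negb_or [a == s a]eq_sym na [a == c]eq_sym ca [s a == c]eq_sym csa.
have all3 i : i \in [:: a; s a; c].
  have sub : {subset [:: a; s a; c] <= enum 'I_3} by move=> j _; rewrite mem_enum.
  by have [|_ ->] := uniq_min_size un sub; rewrite ?size_enum_ord ?mem_enum.
exists a, (s a), c; split=> //; have := all3 (s c); rewrite !inE => /or3P[]/eqP e //.
  by move: csa; rewrite -e sK eqxx.
by have := perm_inj e => h; rewrite h eqxx in ca.
Qed.

(** * The kernel on positions and the case distinction *)

Section Main.
Variables (F : finFieldType) (p m t : nat).
Hypotheses (hp : prime p) (hchar : (p \in [pchar F])%R) (hm : 2 <= m) (ht : 2 <= t).
Variable G : {group {perm tensV F m t}}.
Hypotheses (hG : preserves_tensor_induced G) (hexc : p_exceptional p G).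

Let sG : G \subset tensor_group F m t.
Proof. by apply/subsetP => x /hG[A [s h]]; apply/tensor_groupP; exists A, s. Qed.

Let cop v : coprime #|orbit 'P G v| p. Proof. exact: hexc.2. Qed.

Definition base_group := (G :&: 'ker (sgm F t hm))%G.

Lemma base_groupE y : (y \in base_group) = (y \in G) && (sg y == 1%g).
Proof.
rewrite inE; apply: andb_id2l => yG; have yT := subsetP sG _ yG.
by apply/idP/eqP => [/(kerP (sgm F t hm) yT)|/(kerP (sgm F t hm) yT)].
Qed.

Lemma base_group_dvd : p %| #|base_group| -> [/\ p = 2, m = 2 & t = 2].
Proof.
move=> pH; apply: (fixed_position_p_exceptional hm ht hp hchar (c := Ordinal (ltnW ht)) (K := base_group)).
- by apply: subset_trans sG; exact: subsetIl.
- by move=> y; rewrite base_groupE => /andP[_ /eqP->]; rewrite perm1.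
split=> // v; apply: coprime_dvdl (cop v); apply: normal_orbit_dvd.
by apply: normalGI sG _; exact: ker_normal.
Qed.

Lemma positions_moved : 2 < t -> forall c, exists2 y, y \in G & sg y c != c.
Proof.
move=> t3 c; apply/exists_inP; rewrite -negb_forall_in; apply/negP => /forall_inP h.
have fixc y : y \in G -> sg y c = c by move=> yG; apply/eqP/h.
have [_ _ t2] := fixed_position_p_exceptional hm ht hp hchar sG fixc hexc.
by rewrite t2 in t3.
Qed.

(** An element of order p acting trivially on the positions would lie in the kernel. *)
Lemma swapping_element : ~~ (p %| #|base_group|) ->
  exists x, [/\ x \in G, (x ^+ p = 1)%g & sg x != 1%g].
Proof.
move=> pH; have [x xG ox] := Cauchy hp hexc.1; exists x; split=> //; first by rewrite -ox expg_order.
apply: contra pH => s1; rewrite -ox; apply: order_dvdG.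
by rewrite base_groupE xG.
Qed.

End Main.

Theorem theorem5p1 (F : finFieldType) (p m t : nat)
  (hp : prime p) (hchar : (p \in [pchar F])%R)
  (hm : (2 <= m)%N) (ht : (2 <= t)%N)
  (G : {group {perm tensV F m t}})
  (hG : preserves_tensor_induced G)
  (hexc : p_exceptional p G) :
  p = 2 /\
  [\/ t = 4 /\ m = 2 /\ #|F| = 2,
      t = 3 /\ (m = 2 \/ m = 3) /\ (m = 3 -> #|F| = 2) /\ (m = 2 -> #|F| <= 4)
    | t = 2 /\ (m = 2 \/ m = 3) /\ (m = 3 -> #|F| <= 8)]%N.
Proof.
case: (boolP (p %| #|base_group hm G|)) => [/(base_group_dvd hp hchar ht hG hexc)[-> -> ->]|pH].
  by split=> //; constructor 3; split=> //; split=> //; left.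
have [x [xG xp sx]] := swapping_element hp hG hexc pH.
have sG : G \subset tensor_group F m t by apply/subsetP => y /hG[A [s h]]; apply/tensor_groupP; exists A, s.
have cop v : coprime #|orbit 'P G v| p by exact: hexc.2.
have px : (p.-elt x)%g by apply: (@pnat_dvd _ p); [rewrite order_dvdn xp|rewrite pnat_id].
have t6 := at_most_six_factors hm hp sG cop xG px sx.
have [p2|op] := even_prime hp; last first.
  by case: (odd_small_t hm hp sG cop xG px sx op); rewrite ht.
split=> //; subst p; have x2 := xp.
(* [H] keeps only the membership test of [base_group], so that t and m can be rewritten in the
   context. *)
have [H [oH HE]] : exists H : {group {perm tensV F m t}}, odd #|H| /\
    forall y, (y \in H) = (y \in G) && (sg y == 1%g).
  exists (base_group hm G); split; last exact: base_groupE.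
  by rewrite -[odd _]negbK -dvdn2.
have ss : (sg x * sg x = 1)%g.
  by rewrite -(sgMG hm sG) // -[(x * x)%g]/(x ^+ 2)%g x2 (sgE hm (rep1 F m t)).
have moved := positions_moved hp hchar hm ht hG hexc.
have qpow : exists2 k, 0 < k & #|F| = 2 ^ k by exact: card_pchar hchar.
(* The range 3 < t <= 6 is contradictory, so the first alternative is never selected. *)
have [t4|t3] := ltnP 3 t.
  have [] := distinguished_triple hm sG cop (erefl 2) (moved (ltnW t4)) (x := x) _ xG _ sx.
  - by rewrite t4.
  - by rewrite expgS expg1.
  move=> a [b [c [un sa sb sc fixc]]].
  by case: (no_distinguished_triple hm hchar sG cop xG x2 un sa sb sc).
have [t3'|t2] := ltnP 2 t.
  have e3 : t = 3 by apply/eqP; rewrite eqn_leq t3.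
  constructor 2; split=> //.
  move: G H hG hexc x xG sx xp x2 sG cop px oH HE ss moved {pH}; rewrite e3.
  move=> {}G H {}hG {}hexc x xG sx xp x2 sG cop px oH HE ss moved.
  have [a [b [c [un sa sb sc all3]]]] := involution3_shape ss sx.
  have [m3|m2] := ltnP 2 m.
    by case: (three_factors_small hm hchar sG cop xG x2 un sa sb sc all3 m3).
  have e2 : m = 2 by apply/eqP; rewrite eqn_leq m2.
  split; first by left.
  split; first by rewrite e2.
  (* Since q is a power of 2, q < 8 amounts to q <= 4. *)
  move=> _; have q8 : #|F| < 8.
    subst m.
    exact: (three_qubits_small hchar sG cop HE oH xG x2 un sa sb sc).
  have [k k0 e] := qpow; rewrite e in q8 *; case: k {k0 e} q8 => [|[|[|k]]] //.
  by rewrite ltnNge (@leq_pexp2l 2 3).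
have e2 : t = 2 by apply/eqP; rewrite eqn_leq t2.
constructor 3; split=> //.
have [m3|m2] := ltnP 2 m; last first.
  have em : m = 2 by apply/eqP; rewrite eqn_leq m2.
  by split; [left|rewrite em].
move: G H hG hexc x xG sx xp x2 sG cop px oH HE ss moved {pH}; rewrite e2.
case: m hm m3 => // n hm n2 {}G H {}hG {}hexc x xG sx xp x2 sG cop px oH HE ss moved.
have [en eq] := two_factors_small hchar sG cop HE oH (ltnW n2) xG x2 sx n2.
by split; [right; rewrite en|rewrite eq].
Qed.
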